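(* Let $\delta,\kappa,\sigma,\beta,\beta'>0$ be constants with $\beta=\beta'$ satisfying \[ \kappa>\delta^{-1},\qquad \delta^{-1}<\frac{\kappa+\sigma\delta}{2},\qquad 2\sigma>\max(\beta,\beta')+\frac{\delta^{-1}(1+o(1))}{3\beta}+\frac{(\sigma\delta+\kappa)(1+o(1))}{3\beta'}. \] Then, as $n\to\infty$, \[ \mathbb{E}_{m,f}\big(|\mathcal{X}_{n,m,f}|\big)\ \ge\ L_n\!\left(\tfrac13,\tau\right),\qquad \tau=2\sigma-\frac{\delta^{-1}}{3\beta'}(1+o(1))-\frac{\sigma\delta+\kappa}{3\beta}(1+o(1)), \] where the expectation is over $m$ and $f$ chosen randomly as described in the context.
   Context: Notation: $L_n(a,c)=\exp\!\big(c(\log n)^a(\log\log n)^{1-a}\big)$; $o(1)$ denotes quantities tending to $0$ as $n\to\infty$; $\mathbb{I}(L)=[-L/2,L/2)\cap\mathbb{Z}$. An integer $z\ne0$ is $y$-smooth if every prime $p\mid z$ satisfies $p<y$. Put $B=L_n(1/3,\beta)$, $B'=L_n(1/3,\beta')$, and let $d=\delta(\log n/\log\log n)^{1/3}$, taken to be an odd integer. Random choice of $(m,f)$: $m$ is a uniformly random integer in $[2^{-1/d}L_n(2/3,\delta^{-1}),L_n(2/3,\delta^{-1})]$; $\hat f_{n,m}(x,y)=\sum_i C_i x^{d-i}y^i$ where the $C_i\in[0,m)$ are the digits of the base-$m$ expansion of $n$ (so $\hat f_{n,m}(m,1)=n$); $c_0,\dots,c_{d-1}$ are independent uniform elements of $\mathbb{I}(2L_n(2/3,\kappa-\delta^{-1}))$;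 and \[ f(x,y)=\hat f_{n,m}(x,y)+\sum_{i=0}^{d-1}c_i(x-my)x^{d-i-1}y^i. \] For such $n,m,f$, $\mathcal{X}_{n,m,f}$ is the set of pairs of integers $(a,b)$ with $0\le a<|b|$, $|b|\in[\tfrac12L_n(1/3,\sigma),L_n(1/3,\sigma)]$, such that $a-bm$ is $B$-smooth and $f(a,b)$ is $B'$-smooth. *)

(* Defs.v *)
From mathcomp Require Import all_boot all_order all_algebra.
From mathcomp Require Import finmap.
From mathcomp Require Import all_classical all_reals all_analysis.

Set Implicit Arguments.
Unset Strict Implicit.
Unset Printing Implicit Defensive.

Import Order.TTheory GRing.Theory Num.Theory.
Import numFieldNormedType.Exports.

Local Open Scope classical_set_scope.
Local Open Scope ring_scope.

Definition Lnfun (R : realType) (n : nat) (a c : R) : R :=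
  expR (c * ln n%:R `^ a * ln (ln n%:R) `^ (1 - a)).

(* All the sets to which these two definitions are applied below are finite;
   [fset_set] sends an infinite set to the empty one. *)
Definition card (T : choiceType) (A : set T) : nat := #|` fset_set A|%fset.

(* The expectation of [F] under the uniform distribution on [A]. *)
Definition uniform_mean (R : realType) (T : choiceType) (A : set T)
    (F : T -> R) : R :=
  (\sum_(x \in A) F x) / (card A)%:R.

Definition smooth (R : realType) (y : R) (z : int) : Prop :=
  z != 0 /\ forall p : nat, prime p -> (p %| `|z|)%N -> p%:R < y.

Definition intI (R : realType) (L : R) : set int :=
  [set z | - (L / 2) <= z%:~R < L / 2].

(* The coefficient of x^(d-i) y^i is the base-m digit of n at m^(d-i), so that
   i = 0 is the leading digit. *)
Definition base_digit (n m d i : nat) : nat := ((n %/ m ^ (d - i)) %% m)%N.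

Definition fhat (n m d : nat) (x y : int) : int :=
  \sum_(i < d.+1) (base_digit n m d i)%:Z * x ^+ (d - i) * y ^+ i.

Definition fpoly (n m d : nat) (c : {ffun 'I_d -> int}) (x y : int) : int :=
  fhat n m d x y +
  \sum_(i < d) c i * (x - m%:Z * y) * x ^+ (d - i - 1) * y ^+ i.

(* For an integer degree d, this is the real number delta_n such that
   d = delta_n (log n / log log n)^(1/3); equivalently
   L_n(2/3, 1/delta_n) = n^(1/d), so that for large n the number n has exactly
   d+1 digits in each of the bases m allowed below. *)
Definition delta_of (R : realType) (n d : nat) : R :=
  d%:R / (ln n%:R / ln (ln n%:R)) `^ (1 / 3).

Definition bases (R : realType) (n d : nat) : set nat :=
  let L := Lnfun n (2 / 3) (delta_of R n d)^-1 in
  [set m | 2 `^ (- d%:R^-1) * L <= m%:R <= L].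

Definition coefs (R : realType) (n d : nat) (kappa : R) :
    set {ffun 'I_d -> int} :=
  [set c | forall i,
    intI (2 * Lnfun n (2 / 3) (kappa - (delta_of R n d)^-1)) (c i)].
Arguments coefs {R} n d kappa.

Definition Xset (R : realType) (n : nat) (sigma beta beta' : R) (m : nat)
    (f : int -> int -> int) : set (int * int) :=
  [set ab | [/\ 0 <= ab.1 < `|ab.2|,
     Lnfun n (1 / 3) sigma / 2 <= `|ab.2|%:~R <= Lnfun n (1 / 3) sigma,
     smooth (Lnfun n (1 / 3) beta) (ab.1 - ab.2 * m%:Z) &
     smooth (Lnfun n (1 / 3) beta') (f ab.1 ab.2)]].

(* A uniform element of the product set is a uniform m together with
   independent uniform c_0, ..., c_(d-1), independent of m. *)
Definition expected_card_X (R : realType) (n d : nat)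
    (kappa sigma beta beta' : R) : R :=
  uniform_mean (bases R n d `*` coefs n d kappa)
    (fun mc => (card (Xset n sigma beta beta' mc.1
                  (fpoly n mc.1 mc.2)))%:R).

(* Main.v *)
(* Take b = -B with B > 0, so that a - b m = a + B m =: q; conversely q
   determines m = q / B and a = q mod B.  As f - fhat is (x - m y) times a
   random form, for fixed (a, b) every integer s = B^d n (mod q) of moderate
   size is, up to sign (d being odd), the value f(a, b) for many coefficient
   vectors c.  So the expectation is at least a weighted number of
   triples (B, q, N) with q, N smooth and N = B^d n (mod q).

   Let q and N run through products of v and k primes taken one from each of
   disjoint dyadic blocks just below y = L_n(1/3, beta).  By a Bertrand-type
   estimate the blocks contain a proportion >> 1 / log y of primes; the loss
   exp (- (k + v) log log y) gives the terms in 1 / (3 beta).  That N is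
   equidistributed modulo q on average over q follows from a large sieve
   without characters: write N = a b c with c long enough; the discrepancy is
   a sum of products of functions of mean zero modulo the primes of q, and
   these are almost orthogonal for distinct q. *)
From mathcomp Require Import all_boot all_order all_algebra.
From mathcomp Require Import finmap.
From mathcomp Require Import all_classical all_reals all_analysis.
From mathcomp Require Import zify ring lra.
Require Import Defs.
Set Implicit Arguments.
Unset Strict Implicit.

(** * Primes in dyadic intervals *)

(** The hypothesis [delta^-1 < (kappa + sigma * delta) / 2] says that log N exceeds 2 log q by a
    positive proportion, and the large sieve consumes exactly this. For conductors of size r the
    off-diagonal terms have periods up to r^2, and the free factor a of N must be longer. An
    interval as weight would ask for r^3; K further convolutions lower this to r^(2 + 1/(K+1)), and
    a second factor b, with about 1/(K+1) times as many primes as the conductor, supplies the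
    saving. So K is dictated by the gap in the hypothesis. The hypothesis [kappa > delta^-1] makes
    the range of the c_i far longer than b, so that it meets each residue class modulo b often.

    Put D = (log n / log log n)^(1/3) and w = log log n. Then log y = beta D w, about delta^-1 D /
    beta primes make up q and (kappa + sigma delta) D / beta make up N. Each of them loses a factor
    O(log y), and log log y is asymptotic to w / 3: hence the 3 in the denominators. The number of
    coefficient vectors and the sizes of q and N cancel against the size of the sample space up to
    L_n(1/3, 2 sigma); all other losses are exp (O(D)) and go into o(1). *)

Lemma dvdn_prod_prime_powers (m N : nat) (f : nat -> nat) :
  0 < m -> (forall p, prime p -> p %| m -> (p < N) && (p ^ logn p m %| f p)) ->
  m %| \prod_(p < N | prime p) f p.
Proof.
move=> m0 H; apply/dvdn_partP => // p; rewrite mem_primes => /and3P[pp _ pm].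
have /andP[pN pf] := H p pp pm.
rewrite (bigD1 (Ordinal pN)) //= p_part.
exact: dvdn_mulr.
Qed.

Lemma prime_dvd_fact_le (p n : nat) : prime p -> p %| n`! -> p <= n.
Proof.
move=> pp; elim: n => [|n IH]; first by rewrite fact0 dvdn1 => /eqP p1; rewrite p1 in pp.
by rewrite factS Euclid_dvdM // => /orP[/dvdn_leq -> //|/IH /leq_trans ->].
Qed.

(** A prime p with k + 1 < p <= 2k + 1 divides (2k + 1)! but neither k! nor (k + 1)!. The product of
    these primes is squarefree, so one prime at a time suffices. *)
Lemma prime_prod_dvd_bin (k : nat) :
  \prod_(p < (2 * k).+2 | prime p && (k.+1 < p)) p %| 'C((2 * k).+1, k).
Proof.
set m := \prod_(p < _ | _) _.
have m0 : 0 < m by apply: prodn_cond_gt0 => i /andP[/prime_gt0].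
(* A product of distinct primes has valuation at most 1 everywhere, and positive valuation only at
   its factors; stated for any duplicate-free list so that induction applies. *)
have Hpr (l : nat) (s : seq 'I_l) (P : pred 'I_l) (p : nat) : uniq s -> prime p ->
   logn p (\prod_(q <- s | prime q && P q) q) <= 1 /\
   (p %| \prod_(q <- s | prime q && P q) q ->
     exists2 q : 'I_l, q \in s & P q && (val q == p)).
  move=> + pp; elim: s => [|q s IH] /=; first by rewrite big_nil logn1 dvdn1 => _; split => // /eqP p1; move: pp; rewrite p1.
  move=> /andP[qs us]; have [IH1 IH2] := IH us; rewrite big_cons; case: ifP => [/andP[pq Pq]|_]; last first.
    split => // /IH2 [x xs ?]; exists x => //; by rewrite inE xs orbT.
  have pos : 0 < \prod_(q <- s | prime q && P q) q.
    by rewrite big_seq_cond; apply: prodn_cond_gt0 => i /andP[_ /andP[/prime_gt0]].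
  split; last first.
    rewrite Euclid_dvdM // => /orP[|/IH2[x xs ?]]; last by exists x => //; rewrite inE xs orbT.
    by rewrite dvdn_prime2 // => /eqP ->; exists q; rewrite ?inE ?Pq eqxx.
  rewrite (lognM _ (prime_gt0 pq) pos) (logn_prime _ pq); case: eqP => [e|_] //=.
  case: (posnP (logn p (\prod_(q <- s | prime q && P q) q))) => [->//|].
  rewrite logn_gt0 mem_primes => /and3P[_ _ /IH2[x xs /andP[Px /eqP xp]]].
  by move: qs; rewrite (_ : q = x) ?xs //; apply/val_inj; rewrite /= xp e.
apply/dvdn_partP => // p; rewrite mem_primes => /and3P[pp _ pm].
have [H1 H2] := Hpr _ (index_enum _) (fun q : 'I_(2 * k).+2 => k.+1 < q) p (index_enum_uniq _) pp.
have {H2}[q _ /andP[kq /eqP qp]] := H2 pm.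
have pC : p %| 'C((2 * k).+1, k).
  have e : 'C((2 * k).+1, k) * (k`! * ((2 * k).+1 - k)`!) = ((2 * k).+1)`! by apply: bin_fact; lia.
  have : p %| ((2 * k).+1)`!.
    by rewrite dvdn_fact // prime_gt0 //= -qp -ltnS; exact: ltn_ord.
  have nf (j : nat) : j <= k.+1 -> p %| j`! = false.
    by move=> jk; apply/negP => /(prime_dvd_fact_le pp); rewrite leqNgt -qp (leq_ltn_trans jk kq).
  by rewrite -e Euclid_dvdM // Euclid_dvdM // !nf ?orbF //; lia.
rewrite p_part; apply: (@dvdn_trans (p ^ 1)); last by rewrite expn1.
by apply: dvdn_exp2l.
Qed.

(** The two middle coefficients are equal and both occur in the expansion of 2^(2k+1). *)
Lemma bin_odd_le (k : nat) : 'C((2 * k).+1, k) <= 4 ^ k.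
Proof.
have : \sum_(i < (2 * k).+2) 'C((2 * k).+1, i) = 2 ^ (2 * k).+1.
  by rewrite (expnDn 1 1) ; apply: eq_bigr => i _; rewrite !exp1n !muln1.
have kL : k < (2 * k).+2 by lia.
have kL' : k.+1 < (2 * k).+2 by lia.
rewrite (bigD1 (Ordinal kL)) //= (bigD1 (Ordinal kL')) /=; last first.
  by rewrite -val_eqE /=; lia.
have -> : 'C((2 * k).+1, k.+1) = 'C((2 * k).+1, k).
  have kk : k <= (2 * k).+1 by lia.
  by rewrite -(bin_sub kk); congr 'C(_, _); lia.
by rewrite expnS expnM -[2 ^ 2]/4; lia.
Qed.

(** Strong induction: an even n > 2 is not prime. For n = 2k + 1 the primes up to k + 1 contribute
    at most 4^(k+1), and the product of the larger ones divides C(2k+1, k) <= 4^k. *)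
Lemma primorial_le (n : nat) : \prod_(p < n.+1 | prime p) p <= 4 ^ n.
Proof.
elim/ltn_ind: n => n IH.
have [->|n0] := eqVneq n 0; first by rewrite big_mkcond big_ord_recl big_ord0.
have [->|n1] := eqVneq n 1; first by rewrite big_mkcond 2!big_ord_recl big_ord0.
have [->|n2] := eqVneq n 2; first by rewrite big_mkcond 3!big_ord_recl big_ord0.
have n3 : 2 < n by lia.
case: (boolP (odd n)) => on; last first.
  rewrite big_mkcond big_ord_recr /=.
  have -> : prime n = false.
    apply/negP => pn; have := odd_prime_gt2; case: (even_prime pn) => [|]; lia.
  rewrite muln1 -big_mkcond /=.
  case: n IH on n0 n1 n2 n3 => // n IH _ _ _ _ _.
  by apply: leq_trans (IH _ (ltnSn n)) _; rewrite leq_exp2l.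
pose k := n./2; have nk : n = (2 * k).+1 by rewrite /k; lia.
rewrite nk (bigID (fun p : 'I__ => p <= k.+1)) /=.
have -> : 4 ^ (2 * k).+1 = 4 ^ k.+1 * 4 ^ k by rewrite -expnD; congr (_ ^ _); lia.
apply: leq_mul; last first.
  apply: leq_trans (bin_odd_le k).
  apply: dvdn_leq; first by rewrite bin_gt0; lia.
  have -> : \prod_(i < (2 * k).+2 | prime i && ~~ (i <= k.+1)) i =
            \prod_(i < (2 * k).+2 | prime i && (k.+1 < i)) i.
    by apply: eq_bigl => i; rewrite -ltnNge.
  exact: prime_prod_dvd_bin.
have H : k.+1 < n by lia.
apply: leq_trans (IH _ H).
rewrite (big_ord_widen_cond (2 * k).+2 prime id); last lia.
by rewrite (eq_bigl (fun i : 'I__ => prime i && (i < k.+2))).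
Qed.

Definition primes_in (a b : nat) : seq nat := [seq p <- index_iota a.+1 b.+1 | prime p].

Lemma mem_primes_in (a b p : nat) :
  (p \in primes_in a b) = [&& prime p, a < p & p <= b].
Proof. by rewrite mem_filter mem_index_iota. Qed.

(** Legendre's formula for (2n)! minus twice that for n!, the latter padded with zero terms to the
    same range. *)
Lemma logn_central_bin (p n : nat) : prime p -> 0 < n ->
  logn p 'C(2 * n, n) = \sum_(1 <= k < (2 * n).+1) ((2 * n) %/ p ^ k - 2 * (n %/ p ^ k)).
Proof.
move=> pp n0.
have /(congr1 (logn p)) : 'C(2 * n, n) * (n`! * n`!) = (2 * n)`!.
  have le2 : n <= 2 * n by lia.
  by have := bin_fact le2; rewrite (_ : 2 * n - n = n) //; lia.
rewrite !lognM ?muln_gt0 ?fact_gt0 ?bin_gt0 //; last lia.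
rewrite !logn_fact // => e.
have e2 : \sum_(1 <= k < n.+1) n %/ p ^ k = \sum_(1 <= k < (2 * n).+1) n %/ p ^ k.
  have le1 : n.+1 <= (2 * n).+1 by lia.
  rewrite [RHS](big_cat_nat (ltn0Sn n) le1) //=.
  rewrite [X in _ = _ + X]big_nat_cond [X in _ = _ + X]big1 ?addn0 // => i /andP[/andP[ni _] _].
  by rewrite divn_small //; apply: leq_trans ni (ltnW (ltn_expl _ (prime_gt1 pp))).
rewrite e2 in e.
have le (k : nat) : 2 * (n %/ p ^ k) <= (2 * n) %/ p ^ k.
  by rewrite leq_divRL ?expn_gt0 ?prime_gt0 // -mulnA leq_mul2l leq_trunc_div orbT.
have -> : \sum_(1 <= k < (2 * n).+1) ((2 * n) %/ p ^ k - 2 * (n %/ p ^ k)) =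
   \sum_(1 <= k < (2 * n).+1) ((2 * n) %/ p ^ k) - 2 * \sum_(1 <= k < (2 * n).+1) n %/ p ^ k.
  by rewrite big_distrr /= sumnB.
lia.
Qed.

Lemma double_div_le (n q : nat) : (2 * n) %/ q - 2 * (n %/ q) <= 1.
Proof.
case: (posnP q) => [->|q0]; first by rewrite !divn0.
have := divn_eq n q; have := ltn_pmod n q0.
set a := n %/ q; set b := n %% q => bq ->.
have -> : 2 * (a * q + b) = (2 * a) * q + 2 * b by lia.
rewrite divnMDl //; have : (2 * b) %/ q < 2 by rewrite ltn_divLR //; lia.
lia.
Qed.

(** Each term of Legendre's formula is 0 or 1, and the terms with p^k > 2n vanish. *)
Lemma central_bin_pfactor_le (p n : nat) : prime p -> 0 < n ->
  p ^ logn p 'C(2 * n, n) <= 2 * n.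
Proof.
move=> pp n0; rewrite logn_central_bin //.
have n20 : 0 < 2 * n by lia.
have p1 := prime_gt1 pp.
apply: (@leq_trans (p ^ trunc_log p (2 * n))); last by rewrite trunc_logP.
rewrite leq_exp2l //.
set t := trunc_log p (2 * n).
have tn : t < (2 * n).+1.
  rewrite ltnS; apply: (@leq_trans (p ^ t)); last exact: trunc_logP.
  exact/ltnW/ltn_expl.
rewrite (big_cat_nat (ltn0Sn t) (tn : t.+1 <= (2 * n).+1)) //=.
rewrite [X in _ + X]big_nat_cond [X in _ + X]big1 ?addn0; last first.
  move=> i /andP[/andP[ti _] _]; rewrite divn_small //.
  apply: leq_trans (trunc_log_ltn _ p1) _.
  by rewrite leq_exp2l.
apply: (@leq_trans (\sum_(1 <= i < t.+1) 1)).
  by apply: leq_sum => i _; exact: double_div_le.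
by rewrite sum_nat_const_nat; lia.
Qed.

Lemma logn_central_bin_big (p n : nat) : prime p -> 0 < n -> 2 * n < p ^ 2 ->
  p <= 2 * n -> logn p 'C(2 * n, n) = (2 * n) %/ p - 2 * (n %/ p).
Proof.
move=> pp n0 p2 pn; rewrite logn_central_bin // big_ltn; last lia.
rewrite expn1 big_nat_cond big1 ?addn0 // => i /andP[/andP[i2 _] _].
rewrite divn_small //; apply: leq_trans p2 _; rewrite leq_exp2l //; exact: prime_gt1.
Qed.

(** Primes up to r contribute at most 2n each, primes in (r, 2n/3] at most p each, primes in (2n/3,
    n] nothing, because there 2n/p and n/p have integer parts 2 and 1, and primes in (n, 2n] at most
    2n each. The functions [f1], [f2], [f3] record the three nontrivial bounds. *)
Lemma central_bin_le (n r : nat) : 0 < n -> 2 * n < r.+1 ^ 2 ->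
  'C(2 * n, n) <= (2 * n) ^ (size (primes_in n (2 * n)) + r) * 4 ^ ((2 * n) %/ 3).
Proof.
move=> n0 nr.
have C0 : 0 < 'C(2 * n, n) by rewrite bin_gt0; lia.
pose f1 p := if p <= r then 2 * n else 1.
pose f2 p := if p <= (2 * n) %/ 3 then p else 1.
pose f3 p := if n < p then 2 * n else 1.
apply: (@leq_trans (\prod_(p < (2 * n).+1 | prime p) p ^ logn p 'C(2 * n, n))).
  apply: dvdn_leq.
    by apply: prodn_cond_gt0 => i pi; rewrite expn_gt0 prime_gt0.
  apply: (@dvdn_prod_prime_powers _ _ (fun p => p ^ logn p 'C(2 * n, n))) => // p pp pC; rewrite dvdnn andbT ltnS.
  rewrite leqNgt; apply/negP => np.
  have : p %| (2 * n)`!.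
    have le2 : n <= 2 * n by lia.
    by rewrite -(bin_fact le2) dvdn_mulr.
  by move=> /(prime_dvd_fact_le pp); lia.
apply: (@leq_trans (\prod_(p < (2 * n).+1 | prime p) (f1 p * f2 p * f3 p))).
  apply: leq_prod => -[p /= pn] pp.
  have p0 := prime_gt0 pp.
  have f10 : 0 < f1 p by rewrite /f1; case: ifP; lia.
  have f20 : 0 < f2 p by rewrite /f2; case: ifP; lia.
  have f30 : 0 < f3 p by rewrite /f3; case: ifP; lia.
  case: (leqP p r) => pr.
    have := central_bin_pfactor_le pp n0.
    have -> : 2 * n = f1 p by rewrite /f1 pr.
    by move=> /leq_trans; apply; rewrite -mulnA leq_pmulr // muln_gt0 f20.
  case: (ltnP n p) => np.
    have := central_bin_pfactor_le pp n0.
    have {2}-> : 2 * n = f3 p by rewrite /f3 np.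
    by move=> /leq_trans; apply; rewrite leq_pmull // muln_gt0 f10.
  have p2 : 2 * n < p ^ 2 by apply: leq_trans nr _; rewrite leq_exp2r.
  rewrite logn_central_bin_big //.
  case: (leqP p ((2 * n) %/ 3)) => p3.
    apply: (@leq_trans (p ^ 1)).
      by rewrite leq_exp2l ?prime_gt1 // double_div_le.
    have {1}-> : p = f2 p by rewrite /f2 p3.
    by rewrite expn1 mulnAC leq_pmull // muln_gt0 f10.
  have -> : n %/ p = 1.
    have n2 : n %/ p < 2 by rewrite ltn_divLR //; move: p3; rewrite ltn_divLR //; lia.
    by lia.
  have : (2 * n) %/ p < 3 by rewrite ltn_divLR //; move: p3; rewrite ltn_divLR //; lia.
  move=> h; have -> : (2 * n) %/ p - 2 * 1 = 0 by lia.
  by rewrite expn0 !muln_gt0 f10 f20.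
rewrite !big_split /= expnD mulnAC [X in _ <= X * _]mulnC.
have card_le : \prod_(i < (2 * n).+1 | prime i) f1 i <= (2 * n) ^ r.
  rewrite big_mkcond /=.
  apply: (@leq_trans (\prod_(i < (2 * n).+1) if (0 < i) && (i <= r) then 2 * n else 1)).
    apply: leq_prod => i _; rewrite /f1; case: ifP => [/prime_gt0 ->|] //=.
    by case: ifP => //; lia.
  rewrite -big_mkcond /= prod_nat_const; apply: leq_pexp2l; first lia.
  rewrite cardE -(size_map val); apply: (@leq_trans (size (iota 1 r))); last by rewrite size_iota.
  apply: uniq_leq_size; first by rewrite map_inj_uniq ?enum_uniq //; exact: val_inj.
  by move=> x /mapP[i]; rewrite mem_enum unfold_in mem_iota => /andP[h1 h2] ->; rewrite add1n ltnS h1.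
have -> : \prod_(i < (2 * n).+1 | prime i) f3 i = (2 * n) ^ size (primes_in n (2 * n)).
  rewrite /f3 -big_mkcondr /= -(big_mkord (fun i => prime i && (n < i)) (fun=> 2 * n)).
  rewrite big_const_seq iter_muln_1 /primes_in size_filter; congr (_ ^ _).
  rewrite /index_iota subn0 (_ : (2 * n).+1 = n.+1 + n); last lia.
  rewrite iotaD count_cat add0n (_ : _ + n - n.+1 = n); last lia.
  rewrite (_ : count _ (iota 0 n.+1) = 0) ?add0n.
    by apply: eq_in_count => x; rewrite mem_iota => /andP[-> _]; rewrite andbT.
  apply/eqP; rewrite -leqn0 leqNgt -has_count; apply/negP => /hasP[x].
  by rewrite mem_iota => /andP[_ h] /andP[_]; lia.
apply: leq_mul; first exact: leq_mul.
rewrite /f2 -big_mkcondr /=.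
apply: leq_trans (primorial_le _).
have le3 : (2 * n) %/ 3 <= 2 * n by apply: leq_div.
rewrite (big_ord_widen_cond (2 * n).+1 prime id); last by rewrite ltnS.
by rewrite (eq_bigl (fun i : 'I__ => prime i && (i < ((2 * n) %/ 3).+1))).
Qed.

(** The central coefficient is the largest of 2n + 1 coefficients with sum 4^n. *)
Lemma central_bin_ge (n : nat) : 0 < n -> 4 ^ n <= (2 * n).+1 * 'C(2 * n, n).
Proof.
move=> n0.
have H (k : nat) : 'C(2 * n, k) <= 'C(2 * n, n).
  have inc (j : nat) : j < n -> 'C(2 * n, j) <= 'C(2 * n, j.+1).
    move=> jn; have := mul_bin_left (2 * n) j.
    rewrite -(@leq_pmul2l j.+1) // => ->.
    by rewrite leq_mul2r; apply/orP; right; lia.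
  have up (j : nat) : j <= n -> 'C(2 * n, n - j) <= 'C(2 * n, n).
    elim: j => [|j IH] jn; first by rewrite subn0.
    apply: leq_trans (IH (ltnW jn)).
    have := inc (n - j.+1); rewrite (_ : (n - j.+1).+1 = n - j); last lia.
    by apply; lia.
  case: (leqP k n) => kn; first by have := up (n - k); rewrite subKn //; apply; lia.
  case: (leqP k (2 * n)) => k2; last by rewrite bin_small.
  rewrite -(bin_sub k2); have := up (k - n); rewrite (_ : n - (k - n) = 2 * n - k); last lia.
  apply; lia.
have : \sum_(i < (2 * n).+1) 'C(2 * n, i) = 2 ^ (2 * n).
  by rewrite (expnDn 1 1) ; apply: eq_bigr => i _; rewrite !exp1n !muln1.
rewrite expnM => <-.
apply: (@leq_trans (\sum_(i < (2 * n).+1) 'C(2 * n, n))); first exact: leq_sum.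
by rewrite sum_nat_const card_ord.
Qed.

(* Erdős' argument for Bertrand's postulate. *)
Lemma primes_in_double_ge (n r : nat) : 0 < n -> 2 * n < r.+1 ^ 2 ->
  4 ^ (n - (2 * n) %/ 3) <= (2 * n).+1 ^ (size (primes_in n (2 * n)) + r.+1).
Proof.
move=> n0 nr.
rewrite -(@leq_pmul2r (4 ^ ((2 * n) %/ 3))) ?expn_gt0 // -expnD subnK; last first.
  by lia.
apply: leq_trans (central_bin_ge n0) _.
rewrite addnS expnS -mulnA leq_mul2l /=.
apply: leq_trans (central_bin_le n0 nr) _.
apply: leq_mul => //; set e := _ + r.
by case: e => // e; rewrite leq_exp2r.
Qed.

Import Order.TTheory GRing.Theory Num.Theory.
Import numFieldNormedType.Exports.
Local Open Scope classical_set_scope.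
Local Open Scope ring_scope.

(** * A large sieve for residue classes *)

Lemma ler_sum_subset (R : realFieldType) (T : eqType) (s1 s2 : seq T) (F : T -> R) :
  uniq s1 -> uniq s2 -> {subset s1 <= s2} -> (forall x, 0 <= F x) ->
  \sum_(x <- s1) F x <= \sum_(x <- s2) F x.
Proof.
move=> u1 u2 s12 F0.
rewrite [leRHS](bigID (fun x => x \in s1)) /= -[X in _ <= X + _]big_filter.
have pe : perm_eq [seq i <- s2 | i \in s1] s1.
  apply: uniq_perm => //; first exact: filter_uniq.
  by move=> x; rewrite mem_filter andb_idr //; apply: s12.
by rewrite (perm_big _ pe) lerDl sumr_ge0.
Qed.

Lemma ler_sqr_sum (R : realFieldType) (T : Type) (s : seq T) (a : T -> R) :
  (\sum_(i <- s) a i) ^+ 2 <= (size s)%:R * \sum_(i <- s) a i ^+ 2.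
Proof.
elim: s => [|x s IH]; first by rewrite !big_nil expr0n mulr0.
rewrite !big_cons /= -natr1.
set S := \sum_(j <- s) a j; set Q := \sum_(j <- s) a j ^+ 2.
have cross : 2 * a x * S <= (size s)%:R * a x ^+ 2 + Q.
  rewrite /S /Q; elim: (s) => [|y r IHr]; first by rewrite !big_nil /= mulr0 mul0r addr0.
  rewrite !big_cons /= -natr1.
  have : 0 <= (a x - a y) ^+ 2 by apply: sqr_ge0.
  nra.
rewrite -/S -/Q in IH; nra.
Qed.

(** Summation against the indicator of an interval of length H. Its K-th iterate sums against the
    K-fold convolution of this indicator, a discrete B-spline, without the weight being written
    down. *)
Definition wsum (R : realFieldType) (H : nat) (F : nat -> R) (y : nat) : R :=
  \sum_(x < H) F (y + x)%N.

Lemma eq_iter_wsum (R : realFieldType) (H K : nat) (F G : nat -> R) :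
  F =1 G -> iter K (wsum H) F =1 iter K (wsum H) G.
Proof.
by move=> FG; elim: K => //= K IH y; apply: eq_bigr => x _; apply: IH.
Qed.

Lemma iter_wsum_sum (R : realFieldType) (T : Type) (s : seq T) (H K : nat)
    (f : T -> nat -> R) (y : nat) :
  iter K (wsum H) (fun n => \sum_(i <- s) f i n) y =
  \sum_(i <- s) iter K (wsum H) (f i) y.
Proof.
elim: K y => //= K IH y; rewrite /wsum exchange_big /=; apply: eq_bigr => x _; exact: IH.
Qed.

Lemma sum_period_shift (R : realFieldType) (F : nat -> R) (L y : nat) :
  (forall x, F (x + L)%N = F x) -> \sum_(x < L) F (y + x)%N = \sum_(x < L) F x.
Proof.
move=> per; elim: y => [|y <-]; first by apply: eq_bigr => x _; rewrite add0n.
have e0 : \sum_(i < L.+1) F (y + i)%N = \sum_(i < L) F (y + i)%N + F (y + L)%N by rewrite big_ord_recr.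
move: e0; rewrite big_ord_recl /= addn0 per addrC => /addIr e.
rewrite -[RHS]e; apply: eq_bigr => x _; congr F; rewrite /bump /=; lia.
Qed.

Lemma period_mul (R : realFieldType) (F : nat -> R) (L : nat) :
  (forall x, F (x + L)%N = F x) -> forall m x, F (x + m * L)%N = F x.
Proof.
move=> per; elim=> [|m IH] x; first by rewrite mul0n addn0.
by rewrite mulSn [(L + _)%N]addnC addnA per IH.
Qed.

Lemma sum_period_mul (R : realFieldType) (F : nat -> R) (L m : nat) :
  (forall x, F (x + L)%N = F x) -> \sum_(x < m * L) F x = m%:R * \sum_(x < L) F x.
Proof.
move=> per; elim: m => [|m IH]; first by rewrite mul0n big_ord0 mul0r.
rewrite mulSn big_split_ord /= -natr1 mulrDl mul1r addrC -IH; congr (_ + _).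
by apply: eq_bigr => x _; rewrite addnC per.
Qed.

Lemma wsum_periodic (R : realFieldType) (H : nat) (F : nat -> R) (L : nat) :
  (forall x, F (x + L)%N = F x) -> forall x, wsum H F (x + L)%N = wsum H F x.
Proof. by move=> per x; apply: eq_bigr => y _; rewrite addnAC per. Qed.

Lemma wsum_split (R : realFieldType) (H1 H2 : nat) (F : nat -> R) (y : nat) :
  wsum (H1 + H2) F y = wsum H1 F y + wsum H2 F (y + H1)%N.
Proof.
by rewrite /wsum big_split_ord /=; congr (_ + _); apply: eq_bigr => x _; rewrite addnA.
Qed.

(** Whole periods inside the window sum to zero, and what remains is shorter than a period. *)
Lemma wsum_zero_mean_le (R : realFieldType) (H L : nat) (F : nat -> R) (y : nat) :
  (0 < L)%N -> (forall x, F (x + L)%N = F x) -> \sum_(x < L) F x = 0 ->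
  `|wsum H F y| <= \sum_(x < L) `|F x|.
Proof.
move=> L0 per z; elim/ltn_ind: H y => H IH y.
case: (leqP L H) => LH.
  rewrite -(subnKC LH) wsum_split /wsum sum_period_shift // z add0r.
  by apply: IH; lia.
apply: le_trans (ler_norm_sum _ _ _) _.
rewrite -(@sum_period_shift _ (fun x => `|F x|) L y); last by move=> x; rewrite per.
rewrite (big_ord_widen _ (fun x => `|F (y + x)%N|) (ltnW LH)) [leRHS](bigID (fun i : 'I_L => (i < H)%N)) /=.
by rewrite lerDl sumr_ge0.
Qed.

Lemma sum_wsum_period (R : realFieldType) (H L : nat) (F : nat -> R) :
  (forall x, F (x + L)%N = F x) ->
  \sum_(y < L) wsum H F y = H%:R * \sum_(x < L) F x.
Proof.
move=> per; rewrite /wsum exchange_big /=.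
rewrite (eq_bigr (fun=> \sum_(x < L) F x)); first by rewrite sumr_const card_ord mulr_natl.
move=> x _; rewrite -(sum_period_shift x per).
by apply: eq_bigr => y _; rewrite addnC.
Qed.

(** [wsum] preserves the period and the vanishing mean and bounds the values by the l1 norm over a
    period. So every further application costs a factor L, where the trivial estimate costs H;
    iterating pays as soon as L < H. *)
Lemma iter_wsum_zero_mean_le (R : realFieldType) (H L K : nat) (F : nat -> R) (y : nat) :
  (0 < L)%N -> (forall x, F (x + L)%N = F x) -> \sum_(x < L) F x = 0 ->
  `|iter K.+1 (wsum H) F y| <= L%:R ^+ K * \sum_(x < L) `|F x|.
Proof.
move=> L0; elim: K F y => [|K IH] F y per z.
  by rewrite expr0 mul1r; apply: wsum_zero_mean_le.
rewrite iterSr; apply: le_trans (IH _ _ _ _) _; first exact: wsum_periodic.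
  by rewrite sum_wsum_period // z mulr0.
rewrite exprSr -mulrA ler_wpM2l ?exprn_ge0 //.
apply: (@le_trans _ _ (\sum_(x < L) \sum_(x < L) `|F x|)).
  by apply: ler_sum => x _; apply: wsum_zero_mean_le.
by rewrite sumr_const card_ord mulr_natl.
Qed.

(** The innermost window meets at most H/r + 1 periods; the K outer windows are estimated
    trivially. *)
Lemma iter_wsum_ge0_le (R : realFieldType) (H r K : nat) (F : nat -> R) (y : nat) :
  (0 < r)%N -> (forall x, 0 <= F x) -> (forall x, F (x + r)%N = F x) ->
  iter K.+1 (wsum H) F y <= H%:R ^+ K * ((H %/ r).+1)%:R * \sum_(x < r) F x.
Proof.
move=> r0 F0 per; elim: K y => [|K IH] y; last first.
  rewrite iterS {1}/wsum; set B := _ * _ * _ in IH.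
  apply: (@le_trans _ _ (\sum_(x < H) B)); first by apply: ler_sum => x _; apply: IH.
  by rewrite sumr_const card_ord -[_ *+ H]mulr_natl exprS /B !mulrA.
rewrite expr0 mul1r /=.
elim/ltn_ind: H y => H IH y; case: (leqP r H) => rH.
  rewrite -(subnKC rH) wsum_split /wsum sum_period_shift // divnDl // divnn r0 add1n.
  have h : (H - r < H)%N by lia.
  by have := IH _ h (y + r)%N; rewrite /wsum -!natr1; nra.
rewrite divn_small // mul1r -(sum_period_shift y per).
rewrite /wsum (big_ord_widen _ (fun x => F (y + x)%N) (ltnW rH)) [leRHS](bigID (fun i : 'I_r => (i < H)%N)) /=.
by rewrite lerDl sumr_ge0.
Qed.

Lemma iter_wsum_ge0 (R : realFieldType) (H K : nat) (F : nat -> R) (y : nat) :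
  (forall x, 0 <= F x) -> 0 <= iter K (wsum H) F y.
Proof. by move=> F0; elim: K y => //= K IH y; apply: sumr_ge0. Qed.

(** The weight is at least h^K on [s, s + M): whichever shifts below h are taken in the K outer
    windows, the innermost window still covers this interval. *)
Lemma iter_wsum_ge (R : realFieldType) (H K h s M : nat) (F : nat -> R) (y : nat) :
  (forall x, 0 <= F x) -> (h <= H)%N -> (y + K * h <= s)%N -> (s + M <= y + H)%N ->
  h%:R ^+ K * \sum_(n < M) F (s + n)%N <= iter K.+1 (wsum H) F y.
Proof.
move=> F0 hH; elim: K y => [|K IH] y ys sM.
  rewrite expr0 mul1r /= /wsum.
  have -> : \sum_(n < M) F (s + n)%N = wsum M F (y + (s - y))%N.
    by apply: eq_bigr => n _; rewrite subnKC; last lia.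
  have -> : H = ((s - y) + (M + (H - (s - y) - M)))%N by lia.
  rewrite -/(wsum _ F y) !wsum_split.
  have p1 := @iter_wsum_ge0 R (s - y) 1 F y F0.
  have p2 := @iter_wsum_ge0 R (H - (s - y) - M) 1 F (y + (s - y) + M)%N F0.
  rewrite /= in p1 p2; lra.
rewrite iterS {1}/wsum.
rewrite (bigID (fun x : 'I_H => (x < h)%N)) /= exprS -mulrA.
apply: (@le_trans _ _ (\sum_(i < H | (i < h)%N) iter K.+1 (wsum H) F (y + i)%N)); last first.
  by rewrite lerDl sumr_ge0 // => i _; exact: (@iter_wsum_ge0 R H K.+1).
rewrite -(big_ord_widen _ (fun i => iter K.+1 (wsum H) F (y + i)%N) hH).
apply: (@le_trans _ _ (\sum_(i < h) h%:R ^+ K * \sum_(n < M) F (s + n)%N)).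
  by rewrite sumr_const card_ord mulr_natl.
by apply: ler_sum => i _; apply: IH; have := ltn_ord i; lia.
Qed.

(* The large sieve by duality: iterating [wsum] produces a smooth weight that
   is so well distributed modulo r_i r_j that the functions g_i, g_j, having
   product of mean zero, are almost orthogonal, even when r_i r_j is close to
   the length of summation. *)
Lemma weak_large_sieve (R : realFieldType) (I : eqType) (s : seq I) (r : I -> nat)
    (g : I -> nat -> R) (R0 Rb H K h s0 M : nat) :
  uniq s -> (0 < R0)%N -> {in s, forall i, (R0 <= r i <= Rb)%N} ->
  {in s, forall i x, g i (x + r i)%N = g i x} ->
  {in s &, forall i j, i != j -> \sum_(x < r i * r j) g i x * g j x = 0} ->
  (h <= H)%N -> (K * h <= s0)%N -> (s0 + M <= H)%N ->
  h%:R ^+ K * \sum_(n < M) (\sum_(i <- s) g i (s0 + n)%N) ^+ 2 <=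
  (H%:R ^+ K * ((H %/ R0).+1)%:R + (Rb ^ 2)%:R ^+ K * Rb%:R * (size s)%:R) *
  \sum_(i <- s) \sum_(x < r i) g i x ^+ 2.
Proof.
move=> us R00 rb per orth hH Ks sM.
pose F n := (\sum_(i <- s) g i n) ^+ 2.
have := @iter_wsum_ge R H K h s0 M F 0 (fun x => sqr_ge0 _) hH Ks sM.
move=> /le_trans; apply.
have FE : F =1 fun n => \sum_(i <- s) \sum_(j <- s) g i n * g j n.
  move=> n; rewrite /F expr2 mulr_suml; apply: eq_bigr => i _.
  by rewrite mulr_sumr.
rewrite (eq_iter_wsum _ _ FE) iter_wsum_sum.
under eq_bigr do rewrite iter_wsum_sum.
set D := H%:R ^+ K * _; pose E : R := (Rb ^ 2)%:R ^+ K * Rb%:R.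
pose gam i := \sum_(x < r i) g i x ^+ 2.
have gam0 i : 0 <= gam i by apply: sumr_ge0 => x _; exact: sqr_ge0.
have E0 : 0 <= E by rewrite mulr_ge0 ?exprn_ge0.
have key : {in s &, forall i j, iter K.+1 (wsum H) (fun n => g i n * g j n) 0 <=
    (i == j)%:R * (D * gam i) + E * ((gam i + gam j) / 2)}.
  move=> i j si sj; have /andP[ri1 ri2] := rb i si; have /andP[rj1 rj2] := rb j sj.
  have ri0 : (0 < r i)%N by lia.
  case: eqVneq => [<-|ij].
    rewrite mul1r; apply: (@le_trans _ _ (D * gam i)); last first.
      by rewrite lerDl mulr_ge0 // divr_ge0 ?addr_ge0.
    have := @iter_wsum_ge0_le R H (r i) K (fun n => g i n * g i n) 0 ri0.
    move=> /(_ _ _)/le_trans; apply.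
      by move=> x; rewrite -expr2 sqr_ge0.
      by move=> x; rewrite per.
    have -> : gam i = \sum_(x < r i) g i x * g i x by apply: eq_bigr => x _; rewrite expr2.
    rewrite ler_wpM2r ?sumr_ge0 // => [x _|]; first by rewrite -expr2 sqr_ge0.
    by rewrite /D ler_wpM2l ?exprn_ge0 // ler_nat ltnS leq_div2l.
  (* Off the diagonal the product has mean zero and a period of at most Rb^2; its l1 norm is split
     into two l2 norms by 2|xy| <= x^2 + y^2. *)
  rewrite mul0r add0r; apply: le_trans (ler_norm _) _.
  have peri x : g i (x + r i * r j)%N = g i x by rewrite mulnC period_mul //; apply: per.
  have perj x : g j (x + r i * r j)%N = g j x by rewrite period_mul //; apply: per.
  apply: le_trans (@iter_wsum_zero_mean_le _ H (r i * r j) K _ 0 _ _ (orth i j si sj ij)) _.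
    by rewrite muln_gt0 ri0 /=; lia.
    by move=> x; rewrite peri perj.
  rewrite /E -mulrA; apply: ler_pM; rewrite ?exprn_ge0 ?sumr_ge0 //.
    by rewrite lerXn2r ?nnegrE // ler_nat -mulnn leq_mul.
  apply: (@le_trans _ _ (\sum_(x < r i * r j) (g i x ^+ 2 / 2 + g j x ^+ 2 / 2))).
    apply: ler_sum => x _; rewrite normrM.
    have := sqr_ge0 (`|g i x| - `|g j x|).
    rewrite -(real_normK (num_real (g i x))) -(real_normK (num_real (g j x))).
    nra.
  rewrite big_split /= -!mulr_suml.
  rewrite [X in X / 2 + _](_ : _ = (r j)%:R * gam i); last first.
    by rewrite mulnC (@sum_period_mul _ (fun x => g i x ^+ 2)) // => x; rewrite per.
  rewrite [X in _ + X / 2](_ : _ = (r i)%:R * gam j); last first.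
    by rewrite (@sum_period_mul _ (fun x => g j x ^+ 2)) // => x; rewrite per.
  have rj' : (r j)%:R <= Rb%:R :> R by rewrite ler_nat.
  have ri' : (r i)%:R <= Rb%:R :> R by rewrite ler_nat.
  have := gam0 i; have := gam0 j; nra.
apply: (@le_trans _ _ (\sum_(i <- s) \sum_(j <- s)
    ((i == j)%:R * (D * gam i) + E * ((gam i + gam j) / 2)))).
  rewrite big_seq [leRHS]big_seq; apply: ler_sum => i si.
  by rewrite big_seq [leRHS]big_seq; apply: ler_sum => j sj; apply: key.
rewrite -/E mulrDl.
have -> : \sum_(i <- s) \sum_(j <- s) ((i == j)%:R * (D * gam i) + E * ((gam i + gam j) / 2)) =
   \sum_(i <- s) (D * gam i + E * ((size s)%:R * gam i + \sum_(j <- s) gam j) / 2).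
  apply: eq_big_seq => i si; rewrite big_split /=; congr (_ + _).
    rewrite (bigD1_seq i) //= eqxx mul1r big1 ?addr0 // => j /negbTE.
    by rewrite eq_sym => ->; rewrite mul0r.
  rewrite -mulr_sumr -mulr_suml big_split /= mulrA; congr (_ * _ / _); congr (_ + _).
  by rewrite big_const_seq count_predT iter_addr_0 mulr_natl.
rewrite big_split /= -mulr_sumr lerD2l -mulr_suml -mulr_sumr big_split /= -mulr_sumr.
rewrite [X in _ + X]big_const_seq count_predT iter_addr_0 -mulr_natl.
by rewrite -/gam le_eqVlt; apply/orP; left; apply/eqP; field.
Qed.

(** * Products of primes *)

Definition prodn (ps : seq nat) : nat := \prod_(p <- ps) p.

Fixpoint subs (s : seq nat) : seq (seq nat) :=
  if s is p :: s' then subs s' ++ [seq p :: r | r <- subs s'] else [:: [::]].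

Fixpoint tuples (Qs : seq (seq nat)) : seq (seq nat) :=
  if Qs is P :: Qs' then [seq p :: ps | p <- P, ps <- tuples Qs'] else [:: [::]].

Lemma size_subs (s : seq nat) : size (subs s) = (2 ^ size s)%N.
Proof. by elim: s => //= p s IH; rewrite size_cat size_map IH expnS mul2n addnn. Qed.

Lemma subs_subseq (s r : seq nat) : r \in subs s -> subseq r s.
Proof.
elim: s r => [|p s IH] r /=; first by rewrite inE => /eqP ->.
rewrite mem_cat => /orP[/IH h|/mapP[r' /IH h ->]].
  exact: subseq_trans h (subseq_cons _ _).
by rewrite /= eqxx.
Qed.

Lemma prod_1D (R : comNzRingType) (f : nat -> R) (s : seq nat) :
  \prod_(p <- s) (1 + f p) = \sum_(r <- subs s) \prod_(p <- r) f p.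
Proof.
elim: s => [|p s IH]; first by rewrite big_nil big_seq1 big_nil.
rewrite big_cons /= big_cat big_map /= mulrDl mul1r IH mulr_sumr; congr (_ + _).
by apply: eq_bigr => r _; rewrite big_cons.
Qed.

Lemma mem_tuples (Qs : seq (seq nat)) (ps : seq nat) :
  (ps \in tuples Qs) = all2 (fun p P => p \in P) ps Qs.
Proof.
elim: Qs ps => [|P Qs IH] [|p ps] //=; first by apply/negP => /allpairsP[[a b] [_ _]].
rewrite -IH; apply/allpairsP/andP => [[[a b] /= [aP bQ [-> ->]]] //|[pP psQ]].
by exists (p, ps).
Qed.

Lemma size_mem_tuples (Qs : seq (seq nat)) (ps : seq nat) :
  ps \in tuples Qs -> size ps = size Qs.
Proof. by rewrite mem_tuples all2E => /andP[/eqP]. Qed.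

Lemma mem_tuples_flatten (Qs : seq (seq nat)) (ps : seq nat) :
  ps \in tuples Qs -> {subset ps <= flatten Qs}.
Proof.
rewrite mem_tuples; elim: Qs ps => [|P Qs IH] [|p ps] //= /andP[pP h] q.
rewrite inE mem_cat => /orP[/eqP ->|/(IH _ h) ->]; first by rewrite pP.
by rewrite orbT.
Qed.

Lemma size_tuples (Qs : seq (seq nat)) :
  size (tuples Qs) = \prod_(P <- Qs) size P.
Proof.
elim: Qs => [|P Qs IH]; first by rewrite big_nil.
by rewrite big_cons /= size_allpairs IH.
Qed.

Lemma sum_tuples_cons (R : nmodType) P Qs (F : seq nat -> R) :
  \sum_(ps <- tuples (P :: Qs)) F ps =
  \sum_(p <- P) \sum_(ps <- tuples Qs) F (p :: ps).
Proof. by rewrite /= big_allpairs_dep. Qed.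

Lemma sum_tuples_cat (R : nmodType) Qs1 Qs2 (F : seq nat -> R) :
  \sum_(ps <- tuples (Qs1 ++ Qs2)) F ps =
  \sum_(a <- tuples Qs1) \sum_(b <- tuples Qs2) F (a ++ b).
Proof.
elim: Qs1 F => [|P Qs1 IH] F; first by rewrite big_seq1.
by rewrite cat_cons !sum_tuples_cons; apply: eq_bigr => p _; rewrite IH.
Qed.

Lemma uniq_tuples (Qs : seq (seq nat)) : uniq (flatten Qs) -> uniq (tuples Qs).
Proof.
elim: Qs => //= P Qs IH; rewrite cat_uniq => /and3P[uP _ /IH uQ].
apply: allpairs_uniq => // -[a b] [c d] _ _ /=; by case=> -> ->.
Qed.

Lemma uniq_mem_tuples (Qs : seq (seq nat)) (ps : seq nat) :
  uniq (flatten Qs) -> ps \in tuples Qs -> uniq ps.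
Proof.
rewrite mem_tuples; elim: Qs ps => [|P Qs IH] [|p ps] //=.
rewrite cat_uniq => /and3P[uP /hasPn dis uQ] /andP[pP h]; rewrite (IH _ uQ h) andbT.
apply/negP => pps; have := @mem_tuples_flatten Qs ps; rewrite mem_tuples => /(_ h p pps) /dis.
by rewrite /= pP.
Qed.

Lemma uniq_flatten_subseq (Qs Ss : seq (seq nat)) :
  subseq Ss Qs -> subseq (flatten Ss) (flatten Qs).
Proof.
elim: Qs Ss => [|Q Qs IH] [|S Ss] //=; first by rewrite sub0seq.
case: eqP => [-> /IH h|_ /IH h]; first by rewrite cat_subseq.
by apply: subseq_trans h _; rewrite suffix_subseq.
Qed.

Lemma prodn_primes_gt0 (ps : seq nat) : all prime ps -> (0 < prodn ps)%N.
Proof.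
by elim: ps => [|p ps IH]; rewrite /prodn ?big_nil // big_cons /= => /andP[/prime_gt0 p0 /IH]; rewrite muln_gt0 p0.
Qed.

Lemma prodn_cons (p : nat) (ps : seq nat) : prodn (p :: ps) = (p * prodn ps)%N.
Proof. by rewrite /prodn big_cons. Qed.

Lemma prodn_cat (ps qs : seq nat) : prodn (ps ++ qs) = (prodn ps * prodn qs)%N.
Proof. by rewrite /prodn big_cat. Qed.

Lemma prime_dvd_prodn (p : nat) (ps : seq nat) :
  prime p -> all prime ps -> (p %| prodn ps)%N = (p \in ps).
Proof.
move=> pp; elim: ps => [|q ps IH] /=.
  by rewrite /prodn big_nil dvdn1; move: pp; case: eqP => // ->.
move=> /andP[pq /IH h]; rewrite prodn_cons Euclid_dvdM // h inE.
by rewrite dvdn_prime2.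
Qed.

Lemma dvdn_prodn (p : nat) (ps : seq nat) : p \in ps -> (p %| prodn ps)%N.
Proof.
elim: ps => //= q ps IH; rewrite inE prodn_cons => /orP[/eqP ->|/IH]; first exact: dvdn_mulr.
exact: dvdn_mull.
Qed.

Lemma coprime_prodn (t : nat) (ps : seq nat) :
  coprime (prodn ps) t = all (fun p => coprime p t) ps.
Proof.
elim: ps => [|p ps IH]; first by rewrite /prodn big_nil coprime1n.
by rewrite prodn_cons coprimeMl IH.
Qed.

(** The source of orthogonality for two different moduli. The tuples differ in some block, and as
    the blocks are disjoint the entry found there cannot reappear elsewhere in the other tuple. *)
Lemma tuples_distinct (Qs : seq (seq nat)) (ps ps' : seq nat) :
  uniq (flatten Qs) -> ps \in tuples Qs -> ps' \in tuples Qs -> ps != ps' ->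
  exists2 p, p \in ps & p \notin ps'.
Proof.
elim: Qs ps ps' => [|P Qs IH] ps ps' /=.
  by move=> _; rewrite !inE => /eqP -> /eqP ->; rewrite eqxx.
rewrite cat_uniq => /and3P[uP /hasPn dis uQ].
move=> /allpairsP[[p qs] /= [pP qsQ ->]] /allpairsP[[p' qs'] /= [p'P qs'Q ->]] ne.
have [e|pp'] := eqVneq p p'.
  have {}ne : qs != qs' by apply: contra ne => /eqP ->; rewrite e.
  have [q q1 q2] := IH _ _ uQ qsQ qs'Q ne.
  exists q; first by rewrite inE q1 orbT.
  rewrite inE negb_or q2 andbT; apply/negP => /eqP qp'.
  by have := dis _ (mem_tuples_flatten qsQ q1); rewrite qp' /= p'P.
exists p; first by rewrite inE eqxx.
rewrite inE negb_or pp' /=; apply/negP => pq.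
by have := dis _ (mem_tuples_flatten qs'Q pq); rewrite /= pP.
Qed.

Lemma prodn_inj (Qs : seq (seq nat)) (ps ps' : seq nat) :
  uniq (flatten Qs) -> all prime (flatten Qs) ->
  ps \in tuples Qs -> ps' \in tuples Qs -> prodn ps = prodn ps' -> ps = ps'.
Proof.
move=> uQ /allP prQ h h' e; apply/eqP/negPn/negP => ne.
have [p p1 /negP p2] := tuples_distinct uQ h h' ne; apply: p2.
have pr' : all prime ps' by apply/allP => q /(mem_tuples_flatten h')/prQ.
have pp : prime p by apply: prQ; apply: (mem_tuples_flatten h).
by rewrite -prime_dvd_prodn // -e dvdn_prodn.
Qed.

Lemma uniq_prods (Qs : seq (seq nat)) :
  uniq (flatten Qs) -> all prime (flatten Qs) -> uniq (map prodn (tuples Qs)).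
Proof.
move=> uQ prQ; rewrite map_inj_in_uniq; first exact: uniq_tuples.
by move=> ps ps' h h'; exact: (prodn_inj uQ prQ h h').
Qed.

Lemma prodn_le (U : nat) (ps : seq nat) :
  all (fun p => p <= U)%N ps -> (prodn ps <= U ^ size ps)%N.
Proof.
elim: ps => [|p ps IH] /=; first by rewrite /prodn big_nil.
by move=> /andP[pU /IH h]; rewrite prodn_cons expnS leq_mul.
Qed.

Lemma prodn_ge (Z : nat) (ps : seq nat) :
  all (fun p => Z <= p)%N ps -> (Z ^ size ps <= prodn ps)%N.
Proof.
elim: ps => [|p ps IH] /=; first by rewrite /prodn big_nil.
by move=> /andP[pU /IH h]; rewrite prodn_cons expnS leq_mul.
Qed.

Lemma size_tuples_ge (Z : nat) (Qs : seq (seq nat)) :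
  all (fun P => Z <= size P)%N Qs -> (Z ^ size Qs <= size (tuples Qs))%N.
Proof.
elim: Qs => //= P Qs IH /andP[ZP /IH h]; rewrite size_allpairs expnS; exact: leq_mul.
Qed.

Lemma size_tuples_le (U : nat) (Qs : seq (seq nat)) :
  uniq (flatten Qs) -> all (fun p => 0 < p <= U)%N (flatten Qs) ->
  (size (tuples Qs) <= U ^ size Qs)%N.
Proof.
elim: Qs => //= P Qs IH; rewrite cat_uniq all_cat => /and3P[uP _ uQ] /andP[aP aQ].
rewrite size_allpairs expnS; apply: leq_mul; last exact: IH.
rewrite -[U in (_ <= U)%N](size_iota 1); apply: uniq_leq_size => // x xP.
by rewrite mem_iota add1n ltnS; exact: (allP aP).
Qed.

(** * Congruences modulo products of primes and mean-zero kernels *)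

Lemma eqmod_mul_cancel (D a x y : nat) :
  coprime D a -> x * a = y * a %[mod D] -> x = y %[mod D].
Proof.
move=> co; wlog xy : x y / (x <= y)%N.
  by case: (leqP x y) => [h H|/ltnW h H e]; [exact: H | symmetry; apply: H].
move=> /esym/eqP e; apply/esym/eqP; move: e.
by rewrite !eqn_mod_dvd ?leq_mul2r ?xy ?orbT // -mulnBl Gauss_dvdl.
Qed.

Lemma size_congr_le (s : seq nat) (M D : nat) :
  (0 < D)%N -> uniq s -> {in s, forall x, (x < M)%N} ->
  {in s &, forall x y, x = y %[mod D]} -> (D * size s <= M + D)%N.
Proof.
move=> D0 us sM cg.
suff : (size s <= M %/ D + 1)%N.
  move=> /(leq_mul (leqnn D)) /leq_trans; apply.
  by rewrite mulnDr muln1 leq_add2r mulnC leq_trunc_div.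
rewrite addn1 -(size_iota 0 (M %/ D).+1) -(size_map (fun x => x %/ D)%N).
apply: uniq_leq_size.
  rewrite map_inj_in_uniq // => x y xs ys e.
  by rewrite (divn_eq x D) (divn_eq y D) e (cg x y).
by move=> z /mapP[x /sM xM ->]; rewrite mem_iota add0n ltnS leq_div2r // ltnW.
Qed.

Lemma eqmod_prodn (ps : seq nat) (x t : nat) : all prime ps -> uniq ps ->
  (x == t %[mod prodn ps]) = all (fun p => x == t %[mod p]) ps.
Proof.
elim: ps => [|p ps IH] /=; first by rewrite /prodn big_nil !modn1 eqxx.
move=> /andP[pp pps] /andP[np ups].
rewrite prodn_cons chinese_remainder ?IH //.
by rewrite prime_coprime // prime_dvd_prodn.
Qed.

(** The sum of the nontrivial additive characters modulo p at x - t, hence of mean zero over a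
    period. Adding 1 gives p times the indicator of x = t modulo p, so expanding a product of
    factors 1 + kern is the expansion over conductors. *)
Definition kern (R : realFieldType) (t p x : nat) : R :=
  p%:R * (x == t %[mod p])%:R - 1.

Lemma kern_mod (R : realFieldType) (t p x y : nat) :
  x = y %[mod p] -> kern R t p x = kern R t p y.
Proof. by rewrite /kern => ->. Qed.

(** The map j -> (x + j c) a permutes the residues modulo p. *)
Lemma sum_kern_shift (R : realFieldType) (t p x c a : nat) :
  prime p -> coprime p c -> coprime p a ->
  \sum_(j < p) kern R t p ((x + j * c) * a) = 0.
Proof.
move=> pp cc ca; have p0 := prime_gt0 pp.
rewrite /kern sumrB sumr_const card_ord -mulr_sumr.
suff -> : \sum_(j < p) ((((x + j * c) * a)%N == t %[mod p])%:R : R) = 1 by rewrite mulr1 subrr.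
pose f (j : 'I_p) : 'I_p := Ordinal (ltn_pmod ((x + j * c) * a) p0).
have fi : injective f.
  move=> i j [] /(eqmod_mul_cancel ca)/eqP; rewrite eqn_modDl => /eqP /(eqmod_mul_cancel cc).
  by rewrite !modn_small // => ?; apply: val_inj.
pose t0 : 'I_p := Ordinal (ltn_pmod t p0).
transitivity (\sum_(j < p) ((f j == t0)%:R : R)); first by apply: eq_bigr.
rewrite -(reindex_inj fi (F := fun j => ((j == t0)%:R : R)) (P := xpredT)).
by rewrite (bigD1 t0) //= eqxx big1 ?addr0 // => i /negbTE ->.
Qed.

(** Since c is divisible by the other primes of [ps], shifting by its multiples moves only the
    factor at p. *)
Lemma sum_prod_kern_shift (R : realFieldType) (t p x c a : nat) (ps : seq nat) :
  p \in ps -> uniq ps -> prime p -> coprime p c -> coprime p a ->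
  {in ps, forall q, q != p -> q %| c}%N ->
  \sum_(j < p) \prod_(q <- ps) kern R t q ((x + j * c) * a) = 0.
Proof.
move=> pps ups pp cc ca dv.
rewrite (eq_bigr (fun j : 'I_p => kern R t p ((x + j * c) * a) * \prod_(q <- ps | q != p) kern R t q (x * a))).
  by rewrite -mulr_suml sum_kern_shift // mul0r.
move=> j _; rewrite (bigD1_seq p) //=; congr (_ * _).
rewrite big_seq_cond [RHS]big_seq_cond; apply: eq_bigr => q /andP[qs qp].
apply: kern_mod; rewrite mulnDl -modnDmr -[(j * c * a)%N]mulnA mulnCA -modnMml.
by have /eqP -> := dv q qs qp; rewrite mul0n mod0n addn0.
Qed.

(** A sum over a full period does not change under shifts, so it may be averaged over the p shifts
    by multiples of c. *)
Lemma sum_period_eq0 (R : realFieldType) (F : nat -> R) (L p c : nat) :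
  (0 < p)%N -> (forall x, F (x + L)%N = F x) ->
  (forall x, \sum_(j < p) F (x + j * c)%N = 0) -> \sum_(x < L) F x = 0.
Proof.
move=> p0 per z.
have : p%:R * \sum_(x < L) F x = 0.
  transitivity (\sum_(j < p) \sum_(x < L) F (x + j * c)%N).
    rewrite mulr_natl -[X in _ *+ X]card_ord -sumr_const; apply: eq_bigr => j _.
    by rewrite -(sum_period_shift (j * c) per); apply: eq_bigr => x _; rewrite addnC.
  by rewrite exchange_big big1.
by move/eqP; rewrite mulf_eq0 pnatr_eq0 -leqn0 leqNgt p0 /= => /eqP.
Qed.

Lemma subseq_prodn (s1 s2 : seq nat) : subseq s1 s2 -> (prodn s1 %| prodn s2)%N.
Proof.
elim: s2 s1 => [|q s2 IH] [|p s1] //=; first by rewrite {1}/prodn big_nil dvd1n.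
rewrite !prodn_cons; case: eqP => [-> /IH h|_ /IH]; first exact: dvdn_mul.
by rewrite prodn_cons => h; apply: dvdn_mull.
Qed.

Lemma leq_exp2rW (m n k : nat) : (m <= n)%N -> (m ^ k <= n ^ k)%N.
Proof. by case: k => // k; rewrite leq_exp2r. Qed.

Lemma sum_bool_size (T : Type) (P : pred T) (s : seq T) :
  (\sum_(x <- s) P x = size [seq x <- s | P x])%N.
Proof. by elim: s => [|x s IH]; rewrite ?big_nil // big_cons IH /=; case: (P x). Qed.

(** The square counts pairs b, b' that solve the congruence with the same x. As t is prime to D, so
    are x + e and c, whence b = b' modulo D. For each b this leaves at most M/D + 1 values b' and
    r/D + 1 values x. *)
Lemma collision_bound (t e c r D M : nat) (B : seq nat) :
  (0 < D)%N -> (D <= r)%N -> coprime D t -> uniq B -> {in B, forall b, (b < M)%N} ->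
  {in B, forall b, coprime D (b * c)} ->
  (D ^ 2 * \sum_(x < r) (\sum_(b <- B) ((x + e) * (b * c) == t %[mod D])) ^ 2 <=
   2 * r * size B * (M + r))%N.
Proof.
move=> D0 Dr ct uB BM cB.
pose P (x b : nat) := (x + e) * (b * c) == t %[mod D].
have cx x b : P x b -> coprime D ((x + e) * (b * c)).
  by move=> /eqP h; rewrite coprime_sym -coprime_modl h coprime_modl coprime_sym.
have uniqx b : b \in B -> (D * \sum_(x < r) P x b <= r + D)%N.
  move=> bB; rewrite -(big_mkord xpredT (fun x => P x b : nat)) /index_iota subn0.
  rewrite sum_bool_size.
  apply: size_congr_le => //; first by rewrite filter_uniq ?iota_uniq.
    by move=> x; rewrite mem_filter mem_iota add0n => /andP[_ /andP[]].
  move=> x y; rewrite !mem_filter => /andP[/eqP hx _] /andP[/eqP hy _].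
  have /(eqmod_mul_cancel (cB _ bB))/eqP : (x + e) * (b * c) = (y + e) * (b * c) %[mod D] by rewrite hx hy.
  by rewrite eqn_modDr => /eqP.
have uniqb b : b \in B -> (D * \sum_(b' <- B) (b == b' %[mod D]) <= M + D)%N.
  move=> bB; rewrite sum_bool_size.
  apply: size_congr_le => //; first by rewrite filter_uniq.
    by move=> x; rewrite mem_filter => /andP[_ /BM].
  by move=> x y; rewrite !mem_filter => /andP[/eqP <- _] /andP[/eqP <- _].
have step : (\sum_(x < r) (\sum_(b <- B) P x b) ^ 2 <=
    \sum_(b <- B) \sum_(b' <- B) \sum_(x < r) (b == b' %[mod D]) * P x b)%N.
  rewrite (eq_bigr (fun b => \sum_(x < r) \sum_(b' <- B) (b == b' %[mod D]) * P x b)%N); last first.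
    by move=> b _; rewrite exchange_big.
  rewrite exchange_big; apply: leq_sum => x _.
  rewrite -mulnn big_distrl /=; apply: leq_sum => b _.
  rewrite big_distrr /=; apply: leq_sum => b' _.
  case Pb: (P x b) => //; case Pb': (P x b'); rewrite ?muln0 // muln1.
  suff -> : b == b' %[mod D] by [].
  have e1 (d : nat) : ((x + e) * (d * c) = d * ((x + e) * c))%N by lia.
  have cxc : coprime D ((x + e) * c) by have := cx _ _ Pb; rewrite e1 coprimeMr => /andP[].
  apply/eqP/(eqmod_mul_cancel cxc); rewrite -!e1.
  by move/eqP: Pb => ->; move/eqP: Pb' => ->.
apply: leq_trans (leq_mul (leqnn _) step) _.
rewrite -mulnn big_distrr /=.
apply: (@leq_trans (\sum_(b <- B) (M + D) * (r + D))); last first.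
  rewrite big_const_seq count_predT iter_addn_0 mulnC.
  rewrite (_ : 2 * r * size B * (M + r) = size B * ((M + r) * (2 * r)))%N; last lia.
  by rewrite leq_mul2l; apply/orP; right; apply: leq_mul; lia.
rewrite big_seq [leqRHS]big_seq; apply: leq_sum => b bB.
have -> : (D * D * (\sum_(b' <- B) \sum_(x < r) (b == b' %[mod D]) * P x b) =
  (D * \sum_(b' <- B) (b == b' %[mod D])) * (D * \sum_(x < r) P x b))%N.
  rewrite (eq_bigr (fun b' => (b == b' %[mod D]) * \sum_(x < r) P x b)%N).
    by rewrite -big_distrl /=; lia.
  by move=> b' _; rewrite big_distrr.
by apply: leq_mul; [exact: uniqb | exact: uniqx].
Qed.

Lemma prod_indicator (R : realFieldType) (t y : nat) (ps : seq nat) :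
  all prime ps -> uniq ps ->
  \prod_(q <- ps) (q%:R * (y == t %[mod q])%:R) =
  (prodn ps)%:R * (y == t %[mod prodn ps])%:R :> R.
Proof.
move=> pps ups; rewrite eqmod_prodn // big_split /= /prodn natr_prod; congr (_ * _).
elim: ps {pps ups} => [|p ps IH]; first by rewrite big_nil.
by rewrite big_cons /= IH -natrM mulnb.
Qed.

Lemma norm_kern_le (R : realFieldType) (t p x : nat) :
  `|kern R t p x| <= 1 + p%:R * (x == t %[mod p])%:R.
Proof.
rewrite /kern; apply: le_trans (ler_normB _ _) _.
by rewrite normr1 addrC ger0_norm // mulr_ge0.
Qed.

(** Each product of kernels is expanded over the sublists S of [ps] and taken in absolute value: S
    contributes prodn S times a number of solutions modulo prodn S. Cauchy-Schwarz over the 2^j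
    sublists, then [collision_bound] for each of them, account for the factor 4^j, where j is the
    length of [ps]. *)
Lemma sqr_kern_sum_le (R : realFieldType) (t e c M : nat) (ps B : seq nat) :
  all prime ps -> uniq ps -> all (fun p => coprime p t) ps -> uniq B ->
  {in B, forall b, (b < M)%N} -> {in ps & B, forall p b, coprime p (b * c)} ->
  \sum_(x < prodn ps) (\sum_(b <- B) \prod_(q <- ps) kern R t q ((x + e) * (b * c))) ^+ 2 <=
  (4 ^ size ps * (2 * prodn ps * size B * (M + prodn ps)))%:R.
Proof.
move=> pps ups ct uB BM cB.
pose n (S : seq nat) (x : nat) : nat := (\sum_(b <- B) ((x + e) * (b * c) == t %[mod prodn S]))%N.
have subP S : S \in subs ps -> [/\ all prime S, uniq S & {subset S <= ps}].
  move=> /subs_subseq sS; split; last exact: mem_subseq.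
    by apply/allP => q /(mem_subseq sS); apply: (allP pps).
  exact: subseq_uniq sS ups.
have b1 x : `|\sum_(b <- B) \prod_(q <- ps) kern R t q ((x + e) * (b * c))| <=
    \sum_(S <- subs ps) (prodn S * n S x)%:R.
  apply: le_trans (ler_norm_sum _ _ _) _.
  apply: (@le_trans _ _ (\sum_(b <- B) \sum_(S <- subs ps)
     ((prodn S)%:R * ((x + e) * (b * c) == t %[mod prodn S])%:R))); last first.
    rewrite exchange_big /=; apply: ler_sum => S _.
    by rewrite -mulr_sumr natrM /n natr_sum.
  apply: ler_sum => b _; rewrite normr_prod.
  apply: (@le_trans _ _ (\prod_(q <- ps) (1 + q%:R * ((x + e) * (b * c) == t %[mod q])%:R))).
    by apply: ler_prod => q _; rewrite normr_ge0 norm_kern_le.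
  rewrite prod_1D big_seq [leRHS]big_seq.
  by apply: ler_sum => S /subP[S1 S2 _]; rewrite prod_indicator.
have b2 x : (\sum_(b <- B) \prod_(q <- ps) kern R t q ((x + e) * (b * c))) ^+ 2 <=
    (2 ^ size ps)%:R * \sum_(S <- subs ps) ((prodn S) ^ 2 * (n S x) ^ 2)%:R.
  rewrite -(real_normK (num_real _)).
  apply: le_trans (_ : (\sum_(S <- subs ps) (prodn S * n S x)%:R) ^+ 2 <= _).
    by rewrite lerXn2r ?nnegrE ?sumr_ge0.
  apply: le_trans (ler_sqr_sum _ _) _; rewrite size_subs ler_wpM2l //.
  by apply: ler_sum => S _; rewrite -natrX expnMn.
apply: (@le_trans _ _ (\sum_(x < prodn ps) (2 ^ size ps)%:R *
   \sum_(S <- subs ps) ((prodn S) ^ 2 * (n S x) ^ 2)%:R)).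
  by apply: ler_sum => x _; apply: b2.
rewrite -mulr_sumr exchange_big /= (_ : 4 = 2 * 2)%N // expnMn -mulnA natrM ler_wpM2l //.
apply: (@le_trans _ _ (\sum_(S <- subs ps) (2 * prodn ps * size B * (M + prodn ps))%:R)); last first.
  by rewrite big_const_seq count_predT iter_addr_0 size_subs -mulrnA mulnC.
rewrite big_seq [leRHS]big_seq; apply: ler_sum => S Ss; have [S1 S2 S3] := subP S Ss.
rewrite -natr_sum ler_nat -big_distrr /=.
apply: collision_bound => //.
- exact: prodn_primes_gt0.
- apply: dvdn_leq; first exact: prodn_primes_gt0.
  by have := subs_subseq Ss; move=> /subseq_prodn.
- by rewrite coprime_prodn; apply/allP => q /S3; apply: (allP ct).
- by move=> b bB; rewrite coprime_prodn; apply/allP => q /S3 qp; apply: cB.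
Qed.

(** Duality: the absolute values are written with signs, Cauchy-Schwarz extends the sum over a from
    A to all integers up to h, and the large sieve applies to the functions that remain. With R =
    U^j its off-diagonal part is dominated by h^(K+1) once R^(2K+3) <= h^(K+1), so h need only be
    slightly larger than R^2. *)
Lemma core_bound (R : realFieldType) (t U Z h c j K : nat) (Ss : seq (seq nat)) (A B : seq nat) :
  size Ss = j -> uniq (flatten Ss) -> all prime (flatten Ss) ->
  all (fun p => Z <= p <= U)%N (flatten Ss) ->
  all (fun p => coprime p t) (flatten Ss) ->
  {in flatten Ss & B, forall p b, coprime p (b * c)} ->
  uniq A -> {in A, forall a, (a <= h)%N} -> uniq B -> {in B, forall b, (b <= U ^ j)%N} ->
  (0 < Z)%N -> ((U ^ j) ^ (2 * K + 3) <= h ^ K.+1)%N ->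
  (Z ^ j)%:R * (\sum_(ps <- tuples Ss)
     `|\sum_(a <- A) \sum_(b <- B) \prod_(q <- ps) kern R t q (a * (b * c))|) ^+ 2 <=
  (12 * (K + 3) ^ K.+1 * 4 ^ j * h * (U ^ j) ^ 2 * (size A * size B * size (tuples Ss)))%:R.
Proof.
move=> sS uS pS ZU ct cB uA Ah uB BU Z0 Uh.
set I := tuples Ss; set Rb := (U ^ j)%N; set R0 := (Z ^ j)%N.
have [I0|[ps0 ps0I]] : size I = 0%N \/ exists ps, ps \in I.
- by case: I => [|x s]; [left | right; exists x; rewrite inE eqxx].
- by rewrite (size0nil I0) big_nil expr0n mulr0.
have psP ps : ps \in I -> [/\ all prime ps, uniq ps, size ps = j & {subset ps <= flatten Ss}].
  move=> psI; split; last exact: mem_tuples_flatten.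
  - by apply/allP => q /(mem_tuples_flatten psI); apply: (allP pS).
  - exact: uniq_mem_tuples psI.
  - by rewrite (size_mem_tuples psI).
have rb ps : ps \in I -> (R0 <= prodn ps <= Rb)%N.
  move=> /psP[_ _ sz sub]; rewrite /R0 /Rb -sz; apply/andP; split.
    by apply: prodn_ge; apply/allP => q /sub /(allP ZU)/andP[].
  by apply: prodn_le; apply/allP => q /sub /(allP ZU)/andP[].
have R00 : (0 < R0)%N by rewrite expn_gt0 Z0.
have R0b : (R0 <= Rb)%N by have /andP[h1 h2] := rb _ ps0I; apply: leq_trans h1 h2.
have Rbh : (Rb <= h)%N.
  rewrite -(@leq_exp2r _ _ K.+1) //; apply: leq_trans Uh.
  by apply: leq_pexp2l; [exact: leq_trans R00 R0b | clear; lia].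
(* The sieve controls the window [s0, s0 + h], but a lies in [0, h]. As s0 + e = s0 * U! vanishes
   modulo every prime up to U, adding e inside the kernels undoes the translation. *)
pose s0 := (K * h)%N; pose e := (s0 * (U`!).-1)%N.
have es (q n : nat) : (0 < q <= U)%N -> s0 + n + e = n %[mod q].
  move=> qU; rewrite /e [(s0 + n)%N]addnC -addnA -mulnS prednK ?fact_gt0 //.
  by rewrite -modnDmr -modnMmr; have /eqP -> := dvdn_fact qU; rewrite muln0 mod0n addn0.
pose f ps := \sum_(a <- A) \sum_(b <- B) \prod_(q <- ps) kern R t q (a * (b * c)).
pose g ps (x : nat) := Num.sg (f ps) * \sum_(b <- B) \prod_(q <- ps) kern R t q ((x + e) * (b * c)).
have gE ps n : ps \in I -> g ps (s0 + n)%N = Num.sg (f ps) * \sum_(b <- B) \prod_(q <- ps) kern R t q (n * (b * c)).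
  move=> /psP[pr _ _ sub]; congr (_ * _); apply: eq_bigr => b _; apply: eq_big_seq => q qps.
  apply: kern_mod; rewrite -modnMml es ?modnMml //.
  by rewrite prime_gt0 ?(allP pr) //; have /andP[] := allP ZU q (sub q qps).
have per : {in I, forall ps x, g ps (x + prodn ps)%N = g ps x}.
  move=> ps psI x; congr (_ * _); apply: eq_bigr => b _; apply: eq_big_seq => q qps.
  apply: kern_mod; rewrite addnAC -modnMml -modnDmr.
  by have /eqP -> := dvdn_prodn qps; rewrite addn0 modnMml.
have orth : {in I &, forall ps ps', ps != ps' ->
    \sum_(x < prodn ps * prodn ps') g ps x * g ps' x = 0}.
  move=> ps ps' psI ps'I ne.
  have [pr up _ sub] := psP _ psI; have [pr' up' _ sub'] := psP _ ps'I.
  have [p p1 p2] := tuples_distinct uS psI ps'I ne.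
  have pp := allP pr p p1; have p0 := prime_gt0 pp.
  have rE : prodn ps = (p * prodn (rem p ps))%N.
    by rewrite -prodn_cons /prodn (perm_big _ (perm_to_rem p1)).
  (* Multiples of cc are divisible by all primes of ps' and by all primes of ps except p, so that
     shifting by them fixes g ps' and moves only the factor at p in g ps. *)
  pose cc := (prodn (rem p ps) * prodn ps')%N.
  have pr_rem : all prime (rem p ps) by apply/allP => q /mem_rem; apply: (allP pr).
  have ccp : coprime p cc.
    rewrite coprimeMr !prime_coprime // !prime_dvd_prodn // p2 andbT.
    by rewrite mem_rem_uniq // inE eqxx.
  apply: (@sum_period_eq0 _ (fun x => g ps x * g ps' x) _ p cc) => // x.
    rewrite [X in _ * X]period_mul; last by move=> y; exact: per.
    by rewrite mulnC period_mul //; move=> y; exact: per.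
  rewrite (eq_bigr (fun j0 : 'I_p => g ps' x * g ps (x + j0 * cc)%N)); last first.
    move=> j0 _; rewrite mulrC; congr (_ * _).
    by rewrite /cc mulnA period_mul //; move=> y; exact: per.
  rewrite -mulr_sumr; suff -> : \sum_(i < p) g ps (x + i * cc)%N = 0 by rewrite mulr0.
  rewrite -mulr_sumr exchange_big big_seq big1 ?mulr0 //= => b bB.
  rewrite (eq_bigr (fun j0 : 'I_p => \prod_(q <- ps) kern R t q ((x + e + j0 * cc) * (b * c)))).
    apply: sum_prod_kern_shift => //; first by apply: cB => //; exact: sub.
    move=> q qps qp; apply: dvdn_mulr; apply: dvdn_prodn.
    by rewrite mem_rem_uniq // inE qp.
  by move=> j0 _; rewrite addnAC.
(* Room for K shifts below h and for the h + 1 integers of the window. *)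
pose H := ((K + 2) * h)%N.
have := @weak_large_sieve R _ I prodn g R0 Rb H K h s0 h.+1 (uniq_tuples uS) R00 rb per orth.
move=> /(_ _ _ _) /=.
have h0 : (0 < h)%N by exact: leq_trans (leq_trans R00 R0b) Rbh.
have hH : (h <= H)%N by rewrite /H leq_pmull // addn2.
have sH : (s0 + h.+1 <= H)%N by rewrite /H /s0 mulnDl leq_add2l; move: h0; clear; lia.
move=> /(_ hH (leqnn _) sH) LS.
set W := \sum_(ps <- I) _.
pose V n := \sum_(ps <- I) g ps (s0 + n)%N.
have WV : W = \sum_(a <- A) V a.
  rewrite exchange_big /=; apply: eq_big_seq => ps psI.
  rewrite -/(f ps) normrEsg -/(f ps) {2}/f mulr_sumr; apply: eq_bigr => a _.
  by rewrite gE.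
have WA : W ^+ 2 <= (size A)%:R * \sum_(n < h.+1) V n ^+ 2.
  rewrite WV; apply: le_trans (ler_sqr_sum _ _) _; rewrite ler_wpM2l //.
  rewrite -(big_mkord xpredT (fun n => V n ^+ 2)).
  apply: ler_sum_subset => //; [exact: iota_uniq | | by move=> x; exact: sqr_ge0].
  by move=> a /Ah ah; rewrite mem_index_iota ltnS.
(* The 6 comes from 2 r |B| (R + 1 + r) with r <= R and 1 <= R. *)
have Gam : \sum_(ps <- I) \sum_(x < prodn ps) g ps x ^+ 2 <=
    (size I * (4 ^ j * (6 * Rb ^ 2 * size B)))%:R.
  apply: (@le_trans _ _ (\sum_(ps <- I) (4 ^ j * (6 * Rb ^ 2 * size B))%:R)); last first.
    by rewrite big_const_seq count_predT iter_addr_0 -mulrnA mulnC.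
  rewrite big_seq [leRHS]big_seq; apply: ler_sum => ps psI.
  have [pr up sz sub] := psP _ psI; have /andP[_ rR] := rb _ psI.
  have := @sqr_kern_sum_le R t e c Rb.+1 ps B pr up.
  have -> : all (fun p => coprime p t) ps by apply/allP => q /sub; apply: (allP ct).
  move=> /(_ isT uB) h1.
  apply: (@le_trans _ _ (4 ^ size ps * (2 * prodn ps * size B * (Rb.+1 + prodn ps)))%:R).
    apply: le_trans (h1 _ _); last 2 first.
    - by move=> b /BU; rewrite ltnS.
    - by move=> p b pps; apply: cB; exact: sub.
    apply: ler_sum => x _; rewrite exprMn -[leRHS]mul1r ler_wpM2r ?sqr_ge0 //.
    by rewrite sqr_sg; case: (_ != 0).
  rewrite sz ler_nat leq_mul2l; apply/orP; right.
  have e6 (x y : nat) : (6 * x ^ 2 * y = 2 * x * y * (3 * x))%N by clear; rewrite -mulnn; lia.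
  rewrite e6; apply: leq_mul; first by rewrite !leq_mul.
  by move: rR (leq_trans R00 R0b); generalize Rb (prodn ps); clear; lia.
have sI : (size I <= Rb)%N.
  rewrite /Rb -sS; apply: size_tuples_le => //; apply/allP => p pp.
  by have /andP[h1 h2] := allP ZU p pp; rewrite h2 andbT (leq_trans Z0 h1).
(* R0 cancels the number of periods H/R0 + 1 on the diagonal; off the diagonal [Uh] applies. *)
have brack : R0%:R * (H%:R ^+ K * ((H %/ R0).+1)%:R + (Rb ^ 2)%:R ^+ K * Rb%:R * (size I)%:R) <=
   (2 * (K + 3) ^ K.+1 * h ^ K.+1)%:R :> R.
  rewrite -!natrX -!natrM -natrD -natrM ler_nat mulnDr.
  have i1 : (R0 * (H ^ K * (H %/ R0).+1) <= (K + 3) ^ K.+1 * h ^ K.+1)%N.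
    rewrite -expnMn expnS mulnCA mulnC.
    apply: leq_mul; last by apply: leq_exp2rW; rewrite /H leq_mul2r leq_add2l orbT.
    rewrite mulnS; have := leq_trunc_div H R0; rewrite mulnC.
    move: (leq_trans R0b Rbh); rewrite /H; generalize R0 (((K + 2) * h) %/ R0)%N; clear; nia.
  have i2 : (R0 * ((Rb ^ 2) ^ K * Rb * size I) <= h ^ K.+1)%N.
    apply: leq_trans Uh; rewrite -/Rb -expnM expnD 2!expnS expn1.
    have e4 (x y z w : nat) : (x * (y * z * w) = y * (z * (w * x)))%N by clear; lia.
    by rewrite e4 !leq_mul.
  have : (0 < (K + 3) ^ K.+1)%N by rewrite expn_gt0 addn3.
  move: i1 i2; generalize (R0 * (H ^ K * (H %/ R0).+1))%N (R0 * ((Rb ^ 2) ^ K * Rb * size I))%N.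
  generalize ((K + 3) ^ K.+1)%N (h ^ K.+1)%N; clear; nia.
have hK : 0 < h%:R ^+ K :> R by rewrite exprn_gt0 // ltr0n.
rewrite -(ler_pM2l hK).
apply: (@le_trans _ _ (h%:R ^+ K * (R0%:R * ((size A)%:R * \sum_(n < h.+1) V n ^+ 2)))).
  by rewrite !ler_wpM2l // ltW.
apply: (@le_trans _ _ ((size A)%:R * (R0%:R * ((H%:R ^+ K * ((H %/ R0).+1)%:R + (Rb ^ 2)%:R ^+ K * Rb%:R * (size I)%:R) *
  (size I * (4 ^ j * (6 * Rb ^ 2 * size B)))%:R)))).
  rewrite (_ : h%:R ^+ K * _ = (size A)%:R * (R0%:R * (h%:R ^+ K * \sum_(n < h.+1) V n ^+ 2))); last by ring.
  rewrite !ler_wpM2l //; apply: le_trans LS _; rewrite ler_wpM2l //.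
rewrite [X in _ * X]mulrA.
apply: (@le_trans _ _ ((size A)%:R * ((2 * (K + 3) ^ K.+1 * h ^ K.+1)%:R *
  (size I * (4 ^ j * (6 * Rb ^ 2 * size B)))%:R))).
  by rewrite ler_wpM2l // ler_wpM2r.
rewrite -natrX -!natrM ler_nat; apply/eq_leq; rewrite (expnS h K) -/Rb.
move: (Rb ^ 2)%N (4 ^ j)%N (h ^ K)%N ((K + 3) ^ K.+1)%N (size A) (size B) (size I) => *; clear; lia.
Qed.

(** * Equidistribution on average *)

(** For fixed c the sum over N = a b c falls under [core_bound], with a extended to all integers up
    to U^k1. Compared with the trivial bound, the square of the sum saves Z^k2 up to constants and
    powers of U/Z. So the factor b produces the gain, and the last hypothesis says that it amounts
    to xi^j. *)
Lemma level_bound (R : realFieldType) (t U Z j k1 k2 K : nat) (xi : R)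
    (Ss As Bs Cs : seq (seq nat)) :
  size Ss = j -> size As = k1 -> size Bs = k2 -> (k2 <= j)%N ->
  uniq (flatten (Ss ++ As ++ Bs ++ Cs)) ->
  all (fun p => prime p && (Z <= p <= U)%N) (flatten (Ss ++ As ++ Bs ++ Cs)) ->
  all (fun P => Z <= size P)%N (Ss ++ As ++ Bs ++ Cs) ->
  all (fun p => coprime p t) (flatten Ss) ->
  (0 < Z)%N -> (0 < U)%N -> (j * (2 * K + 3) <= k1 * K.+1)%N -> 0 <= xi ->
  (12 * (K + 3) ^ K.+1 * 4 ^ j * U ^ k1 * (U ^ j) ^ 2)%:R <=
    xi ^+ (2 * j) * (Z ^ (k1 + 2 * j + k2))%:R ->
  \sum_(ps <- tuples Ss)
     `|\sum_(N <- tuples (As ++ Bs ++ Cs)) \prod_(q <- ps) kern R t q (prodn N)| <=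
  (size (tuples (As ++ Bs ++ Cs)))%:R * (size (tuples Ss))%:R * xi ^+ j.
Proof.
move=> sS sA sB k2j; rewrite !flatten_cat !cat_uniq !all_cat !has_cat !negb_or.
move=> /and3P[uS /andP[_ /andP[disSB disSC]] /and3P[uA _ /and3P[uB _ _]]].
move=> /and4P[aS aA aB aC] /and4P[zS zA zB zC] ct Z0 U0 kj xi0 num.
have allpr s : all (fun p => prime p && (Z <= p <= U)%N) s -> all prime s.
  by apply: sub_all => p /andP[].
have allZU s : all (fun p => prime p && (Z <= p <= U)%N) s -> all (fun p => Z <= p <= U)%N s.
  by apply: sub_all => p /andP[].
have tupU Qs ps : all (fun p => prime p && (Z <= p <= U)%N) (flatten Qs) ->
    ps \in tuples Qs -> (prodn ps <= U ^ size Qs)%N.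
  move=> /allP aP h; rewrite -(size_mem_tuples h); apply: prodn_le; apply/allP => q.
  by move=> /(mem_tuples_flatten h)/aP/and3P[].
have cop Qs ps : all (fun p => prime p && (Z <= p <= U)%N) (flatten Qs) ->
    ~~ has (mem (flatten Ss)) (flatten Qs) -> ps \in tuples Qs ->
    {in flatten Ss, forall p, coprime p (prodn ps)}.
  move=> aQ /hasPn dis h p pS.
  rewrite prime_coprime ?(allP (allpr _ aS)) // prime_dvd_prodn //; last 2 first.
  - exact: (allP (allpr _ aS)).
  - by apply/allP => q /(mem_tuples_flatten h); apply: (allP (allpr _ aQ)).
  by apply/negP => /(mem_tuples_flatten h)/dis; rewrite /= pS.
set A := map prodn (tuples As); set B := map prodn (tuples Bs).
set I := tuples Ss.
have core c : c \in tuples Cs ->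
  \sum_(ps <- I) `|\sum_(a <- A) \sum_(b <- B) \prod_(q <- ps) kern R t q (a * (b * prodn c))| <=
  (size A)%:R * (size B)%:R * (size I)%:R * xi ^+ j.
  move=> cC.
  have := @core_bound R t U Z (U ^ k1) (prodn c) j K Ss A B sS uS (allpr _ aS) (allZU _ aS) ct.
  set W := \sum_(ps <- I) _ => h.
  have W0 : 0 <= W by apply: sumr_ge0.
  have {}h : (Z ^ j)%:R * W ^+ 2 <= (12 * (K + 3) ^ K.+1 * 4 ^ j * U ^ k1 * (U ^ j) ^ 2 * (size A * size B * size I))%:R.
    apply: h => //.
    - move=> p b pS /mapP[bs bsB ->]; rewrite coprimeMr.
      by rewrite (cop Bs bs) ?(cop Cs c).
    - exact: uniq_prods (allpr _ aA).
    - by move=> a /mapP[as_ h ->]; rewrite -sA tupU.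
    - exact: uniq_prods (allpr _ aB).
    - move=> b /mapP[bs h ->]; apply: leq_trans (tupU _ _ aB h) _.
      by rewrite sB leq_pexp2l.
    - by rewrite -!expnM leq_pexp2l.
  have Zj : 0 < (Z ^ j)%:R :> R by rewrite ltr0n expn_gt0 Z0.
  rewrite -(ler_pXn2r (n := 2)) ?nnegrE ?mulr_ge0 ?exprn_ge0 //.
  rewrite -(ler_pM2l Zj); apply: le_trans h _; rewrite natrM.
  apply: le_trans (ler_wpM2r _ num) _ => //.
  have sizes : (Z ^ (k1 + 2 * j + k2) <= Z ^ j * (size A * size B * size I))%N.
    rewrite (_ : k1 + 2 * j + k2 = j + (k1 + k2 + j))%N; last by clear; lia.
    rewrite !(expnD Z) !size_map; apply: leq_mul => //; apply: leq_mul; last by rewrite -sS size_tuples_ge.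
    by apply: leq_mul; [rewrite -sA size_tuples_ge | rewrite -sB size_tuples_ge].
  rewrite -(ler_nat R) natrM in sizes.
  set X := (size A * size B * size I)%N in sizes *.
  rewrite -!natrM -/X exprMn -exprM [(j * 2)%N]mulnC.
  apply: (@le_trans _ _ (xi ^+ (2 * j) * ((Z ^ j)%:R * X%:R) * X%:R)).
    by rewrite ler_wpM2r // ler_wpM2l // exprn_ge0.
  by rewrite le_eqVlt; apply/orP; left; apply/eqP; ring.
pose F ps a b c := \prod_(q <- ps) kern R t q (prodn a * (prodn b * prodn c)).
apply: (@le_trans _ _ (\sum_(ps <- I) \sum_(c <- tuples Cs)
   `|\sum_(a <- tuples As) \sum_(b <- tuples Bs) F ps a b c|)).
  apply: ler_sum => ps _.
  rewrite (_ : \sum_(N <- _) _ = \sum_(c <- tuples Cs) \sum_(a <- tuples As) \sum_(b <- tuples Bs) F ps a b c).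
    exact: ler_norm_sum.
  rewrite sum_tuples_cat [RHS]exchange_big /=; apply: eq_bigr => a _.
  rewrite sum_tuples_cat [RHS]exchange_big /=; apply: eq_bigr => b _; apply: eq_bigr => c _.
  by rewrite !prodn_cat.
rewrite exchange_big /=.
apply: (@le_trans _ _ (\sum_(c <- tuples Cs) (size A)%:R * (size B)%:R * (size I)%:R * xi ^+ j)).
  rewrite big_seq [leRHS]big_seq; apply: ler_sum => c /core.
  apply: le_trans; rewrite le_eqVlt; apply/orP; left; apply/eqP.
  by apply: eq_bigr => ps _; rewrite big_map; congr `|_|; apply: eq_bigr => a _; rewrite big_map.
rewrite big_const_seq count_predT iter_addr_0 -[_ *+ _]mulr_natr !size_map.
rewrite !size_tuples !big_cat /= -!size_tuples !natrM.
by rewrite le_eqVlt; apply/orP; left; apply/eqP; ring.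
Qed.

(** The binomial theorem over the blocks. In the induction the prime of the first block is absorbed
    into [G], and the factor size P * xi into [W], which is why both are arbitrary. *)
Lemma sum_subs_tuples_le (R : realFieldType) (G : seq nat -> R) (Qs : seq (seq nat)) (W xi : R) :
  0 <= xi ->
  (forall Ss, subseq Ss Qs ->
     \sum_(r <- tuples Ss) G r <= (size (tuples Ss))%:R * xi ^+ size Ss * W) ->
  \sum_(ps <- tuples Qs) \sum_(S <- subs ps) G S <=
  (size (tuples Qs))%:R * (1 + xi) ^+ size Qs * W.
Proof.
move=> xi0; elim: Qs G W => [|P Qs IH] G W H.
  have := H [::] isT; by rewrite /= !big_seq1 !expr0.
pose G' S := \sum_(p <- P) G (p :: S).
have h1 := IH G W (fun Ss sub => H Ss (subseq_trans sub (subseq_cons _ _))).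
have h2 : \sum_(ps <- tuples Qs) \sum_(S <- subs ps) G' S <=
    (size (tuples Qs))%:R * (1 + xi) ^+ size Qs * ((size P)%:R * xi * W).
  apply: IH => Ss sub; have := H (P :: Ss); rewrite /= eqxx => /(_ sub).
  rewrite size_allpairs natrM big_allpairs_dep exchange_big /= exprS.
  by move=> /le_trans; apply; rewrite le_eqVlt; apply/orP; left; apply/eqP; ring.
rewrite sum_tuples_cons /= size_allpairs natrM exprS.
have -> : \sum_(p <- P) \sum_(ps <- tuples Qs) \sum_(S <- subs (p :: ps)) G S =
  (size P)%:R * (\sum_(ps <- tuples Qs) \sum_(S <- subs ps) G S) +
  \sum_(ps <- tuples Qs) \sum_(S <- subs ps) G' S.
  rewrite (eq_bigr (fun p => \sum_(ps <- tuples Qs) \sum_(S <- subs ps) G S +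
      \sum_(ps <- tuples Qs) \sum_(S <- subs ps) G (p :: S))); last first.
    move=> p _; rewrite -big_split /=; apply: eq_bigr => ps _.
    by rewrite big_cat /= big_map.
  rewrite big_split /= big_const_seq count_predT iter_addr_0 mulr_natl; congr (_ + _).
  rewrite exchange_big /=; apply: eq_bigr => ps _.
  by rewrite exchange_big.
have := ler_wpM2l (ler0n R (size P)) h1.
by move=> h3; apply: le_trans (lerD h3 h2) _; rewrite le_eqVlt; apply/orP; left; apply/eqP; ring.
Qed.

(** Replaces the conditions of [level_bound], one for each j, by a single one, which is possible
    because Z^k2 is at least the power j/(K+1) of Z. The exponent 4j + k2 of U/Z is at most 5j, and
    12 * 4^j <= 48^j. *)
Lemma level_numeric (R : realFieldType) (U Z j k2 K : nat) (xi : R) :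
  (0 < j)%N -> (k2 <= j)%N -> (j <= k2 * K.+1)%N -> (0 < Z)%N -> (Z <= U)%N -> 0 < xi -> xi <= 1 ->
  ((48 * (K + 3) ^ K.+1)%:R * (U%:R / Z%:R) ^+ 5) ^+ K.+1 <= xi ^+ (2 * K.+1) * Z%:R ->
  (12 * (K + 3) ^ K.+1 * 4 ^ j * U ^ (2 * j + k2) * (U ^ j) ^ 2)%:R <=
    xi ^+ (2 * j) * (Z ^ ((2 * j + k2) + 2 * j + k2))%:R.
Proof.
move=> j0 k2j jk Z0 ZU xi0 xi1 H.
have z0 : 0 < Z%:R :> R by rewrite ltr0n.
have [E EE] : exists E, E = ((K + 3) ^ K.+1)%N by eexists.
have E1 : (0 < E)%N by rewrite EE expn_gt0 addn3.
have [g gE] : exists g : R, g = U%:R / Z%:R by eexists.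
rewrite -EE -gE in H; rewrite -EE.
have g1 : 1 <= g by rewrite gE ler_pdivlMr // mul1r ler_nat.
have UE : U%:R = g * Z%:R :> R by rewrite gE mulfVK // gt_eqF.
pose b : R := (48 * E)%:R.
have b1 : 1 <= b by rewrite /b -[1]/(1%:R) ler_nat muln_gt0.
pose q := b * g ^+ 5 / xi ^+ 2.
have q1 : 1 <= q.
  rewrite /q ler_pdivlMr ?exprn_gt0 // mul1r.
  apply: (@le_trans _ _ 1); first by rewrite exprn_ile1 // ltW.
  by rewrite mulr_ege1 // exprn_ege1.
have qZ : q ^+ K.+1 <= Z%:R.
  by rewrite /q expr_div_n -exprM ler_pdivrMr ?exprn_gt0 // [leRHS]mulrC.
have qj : q ^+ j <= Z%:R ^+ k2.
  apply: (@le_trans _ _ (q ^+ (k2 * K.+1))); first by rewrite ler_weXn2l.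
  rewrite mulnC exprM; apply: lerXn2r; rewrite ?nnegrE ?exprn_ge0 //.
  by apply: le_trans q1.
have bg : b ^+ j * g ^+ (5 * j) <= xi ^+ (2 * j) * Z%:R ^+ k2.
  have x0 : 0 < xi ^+ (2 * j) by rewrite exprn_gt0.
  by rewrite [leRHS]mulrC -ler_pdivrMr //; move: qj; rewrite /q expr_div_n exprMn -!exprM.
have -> : (12 * E * 4 ^ j * U ^ (2 * j + k2) * (U ^ j) ^ 2)%:R =
   (12 * E%:R * 4 ^+ j * g ^+ (4 * j + k2)) * Z%:R ^+ (2 * j + k2 + 2 * j) :> R.
  rewrite -expnM !natrM !natrX UE !exprMn [(j * 2)%N]mulnC.
  rewrite (_ : 4 * j + k2 = 2 * j + k2 + 2 * j)%N; last by clear; lia.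
  by rewrite (exprD g (2 * j + k2)) (exprD Z%:R (2 * j + k2)); ring.
rewrite natrX (exprD Z%:R (2 * j + k2 + 2 * j) k2) [leRHS]mulrCA [leRHS]mulrC ler_wpM2r ?exprn_ge0 //.
apply: le_trans bg; apply: ler_pM; rewrite ?mulr_ge0 ?exprn_ge0 //.
- by apply: le_trans g1.
- have -> : b = 4%:R * (12 * E%:R) by rewrite /b natrM; ring.
  rewrite exprMn mulrC ler_wpM2l ?exprn_ge0 // ler_eXnr //.
  by rewrite -natrM ler1n muln_gt0.
- by rewrite ler_weXn2l //; move: k2j; clear; lia.
Qed.

(** The head is the trivial conductor, which contributes the main term. *)
Lemma subs_head (ps : seq nat) : exists r, subs ps = [::] :: r.
Proof. by elim: ps => [|p ps [r rE]]; [exists [::] | rewrite /= rE; eexists]. Qed.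

Lemma subseq_flatten_cat (Ss Qs Ns : seq (seq nat)) :
  subseq Ss Qs -> subseq (flatten (Ss ++ Ns)) (flatten (Qs ++ Ns)).
Proof. by move=> h; apply: uniq_flatten_subseq; rewrite subseq_cat2r. Qed.

(* The discrepancy is expanded over the squarefree conductors; a conductor with
   j prime factors is handled by applying the large sieve to the factors of N
   lying in 2j + ceil(j/(K+1)) of the blocks, and saves xi^j. *)
Lemma equidistribution (R : realFieldType) (t U Z K : nat) (xi : R) (Qs Ns : seq (seq nat)) :
  uniq (flatten (Qs ++ Ns)) ->
  all (fun p => prime p && (Z <= p <= U)%N) (flatten (Qs ++ Ns)) ->
  all (fun P => Z <= size P)%N (Qs ++ Ns) ->
  all (fun p => coprime p t) (flatten Qs) ->
  (0 < Z)%N -> (Z <= U)%N ->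
  (2 * size Qs + 2 * ((size Qs + K) %/ K.+1) <= size Ns)%N -> 0 < xi -> xi <= 1 ->
  ((48 * (K + 3) ^ K.+1)%:R * (U%:R / Z%:R) ^+ 5) ^+ K.+1 <= xi ^+ (2 * K.+1) * Z%:R ->
  \sum_(ps <- tuples Qs)
    `|(prodn ps)%:R * (\sum_(N <- tuples Ns) (prodn N == t %[mod prodn ps])%:R)
      - (size (tuples Ns))%:R| <=
  (size (tuples Ns))%:R * (size (tuples Qs))%:R * ((1 + xi) ^+ size Qs - 1).
Proof.
move=> uQN aQN zQN ct Z0 ZU kv xi0 xi1 num.
pose G ps : R := \sum_(N <- tuples Ns) \prod_(q <- ps) kern R t q (prodn N).
have G0 : G [::] = (size (tuples Ns))%:R.
  rewrite /G (eq_bigr (fun=> 1)); last by move=> N _; rewrite big_nil.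
  by rewrite big_const_seq count_predT iter_addr_0.
have pQ : all prime (flatten Qs).
  by apply/allP => p pQ; have := allP aQN p; rewrite flatten_cat mem_cat pQ => /(_ isT)/andP[].
have uQ : uniq (flatten Qs) by move: uQN; rewrite flatten_cat cat_uniq => /and3P[].
have expand ps : ps \in tuples Qs ->
    (prodn ps)%:R * (\sum_(N <- tuples Ns) (prodn N == t %[mod prodn ps])%:R) =
    \sum_(S <- subs ps) G S.
  move=> h; rewrite mulr_sumr [RHS]exchange_big /=; apply: eq_bigr => N _.
  rewrite -prod_1D -prod_indicator.
  - by apply: eq_bigr => q _; rewrite /kern addrC subrK.
  - by apply/allP => q /(mem_tuples_flatten h); apply: (allP pQ).
  - exact: uniq_mem_tuples h.
have main : \sum_(ps <- tuples Qs) \sum_(S <- subs ps) `|G S| <=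
    (size (tuples Qs))%:R * (1 + xi) ^+ size Qs * (size (tuples Ns))%:R.
  apply: sum_subs_tuples_le; first exact: ltW.
  move=> Ss sub.
  have [->|Ss0] := eqVneq Ss [::].
    by rewrite /= big_seq1 G0 expr0 !mul1r ger0_norm.
  set j := size Ss; have j0 : (0 < j)%N by rewrite lt0n size_eq0.
  have jv : (j <= size Qs)%N by apply: size_subseq.
  have [k2 k2E] : exists k2, k2 = ((j + K) %/ K.+1)%N by eexists.
  have k2v : (k2 <= (size Qs + K) %/ K.+1)%N by rewrite k2E; apply: leq_div2r; rewrite leq_add2r.
  have jk : (j <= k2 * K.+1)%N.
    have := divn_eq (j + K) K.+1; have := ltn_pmod (j + K) (ltn0Sn K).
    by rewrite -k2E; generalize j ((j + K) %% K.+1)%N; clear; lia.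
  have k2j : (k2 <= j)%N.
    by rewrite -ltnS k2E ltn_divLR //; move: j0; generalize j; clear; nia.
  pose k1 := (2 * j + k2)%N.
  have k1k2 : (k1 + k2 <= size Ns)%N by move: jv k2v kv; rewrite /k1; clear; lia.
  have NsE : Ns = take k1 Ns ++ take k2 (drop k1 Ns) ++ drop k2 (drop k1 Ns) by rewrite !cat_take_drop.
  have := @level_bound R t U Z j k1 k2 K xi Ss (take k1 Ns) (take k2 (drop k1 Ns)) (drop k2 (drop k1 Ns)).
  rewrite -NsE -/j -/(G _) => LB.
  apply: (@le_trans _ _ ((size (tuples Ns))%:R * (size (tuples Ss))%:R * xi ^+ j)).
    apply: LB => //.
    - by rewrite size_takel //; apply: leq_trans k1k2; rewrite leq_addr.
    - by rewrite size_takel // size_drop; move: k1k2; clear; lia.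
    - exact: subseq_uniq (subseq_flatten_cat _ sub) uQN.
    - apply/allP => p /(mem_subseq (subseq_flatten_cat _ sub)); exact: (allP aQN).
    - apply/allP => P h; apply: (allP zQN); move: h; rewrite !mem_cat => /orP[/(mem_subseq sub)->|->] //.
      by rewrite orbT.
    - apply/allP => p /(mem_subseq (uniq_flatten_subseq sub)); exact: (allP ct).
    - exact: leq_trans Z0 ZU.
    - by move: jk; rewrite /k1; clear; nia.
    - exact: ltW.
    - exact: level_numeric.
  by rewrite le_eqVlt; apply/orP; left; apply/eqP; ring.
apply: (@le_trans _ _ (\sum_(ps <- tuples Qs) (\sum_(S <- subs ps) `|G S| - (size (tuples Ns))%:R))).
  rewrite big_seq [leRHS]big_seq; apply: ler_sum => ps /expand ->.
  have [r ->] := subs_head ps; rewrite !big_cons G0 (ger0_norm (ler0n R _)).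
  by rewrite !(addrC (size (tuples Ns))%:R) !addrK ler_norm_sum.
rewrite sumrB big_const_seq count_predT iter_addr_0 mulrBr mulr1.
rewrite -[X in _ - X]mulr_natr lerB //.
by apply: le_trans main _; rewrite le_eqVlt; apply/orP; left; apply/eqP; ring.
Qed.

(** * Values of the random polynomial *)

(** A binary form of degree [size c - 1], by a recursion that isolates the first coefficient, the
    only one that matters modulo b. *)
Fixpoint homval (a b : int) (c : seq int) : int :=
  if c is x :: c' then x * a ^+ size c' + b * homval a b c' else 0.

Lemma homvalE (a b : int) (c : seq int) :
  homval a b c = \sum_(i < size c) c`_i * a ^+ (size c - i - 1) * b ^+ i.
Proof.
elim: c => [|x c IH]; first by rewrite big_ord0.
rewrite /= big_ord_recl /= expr0 mulr1 subn0 subn1 /= IH; congr (_ + _).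
rewrite mulr_sumr; apply: eq_bigr => i _; rewrite /bump /= add1n subSS exprS.
by rewrite mulrCA !mulrA; congr (_ * _); rewrite mulrC !mulrA.
Qed.

Lemma PoszX (x n : nat) : (x ^ n)%N%:Z = x%:Z ^+ n.
Proof. by elim: n => // n IH; rewrite expnS exprS PoszM IH. Qed.

Lemma residue_solution (u b : int) (s : nat) :
  b != 0 -> coprimez u b ->
  exists2 x : nat, (x < `|b|)%N & (b %| x%:Z * u - s%:Z)%Z.
Proof.
move=> b0 co; have [v [w vw]] : exists v w : int, v * u + w * b = 1.
  by have [v [w e]] := Bezoutz u b; exists v, w; rewrite e (eqP co).
exists `|((v * s%:Z) %% b)%Z|%N.
  rewrite -ltz_nat gez0_abs ?modz_ge0 //.
  by rewrite (lt_le_trans (ltz_mod _ b0)).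
rewrite gez0_abs ?modz_ge0 // -eqz_mod_dvd -modzMml modz_mod modzMml eqz_mod_dvd.
apply/dvdzP; exists (- (s%:Z * w)).
have -> : v * s%:Z * u - s%:Z = s%:Z * (v * u - 1) by ring.
have -> : v * u - 1 = - (w * b) by rewrite -vw; ring.
by ring.
Qed.

(* The coefficient c_0 is chosen in the prescribed residue class and with the
   sign that makes s - c_0 a^d no larger than s. *)
Lemma homval_representations (a b : int) (K h d : nat) (s : int) :
  0 <= a < `|b| -> coprimez a b -> (h * `|b| <= K)%N -> (`|s| < K * `|b| ^ d)%N ->
  exists L : seq (seq int), [/\ uniq L, (h ^ d <= size L)%N &
    {in L, forall c, [/\ size c = d.+1, all (fun x : int => `|x| < K)%N c & homval a b c = s]}].
Proof.
move=> /andP[a0 ab] co hK; have b0 : b != 0 by rewrite -normr_gt0 (le_lt_trans a0 ab).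
have B0 : (0 < `|b|)%N by rewrite absz_gt0.
elim: d s => [|d IH] s sK.
  (* In degree 0 the coefficient is forced; the h^d choices come from the other d coefficients. *)
  exists [:: [:: s]]; split => // c; rewrite inE => /eqP -> /=; split => //.
    by rewrite andbT; move: sK; rewrite expn0 muln1.
  by rewrite expr0 mulr1 mulr0 addr0.
have cod : coprimez (a ^+ d.+1) b by rewrite coprimezXl.
have [x0 x0b x0s] := residue_solution `|s|%N b0 cod.
pose sgn : int := if s < 0 then -1 else 1.
have sgnE : s = sgn * `|s|%N%:Z.
  by rewrite abszE /sgn; case: ltrP => h1; [rewrite ltr0_norm ?mulN1r ?opprK | rewrite ger0_norm ?mul1r].
have sgn1 : `|sgn|%N = 1%N by rewrite /sgn; case: ifP.
pose c0 i : int := sgn * (x0 + i * `|b|)%N%:Z.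
(* The values of c_0 are added one by one; the clause on c_0 keeps the lists for different values
   disjoint. *)
suff : forall m, (m <= h)%N -> exists L : seq (seq int), [/\ uniq L, (m * h ^ d <= size L)%N &
    {in L, forall c, [/\ size c = d.+2, all (fun x : int => `|x| < K)%N c, homval a b c = s &
       exists2 i, (i < m)%N & c`_0 = c0 i]}].
  move=> /(_ h (leqnn h)) [L [uL sL HL]]; by exists L; split; rewrite ?expnS // => c /HL[].
elim=> [|m IHm] mh; first by exists [::].
have [L [uL sL HL]] := IHm (ltnW mh).
have xK : (x0 + m * `|b| < K)%N.
  by apply: leq_trans hK; apply: leq_trans (_ : m.+1 * `|b| <= _)%N; rewrite ?leq_mul2r ?mh ?orbT // mulSn ltn_add2r.
have [s' s'E] : exists s' : int, s = c0 m * a ^+ d.+1 + b * s'.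
  have /dvdzP[k kE] := x0s.
  exists (- (sgn * (k + m%:Z * Num.sg b * a ^+ d.+1))).
  have bE : `|b|%N%:Z = b * Num.sg b by rewrite abszE normrEsg mulrC.
  have sE : `|s|%N%:Z = x0%:Z * a ^+ d.+1 - k * b by rewrite -kE; ring.
  rewrite {1}sgnE sE /c0 PoszD PoszM bE; ring.
have as' : (`|s'| < K * `|b| ^ d)%N.
  rewrite -(ltn_pmul2l B0) -abszM (_ : b * s' = s - c0 m * a ^+ d.+1); last by rewrite s'E; ring.
  rewrite sgnE /c0 -mulrA -mulrBr abszM sgn1 mul1n mulnCA -expnS.
  have aE : a = `|a|%N%:Z by rewrite gez0_abs.
  have aB : (`|a| ^ d.+1 <= `|b| ^ d.+1)%N.
    by rewrite leq_exp2r // -lez_nat -aE abszE ltW.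
  rewrite aE -PoszX -PoszM.
  have : ((x0 + m * `|b|) * `|a| ^ d.+1 < K * `|b| ^ d.+1)%N.
    apply: leq_ltn_trans (leq_mul (leqnn _) aB) _.
    by rewrite ltn_pmul2r ?expn_gt0 ?B0.
  by move: sK; generalize `|s|%N ((x0 + m * `|b|) * `|a| ^ d.+1)%N (K * `|b| ^ d.+1)%N; clear; lia.
have [L' [uL' sL' HL']] := IH s' as'.
exists ([seq c0 m :: c | c <- L'] ++ L); split.
- rewrite cat_uniq uL andbT map_inj_uniq ?uL' /=; last by move=> x y [].
  apply/hasPn => c cL; apply/negP => /mapP[c' _ cE].
  have [_ _ _ [i im]] := HL _ cL; rewrite cE /= /c0 => /(congr1 absz).
  rewrite !abszM sgn1 !mul1n => /eqP; rewrite eqn_add2l eqn_pmul2r // => /eqP mi.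
  by rewrite mi ltnn in im.
- by rewrite size_cat size_map mulSn leq_add.
- move=> c; rewrite mem_cat => /orP[/mapP[c' /HL'[h1 h2 h3] ->]|/HL[h1 h2 h3 [i im ci]]].
    split => /=; rewrite ?h1 ?h2 ?andbT ?h3 //; last by exists m.
    by rewrite /c0 abszM sgn1 mul1n.
  by split => //; exists i => //; apply: leq_trans im _.
Qed.

Lemma sum_digits (n m d : nat) : (0 < m)%N ->
  (\sum_(i < d.+1) base_digit n m d i * m ^ (d - i) = n %% m ^ d.+1)%N.
Proof.
move=> m0; rewrite (reindex_inj rev_ord_inj) /=.
rewrite (eq_bigr (fun i : 'I_d.+1 => ((n %/ m ^ i) %% m) * m ^ i)%N); last first.
  by move=> i _; rewrite /base_digit subSS subKn // -ltnS.
elim: d => [|d IH]; first by rewrite big_ord1 expn0 divn1 muln1 expn1.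
rewrite big_ord_recr /= IH.
have M0 : (0 < m ^ d.+1)%N by rewrite expn_gt0 m0.
move: (m ^ d.+1)%N (expnS m d.+1) M0 => M -> M0.
have e1 := divn_eq n M; have l1 := ltn_pmod n M0.
have e2 := divn_eq (n %/ M) m; have l2 := ltn_pmod (n %/ M) m0.
have nE : n = (n %/ M %/ m * (m * M) + ((n %/ M) %% m * M + n %% M))%N.
  by rewrite {1}e1 {1}e2 mulnDl mulnA addnA.
have lt : ((n %/ M) %% m * M + n %% M < m * M)%N.
  apply: (@leq_trans (((n %/ M) %% m).+1 * M)%N); last by rewrite leq_mul2r l2 orbT.
  by rewrite mulSn addnC ltn_add2r.
by rewrite [in RHS]nE modnMDl (modn_small lt) addnC.
Qed.

(** Modulo x - m y one may put x = m y, which turns the form into y^d times the base-m expansion of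
    n. *)
Lemma fhat_congr (n m d : nat) (x y : int) : (0 < m)%N -> (n < m ^ d.+1)%N ->
  exists k : int, fhat n m d x y = y ^+ d * n%:Z + k * (x - m%:Z * y).
Proof.
move=> m0 nm; have nE := sum_digits n d m0; rewrite modn_small // in nE.
have : (x - m%:Z * y %| fhat n m d x y - y ^+ d * n%:Z)%Z.
  rewrite -[in X in _ - _ * X%:Z]nE /fhat.
  rewrite (big_morph Posz PoszD (erefl _)) mulr_sumr -sumrB.
  apply: rpred_sum => -[i /= id] _.
  have -> : y ^+ d = y ^+ (d - i) * y ^+ i by rewrite -exprD subnK // -ltnS.
  rewrite PoszM PoszX.
  have -> : (base_digit n m d i)%:Z * x ^+ (d - i) * y ^+ i -
    y ^+ (d - i) * y ^+ i * ((base_digit n m d i)%:Z * m%:Z ^+ (d - i)) =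
    (base_digit n m d i)%:Z * y ^+ i * (x ^+ (d - i) - (m%:Z * y) ^+ (d - i)).
    by rewrite exprMn; ring.
  rewrite subrXX; apply: dvdz_mull; exact: dvdz_mulr.
by move=> /dvdzP[k kE]; exists k; rewrite -kE addrC subrK.
Qed.

Lemma absz_sum_le (d : nat) (F : nat -> int) :
  (absz (\sum_(i < d) F i)%R <= \sum_(i < d) absz (F i))%N.
Proof.
elim: d => [|d IH]; first by rewrite !big_ord0.
have tri (x y : int) : (absz (x + y)%R <= absz x + absz y)%N by lia.
by rewrite !big_ord_recr /=; apply: leq_trans (tri _ _) _; rewrite leq_add2r.
Qed.

Lemma fhat_le (n m d : nat) (x y : int) : (0 < m)%N -> (absz x <= absz y)%N ->
  (absz (fhat n m d x y) <= d.+1 * m * absz y ^ d)%N.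
Proof.
move=> m0 xy; rewrite /fhat.
apply: leq_trans (absz_sum_le _ (fun i => (base_digit n m d i)%:Z * x ^+ (d - i) * y ^+ i)) _.
apply: (@leq_trans (\sum_(i < d.+1) m * absz y ^ d)%N).
  apply: leq_sum => -[i /= id] _; rewrite !abszM !abszX -mulnA leq_mul //.
    by apply/ltnW/ltn_pmod.
  have -> : (absz y ^ d = absz y ^ (d - i) * absz y ^ i)%N by rewrite -expnD subnK // -ltnS.
  rewrite leq_mul2r; apply/orP; right.
  by case: (d - i)%N => // k; rewrite leq_exp2r.
by rewrite sum_nat_const card_ord mulnA.
Qed.

(** As d is odd and N = n b^d modulo q, the difference - N - fhat is divisible by q = a + b m, and
    the quotient is to be represented by the form with coefficients c. Of the d + 2 subtracted from
    K, d + 1 pay for fhat, which is at most q (d + 1) b^(d-1), and 1 for the strict inequality. *)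
Lemma fpoly_representations (n m d b N K : nat) :
  odd d -> (0 < m)%N -> (n < m ^ d.+1)%N -> forall a : nat, (a < b)%N ->
  coprime (a + b * m) b -> N = n * b ^ d %[mod a + b * m] ->
  (d.+2 <= K)%N -> (N <= (a + b * m) * ((K - d.+2) * b ^ d.-1))%N ->
  exists L : seq {ffun 'I_d -> int}, [/\ uniq L, ((K %/ b) ^ d.-1 <= size L)%N &
    {in L, forall c : {ffun 'I_d -> int}, (forall i, absz (c i) < K)%N /\ fpoly n m c a (- b%:Z) = - N%:Z}].
Proof.
move=> od m0 nm a ab cop cong dK NX.
have d0 : (0 < d)%N by case: (d) od.
have b0 : (0 < b)%N by apply: leq_ltn_trans ab.
set q := (a + b * m)%N in cop cong NX *.
have q0 : (0 < q)%N by rewrite /q addn_gt0 muln_gt0 b0 m0 orbT.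
have qE : a%:Z - m%:Z * - b%:Z = q%:Z by rewrite /q PoszD PoszM; ring.
have [k kE] := @fhat_congr n m d a (- b%:Z) m0 nm; rewrite qE in kE.
have bd : (- b%:Z) ^+ d = - (b ^ d)%N%:Z by rewrite exprNn -signr_odd od expr1 mulN1r PoszX.
have [s sE] : exists s : int, - N%:Z = fhat n m d a (- b%:Z) + q%:Z * s.
  have /eqP : (N%:Z = (n * b ^ d)%N%:Z %[mod q%:Z])%Z by rewrite !modz_nat cong.
  rewrite eqz_mod_dvd => /dvdzP[l lE]; exists (- l - k).
  rewrite kE bd; have -> : N%:Z = l * q%:Z + (n * b ^ d)%N%:Z by rewrite -lE subrK.
  by rewrite PoszM; ring.
have fb := @fhat_le n m d a (- b%:Z) m0; rewrite abszN !absz_nat in fb.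
have sK : (absz s < K * absz (- b%:Z)%R ^ d.-1)%N.
  rewrite abszN absz_nat -(ltn_pmul2l q0).
  have -> : (q * absz s = absz (q%:Z * s)%R)%N by rewrite abszM.
  have -> : q%:Z * s = - N%:Z - fhat n m d a (- b%:Z) by rewrite sE; ring.
  apply: (@leq_ltn_trans (N + d.+1 * m * b ^ d)).
    by have := fb (ltnW ab); generalize (d.+1 * m * b ^ d)%N (fhat n m d a (- b%:Z)); clear; lia.
  have mq : (d.+1 * m * b ^ d <= q * (d.+1 * b ^ d.-1))%N.
    have -> : (b ^ d = b * b ^ d.-1)%N by rewrite -expnS prednK.
    have : (m * b <= q)%N by rewrite /q mulnC leq_addl.
    move=> mbq; have e (x y z w : nat) : (x * y * (z * w) = (y * z) * (x * w))%N by clear; lia.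
    by rewrite e leq_mul2r mbq orbT.
  have B0 : (0 < b ^ d.-1)%N by rewrite expn_gt0 b0.
  have key (e K' x y q' N' : nat) : (N' <= q' * ((K' - e.+2) * x) -> y <= q' * (e.+1 * x) ->
      0 < x -> e.+2 <= K' -> 0 < q' -> N' + y < q' * (K' * x))%N.
    clear=> h1 h2 x0 eK q0.
    apply: (@leq_trans (q' * ((K' - e.+2) * x) + q' * (e.+1 * x) + q' * x)%N).
      apply: (@leq_trans (N' + y).+1) => //.
      by rewrite -addn1 leq_add ?leq_add // muln_gt0 q0.
    rewrite -!mulnDr leq_mul2l -[X in (_ + X <= _)%N]mul1n -!mulnDl leq_mul2r.
    by apply/orP; right; apply/orP; right; lia.
  exact: key NX mq B0 dK q0.
have ab' : 0 <= a%:Z < `|- b%:Z| by rewrite normrN ger0_norm //= ltz_nat.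
have co : coprimez a (- b%:Z).
  rewrite coprimezN coprimezE /=; move: cop; rewrite /q /coprime addnC.
  by rewrite mulnC gcdnC gcdnMDl gcdnC.
have hK : ((K %/ b) * absz (- b%:Z)%R <= K)%N by rewrite abszN absz_nat leq_trunc_div.
have [L [uL sL HL]] := homval_representations ab' co hK sK.
pose toffun (c : seq int) : {ffun 'I_d -> int} := [ffun i : 'I_d => c`_i].
exists (map toffun L); split; last 2 first.
- by rewrite size_map.
- move=> c /mapP[l /HL[]]; rewrite prednK // => sl aK lE ->; split.
    by move=> i; rewrite ffunE; apply: (allP aK); rewrite mem_nth // sl.
  rewrite /fpoly sE qE; congr (_ + _).
  rewrite -lE homvalE sl mulr_sumr; apply: eq_bigr => i _; rewrite ffunE.
  by rewrite !mulrA [q%:Z * _]mulrC.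
rewrite map_inj_in_uniq // => l l' /HL[]; rewrite prednK // => sl _ _ /HL[].
rewrite prednK // => sl' _ _ e; apply: (@eq_from_nth _ 0); first by rewrite sl.
move=> i; rewrite sl => id; have := congr1 (fun f : {ffun 'I_d -> int} => f (Ordinal id)) e.
by rewrite !ffunE.
Qed.

(** * Counting pairs of a polynomial and a point *)

Lemma card_le_size (T : choiceType) (A : set T) (s : seq T) :
  (forall x, A x -> x \in s) -> finite_set A /\ (card A <= size s)%N.
Proof.
move=> As; have fA : finite_set A by apply: sub_finite_set (finite_seq s).
split=> //; apply: uniq_leq_size; first exact: fset_uniq.
by move=> x; rewrite in_fset_set // inE => /As.
Qed.

Lemma size_le_card (T : choiceType) (A : set T) (s : seq T) :
  finite_set A -> uniq s -> (forall x, x \in s -> A x) -> (size s <= card A)%N.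
Proof.
move=> fA us sA; apply: uniq_leq_size => // x /sA Ax.
by rewrite in_fset_set // inE.
Qed.

Lemma size_le_sum_card (R : realType) (T S : choiceType) (A : set T) (X : T -> set S)
    (s : seq (T * S)) :
  finite_set A -> (forall x, A x -> finite_set (X x)) -> uniq s ->
  (forall p, p \in s -> A p.1 /\ X p.1 p.2) ->
  ((size s)%:R : R) <= \sum_(x \in A) ((card (X x))%:R : R).
Proof.
move=> fA fX us sAX; rewrite fsbig_finite //=.
have -> : size s = (\sum_(x <- fset_set A) size [seq p <- s | p.1 == x])%N.
  under eq_bigr do rewrite size_filter -sum1_count big_mkcond.
  rewrite exchange_big /= -[LHS]sum1_size; apply: eq_big_seq => p /sAX[Ap _].
  rewrite -big_mkcond /= (eq_bigl (fun x => x == p.1)); last by move=> x; rewrite eq_sym.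
  rewrite sum1_count; have := count_uniq_mem p.1 (fset_uniq (fset_set A)).
  by rewrite in_fset_set // mem_set // => ->.
rewrite natr_sum big_seq [leRHS]big_seq; apply: ler_sum => x.
rewrite in_fset_set // inE => Ax; rewrite ler_nat.
rewrite -(size_map snd); apply: size_le_card; first exact: fX.
  rewrite map_inj_in_uniq ?filter_uniq // => -[a b] [a' b'].
  by rewrite !mem_filter => /andP[/eqP /= -> _] /andP[/eqP /= -> _] ->.
by move=> y /mapP[[a b]]; rewrite mem_filter => /andP[/eqP /= <- /sAX[_ h]] ->.
Qed.

Definition int_range (M : nat) : seq int := [seq i%:Z - M%:Z | i <- iota 0 (2 * M).+1].

Lemma mem_int_range (M : nat) (z : int) : (absz z <= M)%N -> z \in int_range M.
Proof.
move=> zM; apply/mapP; exists (absz (z + M%:Z)).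
  by rewrite mem_iota; lia.
by lia.
Qed.

Lemma absz_le_truncn (R : realType) (z : int) (x : R) :
  `|z%:~R| <= x -> (absz z <= Num.truncn x)%N.
Proof.
move=> zx; rewrite truncn_ge_nat ?(le_trans _ zx) //.
by rewrite natr_absz -intr_norm.
Qed.

(** A lower bound for [card] requires finiteness, since an infinite set would count as empty. *)
Lemma finite_Xset (R : realType) (n : nat) (sigma beta beta' : R) (m : nat)
    (f : int -> int -> int) : finite_set (Xset n sigma beta beta' m f).
Proof.
pose M := Num.truncn (Lnfun n (1 / 3) sigma).
suff /card_le_size[] : forall x, Xset n sigma beta beta' m f x ->
    x \in [seq (a, b) | a <- int_range M, b <- int_range M] by [].
move=> [a b] [] /andP[a0 ab] /andP[_ bY] _ _; rewrite /= in a0 ab bY.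
have bM : (absz b <= M)%N by apply: absz_le_truncn; rewrite -intr_norm.
have aM : (absz a <= M)%N.
  by apply: leq_trans bM; rewrite -lez_nat !abszE ger0_norm // ltW.
apply/allpairsPdep; exists a, b; split => //; exact: mem_int_range.
Qed.

Lemma finite_bases (R : realType) (n d : nat) :
  finite_set (bases R n d) /\
  (card (bases R n d))%:R <= Lnfun n (2 / 3) (delta_of R n d)^-1 + 1 :> R.
Proof.
set L := Lnfun _ _ _; have L0 : 0 <= L by exact: expR_ge0.
have [h1 h2] : finite_set (bases R n d) /\ (card (bases R n d) <= size (iota 0 (Num.truncn L).+1))%N.
  apply: card_le_size => m /andP[_ mL].
  by rewrite mem_iota ltnS truncn_ge_nat.
split => //; rewrite size_iota -(ler_nat R) in h2; apply: le_trans h2 _.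
by rewrite -natr1 lerD2r truncn_le.
Qed.

Lemma finite_coefs (R : realType) (n d : nat) (kappa : R) :
  finite_set (coefs n d kappa) /\
  (card (coefs n d kappa))%:R <=
    (2 * Lnfun n (2 / 3) (kappa - (delta_of R n d)^-1) + 1) ^+ d.
Proof.
set L := Lnfun _ _ _; have L0 : 0 <= L by exact: expR_ge0.
pose M := Num.truncn L.
pose g (f : {ffun 'I_d -> 'I_(2 * M).+1}) : {ffun 'I_d -> int} := [ffun i => (f i)%:Z - M%:Z].
have [h1 h2] : finite_set (coefs n d kappa) /\
   (card (coefs n d kappa) <= size (map g (enum {ffun 'I_d -> 'I_(2 * M).+1})))%N.
  apply: card_le_size => c cc.
  have cM i : (absz (c i) <= M)%N.
    apply: absz_le_truncn; have := cc i; rewrite /intI /= -/L => /andP[c1 c2].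
    by rewrite ler_norml; apply/andP; split; lra.
  apply/mapP; exists [ffun i => inord (absz (c i + M%:Z))]; first by rewrite mem_enum.
  by apply/ffunP => i; rewrite !ffunE inordK; have := cM i; lia.
split => //; rewrite size_map -cardE card_ffun !card_ord -(ler_nat R) natrX in h2.
apply: le_trans h2 _; apply: lerXn2r; rewrite ?nnegrE //; first by lra.
by rewrite -natr1 natrM lerD2r ler_wpM2l // truncn_le.
Qed.

(** The vectors found for different N are different, because c determines the value - N; so the
    counts for the solutions N of the congruence add up. *)
Lemma coefs_representations (n d b q K : nat) (Ns : seq nat) :
  odd d -> (n < (q %/ b) ^ d.+1)%N -> coprime q b -> (d.+2 <= K)%N -> uniq Ns ->
  {in Ns, forall N, (N <= q * ((K - d.+2) * b ^ d.-1))%N} ->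
  exists L : seq {ffun 'I_d -> int}, [/\ uniq L,
    (count (fun N => N == n * b ^ d %[mod q]) Ns * (K %/ b) ^ d.-1 <= size L)%N &
    {in L, forall c : {ffun 'I_d -> int}, (forall i, absz (c i) < K)%N /\
      exists2 N, N \in Ns & fpoly n (q %/ b) c (q %% b)%N (- b%:Z) = - N%:Z}].
Proof.
move=> od nq cop dK uN NX.
have m0 : (0 < q %/ b)%N.
  by rewrite lt0n; apply/negP => /eqP m0; move: nq; rewrite m0 exp0n.
have b0 : (0 < b)%N by case: b m0 {nq cop NX} => //; rewrite divn0.
have qE : q = (q %% b + b * (q %/ b))%N by rewrite addnC mulnC -divn_eq.
elim: Ns uN NX => [|N Ns IH] /=; first by exists [::].
move=> /andP[NNs uN] NX.
have [L [uL sL HL]] := IH uN (fun x h => NX x (mem_behead (s := N :: Ns) h)).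
case: eqVneq => [cong|_]; last first.
  exists L; split => //= c /HL[h1 [M MN h2]]; split => //; exists M => //.
  by rewrite inE MN orbT.
have [L' [uL' sL' HL']] : exists L' : seq {ffun 'I_d -> int}, [/\ uniq L', ((K %/ b) ^ d.-1 <= size L')%N &
    {in L', forall c : {ffun 'I_d -> int}, (forall i, absz (c i) < K)%N /\
      fpoly n (q %/ b) c (q %% b)%N (- b%:Z) = - N%:Z}].
  apply: fpoly_representations => //; rewrite -?qE //; first by rewrite ltn_pmod.
  by apply: NX; rewrite inE eqxx.
exists (L' ++ L); split.
- rewrite cat_uniq uL uL' andbT /=; apply/hasPn => c /HL[_ [M MN h2]].
  apply/negP => /HL'[_]; rewrite h2 => /eqP; rewrite eqr_opp eqz_nat => /eqP MN'.
  by rewrite -MN' MN in NNs.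
- by rewrite size_cat mulnDl mul1n leq_add.
- move=> c; rewrite mem_cat => /orP[/HL'[h1 h2]|/HL[h1 [M MN h2]]]; split => //.
    by exists N => //; rewrite inE eqxx.
  by exists M => //; rewrite inE MN orbT.
Qed.

(** A triple (b, q, c) is recovered from the sample (q / b, c) and the point (q mod b, - b), so
    distinct triples are counted separately. The denominator is an upper bound for the size of the
    sample space. *)
Lemma expected_card_X_ge (R : realType) (n d K : nat) (kappa sigma beta beta' : R)
    (Bs : seq nat) (Q : nat -> seq nat) (Ns : seq nat) :
  odd d -> (d.+2 <= K)%N ->
  K%:R <= Lnfun n (2 / 3) (kappa - (delta_of R n d)^-1) ->
  uniq Bs ->
  {in Bs, forall b, Lnfun n (1 / 3) sigma / 2 <= b%:R <= Lnfun n (1 / 3) sigma} ->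
  {in Bs, forall b, uniq (Q b)} ->
  {in Bs, forall b, {in Q b, forall q, [/\ smooth (Lnfun n (1 / 3) beta) q%:Z,
     coprime q b, (n < (q %/ b) ^ d.+1)%N & bases R n d (q %/ b)%N]}} ->
  uniq Ns -> {in Ns, forall N, smooth (Lnfun n (1 / 3) beta') N%:Z} ->
  {in Bs, forall b, {in Q b, forall q, {in Ns, forall N,
     (N <= q * ((K - d.+2) * b ^ d.-1))%N}}} ->
  (\sum_(b <- Bs) \sum_(q <- Q b)
     count (fun N => N == n * b ^ d %[mod q]) Ns * (K %/ b) ^ d.-1)%:R /
  ((Lnfun n (2 / 3) (delta_of R n d)^-1 + 1) *
   (2 * Lnfun n (2 / 3) (kappa - (delta_of R n d)^-1) + 1) ^+ d) <=
  expected_card_X n d kappa sigma beta beta'.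
Proof.
move=> od dK KL uB BY uQ HQ uN sN NX.
set L1 := Lnfun n (2 / 3) (delta_of R n d)^-1.
set L2 := Lnfun n (2 / 3) (kappa - _) in KL *.
pose h b := ((K %/ b) ^ d.-1)%N.
pose PL (bq : nat * nat) (L : seq {ffun 'I_d -> int}) := bq.1 \in Bs -> bq.2 \in Q bq.1 ->
  [/\ uniq L,
    (count (fun N => N == n * bq.1 ^ d %[mod bq.2]) Ns * h bq.1 <= size L)%N &
    {in L, forall c : {ffun 'I_d -> int}, (forall i, absz (c i) < K)%N /\
      exists2 N, N \in Ns & fpoly n (bq.2 %/ bq.1) c (bq.2 %% bq.1)%N (- bq.1%:Z) = - N%:Z}].
have [Lf HLf] : {Lf & forall bq, PL bq (Lf bq)}.
  apply: choice => -[b q]; rewrite /PL /=.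
  have [bB|_] := boolP (b \in Bs); last by exists [::].
  have [qQ|_] := boolP (q \in Q b); last by exists [::].
  have [_ h2 h3 _] := HQ b bB q qQ.
  have [L HL] := coefs_representations od h3 h2 dK uN (NX b bB q qQ).
  by exists L.
pose pairs := [seq (b, q) | b <- Bs, q <- Q b].
pose Trip : seq ((nat * {ffun 'I_d -> int}) * (int * int)) :=
  [seq (((bq.2 %/ bq.1)%N, c), ((bq.2 %% bq.1)%N%:Z, - bq.1%:Z)) | bq <- pairs, c <- Lf bq].
have pairsP b q : (b, q) \in pairs -> b \in Bs /\ q \in Q b.
  by move=> /allpairsPdep[b' [q' [h1 h2 [-> ->]]]].
have b0 b q : b \in Bs -> q \in Q b -> (0 < b)%N.
  move=> bB qQ; have [_ _ + _] := HQ b bB q qQ.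
  by case: (b) => //; rewrite divn0 exp0n.
set A := (bases R n d `*` coefs n d kappa).
set X := fun mc : nat * {ffun 'I_d -> int} => Xset n sigma beta beta' mc.1 (fpoly n mc.1 mc.2).
have uT : uniq Trip.
  apply: allpairs_uniq_dep.
  - apply: allpairs_uniq_dep => //.
    by move=> [b q] [b' q'] _ _ /= [-> ->].
  - by move=> [b q] /pairsP[h1 h2]; have [] := HLf (b, q) h1 h2.
  - move=> [[b q] c] [[b' q'] c'].
    move=> /allpairsPdep[[b1 q1] [c1 [h1 _ [-> -> _]]]] /allpairsPdep[[b2 q2] [c2 [h2 _ [-> -> _]]]].
    have [bB1 qQ1] := pairsP _ _ h1; have [bB2 qQ2] := pairsP _ _ h2.
    case=> /= e1 e2 e3 e4.
    have e4' : b1 = b2 by move: e4; clear; lia.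
    have e5 : q1 = q2 by rewrite (divn_eq q1 b1) (divn_eq q2 b2) e1 e3 e4'.
    by move: e2; rewrite e4' e5 => ->.
have TA p : p \in Trip -> A p.1 /\ X p.1 p.2.
  move=> /allpairsPdep[[b q] [c [/pairsP[bB qQ] cL ->]]] /=.
  have [_ _ HL] := HLf (b, q) bB qQ; have [cK [N NN fN]] := HL c cL.
  have [sq cop nq bq] := HQ b bB q qQ; rewrite /= in fN.
  have bp := b0 b q bB qQ.
  split.
    split => //= i; have := cK i; rewrite /intI /= -/L2 => ci.
    have ci' : `|(c i)%:~R| < L2.
      by apply: lt_le_trans KL; rewrite -intr_norm -natr_absz ltr_nat.
    by move: ci'; rewrite ltr_norml => /andP[c1 c2]; apply/andP; split; lra.
  split => /=.
  - by rewrite normrN ger0_norm //= ltz_nat ltn_pmod.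
  - by rewrite normrN; exact: BY.
  - rewrite (_ : _ - _ = q%:Z) // {3}(divn_eq q b) PoszD PoszM; ring.
  - have [N0 NP] := sN N NN.
    by rewrite fN; split; [rewrite oppr_eq0 | move=> r rp; rewrite abszN; apply: NP].
have [fb cb] := @finite_bases R n d; have [fc cc] := finite_coefs n d kappa.
have fA : finite_set A by apply: finite_setX.
have cA : (card A)%:R <= (L1 + 1) * (2 * L2 + 1) ^+ d.
  apply: (@le_trans _ _ ((card (bases R n d))%:R * (card (coefs n d kappa))%:R)); last exact: ler_pM.
  rewrite -natrM ler_nat.
  have := @card_le_size _ A [seq (m, c) | m <- fset_set (bases R n d), c <- fset_set (coefs n d kappa)].
  rewrite size_allpairs => -[] // -[m c] [/= h1 h2].
  by apply/allpairsPdep; exists m, c; split => //; rewrite in_fset_set // inE.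
have S1 : (size Trip)%:R <= \sum_(mc \in A) ((card (X mc))%:R : R).
  by apply: size_le_sum_card => // mc _; exact: finite_Xset.
have S2 : (\sum_(b <- Bs) \sum_(q <- Q b)
     count (fun N => N == n * b ^ d %[mod q]) Ns * h b <= size Trip)%N.
  rewrite size_allpairs_dep sumnE big_map big_allpairs_dep /=.
  rewrite big_seq [leqRHS]big_seq; apply: leq_sum => b bB.
  rewrite big_seq [leqRHS]big_seq; apply: leq_sum => q qQ.
  by have [] := HLf (b, q) bB qQ.
rewrite /expected_card_X /uniform_mean -/A -/X.
have L10 : 0 <= L1 by exact: expR_ge0.
have L20 : 0 <= L2 by exact: expR_ge0.
have den0 : 0 < (L1 + 1) * (2 * L2 + 1) ^+ d.
  by rewrite mulr_gt0 ?exprn_gt0 //; lra.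
(* The mean over an empty sample space is 0 by convention; then there are no triples either, since
   each of them yields a sample. *)
have [cA0|cA0] := eqVneq (card A) 0%N.
  rewrite cA0 invr0 mulr0; apply: mulr_le0_ge0; last by rewrite invr_ge0 ltW.
  move: S2; case: Trip uT TA S1 => [|x T] _ TA _; first by rewrite leqn0 => /eqP ->.
  have /TA[Ax _] : x \in x :: T by rewrite inE eqxx.
  have : x.1 \in fset_set A by rewrite in_fset_set // inE.
  by move: cA0; rewrite /card => /cardfs0_eq ->; rewrite in_fset0.
have cAp : 0 < (card A)%:R :> R by rewrite ltr0n lt0n.
apply: ler_pM; [by [] | by rewrite invr_ge0 ltW | | by rewrite lef_pV2].
by apply: le_trans S1; rewrite ler_nat.
Qed.

(** * A lower bound for the expectation *)

Definition coprime_blocks (b : nat) (Qs : seq (seq nat)) : seq (seq nat) :=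
  [seq [seq p <- P | coprime p b] | P <- Qs].

Lemma flatten_coprime_blocks (b : nat) (Qs : seq (seq nat)) :
  flatten (coprime_blocks b Qs) = [seq p <- flatten Qs | coprime p b].
Proof. by elim: Qs => //= P Qs IH; rewrite filter_cat IH. Qed.

(** Asking that q be prime to b amounts to deleting primes from the blocks, so [equidistribution]
    applies to the restricted family as well. *)
Lemma tuples_coprime_blocks (b : nat) (Qs : seq (seq nat)) :
  tuples (coprime_blocks b Qs) = [seq ps <- tuples Qs | coprime (prodn ps) b].
Proof.
elim: Qs => [|P Qs IH]; first by rewrite /= /prodn big_nil coprime1n.
have step (s : seq nat) (S : seq (seq nat)) :
    [seq p :: ps | p <- [seq p <- s | coprime p b], ps <- [seq ps <- S | coprime (prodn ps) b]] =
    [seq ps <- [seq p :: ps | p <- s, ps <- S] | coprime (prodn ps) b].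
  elim: s => //= p s IHs; rewrite filter_cat -IHs filter_map /=.
  have e : [seq x <- S | coprime (prodn (p :: x)) b] =
           (if coprime p b then [seq x <- S | coprime (prodn x) b] else [::]).
    case: ifP => cp; first by apply: eq_filter => x; rewrite prodn_cons coprimeMl cp.
    by rewrite -(filter_pred0 S); apply: eq_filter => x; rewrite prodn_cons coprimeMl cp.
  by rewrite e; case: ifP.
by rewrite [LHS]/= IH step.
Qed.

Lemma ler_sum_subseq (R : realFieldType) (T : eqType) (s1 s2 : seq T) (F : T -> R) :
  subseq s1 s2 -> (forall x, 0 <= F x) -> \sum_(x <- s1) F x <= \sum_(x <- s2) F x.
Proof.
move=> + F0; elim: s2 s1 => [|y s2 IH] [|x s1] //=; rewrite ?big_nil ?sumr_ge0 //.
by case: eqP => [->|_] /IH; rewrite !big_cons ?lerD2l // => /le_trans; apply; rewrite lerDr.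
Qed.

(** Dividing by a modulus in (T/2, T] leaves 1/T in the main term and at most 2/T in the error. *)
Lemma count_congr_ge (R : realFieldType) (T N0 E : R) (n b d : nat) (Ns : seq nat) (S S' : seq (seq nat)) :
  0 < T -> subseq S S' -> (forall ps, ps \in S -> T / 2 < (prodn ps)%:R <= T) -> N0 = (size Ns)%:R ->
  \sum_(ps <- S') `|(prodn ps)%:R * (\sum_(N <- Ns) (N == n * b ^ d %[mod prodn ps])%:R) - N0| <= E ->
  N0 / T * (size S)%:R - 2 * E / T <=
  \sum_(ps <- S) (count (fun N => N == n * b ^ d %[mod prodn ps]) Ns)%:R.
Proof.
move=> T0 sub ST N0E EE.
pose c ps : R := \sum_(N <- Ns) (N == n * b ^ d %[mod prodn ps])%:R.
have cE ps : (count (fun N => N == n * b ^ d %[mod prodn ps]) Ns)%:R = c ps.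
  by rewrite /c -natr_sum -size_filter sum_bool_size.
under eq_bigr do rewrite cE.
have E' : \sum_(ps <- S) `|(prodn ps)%:R * c ps - N0| <= E.
  by apply: le_trans EE; apply: ler_sum_subseq.
have -> : N0 / T * (size S)%:R = \sum_(ps <- S) N0 / T.
  by rewrite big_const_seq count_predT iter_addr_0 mulr_natr.
apply: (@le_trans _ _ (\sum_(ps <- S) (N0 / T - 2 / T * `|(prodn ps)%:R * c ps - N0|))).
  rewrite sumrB lerD2l lerN2 -mulr_sumr [leRHS](_ : _ = 2 / T * E); last by ring.
  by rewrite ler_wpM2l // divr_ge0 // ltW.
rewrite big_seq [leRHS]big_seq; apply: ler_sum => ps /ST /andP[h1 h2].
have P0 : 0 < (prodn ps)%:R :> R by lra.
have N00 : 0 <= N0 by rewrite N0E.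
set q := (prodn ps)%:R in h1 h2 P0 *.
have h3 : N0 - `|q * c ps - N0| <= q * c ps.
  by have := ler_norm (- (q * c ps - N0)); rewrite normrN; lra.
have h4 : (N0 - `|q * c ps - N0|) / q <= c ps by rewrite ler_pdivrMr // [c ps * q]mulrC.
apply: le_trans h4; rewrite mulrBl lerD //.
  by rewrite ler_wpM2l // lef_pV2 // posrE.
have h5 : q^-1 <= 2 / T by rewrite ler_pdivlMr // mulrC ler_pdivrMr //; lra.
by rewrite lerN2 mulrC ler_wpM2r.
Qed.

(* The averaging over b replaces the counting of smooth numbers in the short
   interval of admissible values of q for a single b by counting them in a
   dyadic interval. *)
Lemma assembly (R : realType) (n d K0 U Z kap : nat) (kappa sigma beta beta' xi T len eta Hm : R)
    (Bs : seq nat) (Qs Ns : seq (seq nat)) :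
  odd d -> (d.+2 <= K0)%N ->
  K0%:R <= Lnfun n (2 / 3) (kappa - (delta_of R n d)^-1) ->
  uniq Bs -> {in Bs, forall b, (0 < b)%N} ->
  {in Bs, forall b, Lnfun n (1 / 3) sigma / 2 <= b%:R <= Lnfun n (1 / 3) sigma} ->
  U%:R < Lnfun n (1 / 3) beta -> U%:R < Lnfun n (1 / 3) beta' ->
  uniq (flatten (Qs ++ Ns)) ->
  all (fun p => prime p && (Z <= p <= U)%N) (flatten (Qs ++ Ns)) ->
  all (fun P => Z <= size P)%N Ns ->
  {in Bs, forall b, all (fun P => Z <= size [seq p <- P | coprime p b])%N Qs} ->
  all (fun p => coprime p n) (flatten Qs) ->
  (0 < Z)%N -> (Z <= U)%N ->
  (2 * size Qs + 2 * ((size Qs + kap) %/ kap.+1) <= size Ns)%N -> 0 < xi -> xi <= 1 ->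
  ((48 * (kap + 3) ^ kap.+1)%:R * (U%:R / Z%:R) ^+ 5) ^+ kap.+1 <= xi ^+ (2 * kap.+1) * Z%:R ->
  0 < T ->
  let TT := [seq ps <- tuples Qs | T / 2 < (prodn ps)%:R <= T] in
  let win b q := (n < (q %/ b) ^ d.+1)%N && `[< bases R n d (q %/ b)%N >] in
  {in TT, forall ps, len <= (count (fun b => win b (prodn ps) && coprime (prodn ps) b) Bs)%:R} ->
  eta * (size (tuples Qs))%:R <= (size TT)%:R ->
  4 * (size Bs)%:R * ((1 + xi) ^+ size Qs - 1) <= eta * len ->
  {in Bs, forall b, {in tuples Ns, forall N, (prodn N)%:R <= T / 2 * ((K0 - d.+2)%N%:R * b%:R ^+ d.-1)}} ->
  0 <= Hm -> 0 <= len -> {in Bs, forall b, Hm <= (K0 %/ b)%N%:R} ->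
  (size (tuples Ns))%:R * (size TT)%:R * len / (2 * T) * Hm ^+ d.-1 /
  ((Lnfun n (2 / 3) (delta_of R n d)^-1 + 1) *
   (2 * Lnfun n (2 / 3) (kappa - (delta_of R n d)^-1) + 1) ^+ d) <=
  expected_card_X n d kappa sigma beta beta'.
Proof.
move=> od dK KL uB B0 BY UB UB' uQN aQN zN zQ cQn Z0 ZU kv xi0 xi1 num T0 TT win wlen etaT err NX Hm0 len0 HmK.
pose sel b := [seq ps <- tuples (coprime_blocks b Qs) | (T / 2 < (prodn ps)%:R <= T) && win b (prodn ps)].
pose Q b := map prodn (sel b).
pose NN := map prodn (tuples Ns).
have uQ : uniq (flatten Qs) by move: uQN; rewrite flatten_cat cat_uniq => /and3P[].
have aQ : all (fun p => prime p && (Z <= p <= U)%N) (flatten Qs) by move: aQN; rewrite flatten_cat all_cat => /andP[].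
have aN : all (fun p => prime p && (Z <= p <= U)%N) (flatten Ns) by move: aQN; rewrite flatten_cat all_cat => /andP[].
have pQ : all prime (flatten Qs) by apply: sub_all aQ => p /andP[].
have pN : all prime (flatten Ns) by apply: sub_all aN => p /andP[].
have uN : uniq (flatten Ns) by move: uQN; rewrite flatten_cat cat_uniq => /and3P[].
have selP b ps : ps \in sel b -> [/\ ps \in tuples Qs, coprime (prodn ps) b,
    T / 2 < (prodn ps)%:R <= T & win b (prodn ps)].
  by rewrite mem_filter tuples_coprime_blocks mem_filter => /andP[/andP[-> ->] /andP[-> ->]].
have smo (L : seq (seq nat)) (ps : seq nat) (y : R) : U%:R < y ->
    all (fun p => prime p && (Z <= p <= U)%N) (flatten L) -> ps \in tuples L -> smooth y (prodn ps)%:Z.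
  move=> Uy aL psL.
  have pps : all prime ps by apply/allP => p /(mem_tuples_flatten psL)/(allP aL)/andP[].
  split; first by rewrite eqz_nat -lt0n prodn_primes_gt0.
  move=> p pp; rewrite absz_nat prime_dvd_prodn // => /(mem_tuples_flatten psL)/(allP aL)/and3P[_ _ pU].
  by apply: le_lt_trans Uy; rewrite ler_nat.
have := @expected_card_X_ge R n d K0 kappa sigma beta beta' Bs Q NN od dK KL uB BY.
move=> /(_ _ _ _ _ _) EX.
apply: le_trans (EX _ _ _ _ _) => {EX}; last first.
- move=> b bB q /mapP[ps /selP[_ _ /andP[h1 _] _] ->] N /mapP[N' N'N ->].
  rewrite -(ler_nat R) !natrM natrX; apply: le_trans (NX b bB N' N'N) _.
  by rewrite ler_wpM2r ?mulr_ge0 ?exprn_ge0 // ltW.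
- by move=> N /mapP[N' h ->]; apply: smo UB' aN h.
- exact: uniq_prods.
- move=> b bB q /mapP[ps /selP[h1 h2 _ /andP[h3 /asboolP h4]] ->]; split => //.
  exact: smo UB aQ h1.
- move=> b bB; rewrite map_inj_in_uniq; last first.
    by move=> x y /selP[h1 _ _ _] /selP[h2 _ _ _]; apply: prodn_inj h1 h2.
  rewrite filter_uniq // tuples_coprime_blocks filter_uniq //; exact: uniq_tuples.
rewrite ler_wpM2r //.
  by rewrite invr_ge0 mulr_ge0 ?exprn_ge0 ?addr_ge0 ?mulr_ge0 ?expR_ge0.
set N0 : R := (size (tuples Ns))%:R.
set E1 := (1 + xi) ^+ size Qs - 1 in err *.
set E := N0 * (size (tuples Qs))%:R * E1.
have E10 : 0 <= E1 by rewrite subr_ge0 exprn_ege1 // lerDl ltW.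
have N00 : 0 <= N0 by [].
have per_b b : b \in Bs -> N0 / T * (size (sel b))%:R - 2 * E / T <=
    (\sum_(q <- Q b) count (fun N => N == n * b ^ d %[mod q]) NN)%:R.
  move=> bB; rewrite big_map natr_sum.
  apply: (@count_congr_ge _ _ _ _ _ _ _ _ _ (tuples (coprime_blocks b Qs))) => //.
  - exact: filter_subseq.
  - by move=> ps /selP[].
  - by rewrite /NN size_map.
  have sub1 : subseq (flatten (coprime_blocks b Qs ++ Ns)) (flatten (Qs ++ Ns)).
    by rewrite !flatten_cat flatten_coprime_blocks cat_subseq // filter_subseq.
  have := @equidistribution R (n * b ^ d) U Z kap xi (coprime_blocks b Qs) Ns.
  rewrite size_map; move=> /(_ _ _ _ _ Z0 ZU kv xi0 xi1 num) ED.
  apply: le_trans (_ : _ <= N0 * (size (tuples (coprime_blocks b Qs)))%:R * E1) _; last first.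
    rewrite /E ler_wpM2r // ler_wpM2l // ler_nat tuples_coprime_blocks size_filter; exact: count_size.
  apply: le_trans (ED _ _ _ _).
  - by rewrite /NN; apply: ler_sum => ps _; rewrite big_map.
  - exact: subseq_uniq sub1 uQN.
  - by apply/allP => p /(mem_subseq sub1)/(allP aQN).
  - rewrite all_cat zN andbT; apply/allP => P /mapP[P' h ->]; exact: (allP (zQ b bB)).
  - apply/allP => p; rewrite flatten_coprime_blocks mem_filter => /andP[h1 h2].
    by rewrite coprimeMr (allP cQn) //= coprimeXr.
have sum_sel : (size TT)%:R * len <= (\sum_(b <- Bs) size (sel b))%:R.
  have -> : (\sum_(b <- Bs) size (sel b) = \sum_(ps <- TT) count (fun b => win b (prodn ps) && coprime (prodn ps) b) Bs)%N.
    rewrite (eq_bigr (fun b => \sum_(ps <- TT) (win b (prodn ps) && coprime (prodn ps) b))%N).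
      rewrite exchange_big /=; apply: eq_bigr => ps _.
      by rewrite sum_bool_size size_filter.
    move=> b _; rewrite sum_bool_size /sel tuples_coprime_blocks -!filter_predI.
    apply: (congr1 size); apply: eq_filter => ps /=.
    by case: (T / 2 < _ <= T); case: (win _ _); case: (coprime _ _).
  rewrite natr_sum mulr_natl -[X in _ *+ X](count_predT TT) -iter_addr_0 -big_const_seq.
  by rewrite big_seq [leRHS]big_seq; apply: ler_sum => ps /wlen.
have main : N0 * (size TT)%:R * len / (2 * T) <=
   (\sum_(b <- Bs) \sum_(q <- Q b) count (fun N => N == n * b ^ d %[mod q]) NN)%:R.
  rewrite natr_sum; apply: (@le_trans _ _ (\sum_(b <- Bs) (N0 / T * (size (sel b))%:R - 2 * E / T))).
    have sc : \sum_(b <- Bs) 2 * E / T = 2 * E / T * (size Bs)%:R.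
      by rewrite big_const_seq count_predT iter_addr_0 mulr_natr.
    rewrite sumrB -mulr_sumr -natr_sum sc.
    (* By [err] and [etaT] the discrepancy, summed over all b, consumes at most half of the main
       term. *)
    have EB : 2 * E / T * (size Bs)%:R <= N0 / T * ((size TT)%:R * len / 2).
      have -> : 2 * E / T * (size Bs)%:R = N0 / T * ((size (tuples Qs))%:R * (4 * (size Bs)%:R * E1) / 2).
        by rewrite /E; field; rewrite gt_eqF.
      apply: ler_wpM2l; first exact: divr_ge0 N00 (ltW T0).
      apply: ler_wpM2r; first by rewrite invr_ge0.
      apply: le_trans (ler_wpM2l (ler0n _ _) err) _.
      by rewrite mulrA [_ * eta]mulrC ler_wpM2r.
    have h := ler_wpM2l (divr_ge0 N00 (ltW T0)) sum_sel.
    have -> : N0 * (size TT)%:R * len / (2 * T) = N0 / T * ((size TT)%:R * len) - N0 / T * ((size TT)%:R * len / 2).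
      by field; rewrite gt_eqF.
    by rewrite lerB.
  by rewrite big_seq [leRHS]big_seq; apply: ler_sum.
apply: le_trans (ler_wpM2r (exprn_ge0 _ Hm0) main) _.
rewrite !natr_sum mulr_suml big_seq [leRHS]big_seq; apply: ler_sum => b bB.
rewrite !natr_sum mulr_suml; apply: ler_sum => q _.
rewrite natrM natrX ler_wpM2l // lerXn2r ?nnegrE //.
exact: HmK.
Qed.

(** * Density of primes and construction of the blocks *)

Lemma ln_le_sub1 (R : realType) (x : R) : 0 < x -> ln x <= x - 1.
Proof.
move=> x0; rewrite -ler_expR lnK ?posrE //.
by have := expR_ge1Dx (x - 1); rewrite addrC subrK.
Qed.

Lemma ln2_ge (R : realType) : 2^-1 <= ln (2 : R).
Proof.
have : ln (2^-1 : R) <= 2^-1 - 1 by apply: ln_le_sub1; rewrite invr_gt0.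
by rewrite lnV ?posrE //; lra.
Qed.

(** With s = sqrt (2h) and u^2 = s + 1, the r + 1 extra factors of [primes_in_double_ge] cost at
    most (s + 1) 4u = 4 u^3, which has to stay below h / 6 = (u^2 - 1)^2 / 12. This holds for u >=
    50, hence the bound 2500 = 50^2. *)
Lemma primes_in_double_density (R : realType) (h : nat) (A : R) :
  2500 <= A -> A ^+ 2 <= h%:R ->
  h%:R <= 6 * ln ((2 * h).+1%:R : R) * (size (primes_in h (2 * h)))%:R.
Proof.
move=> A2500 hbig; set c := size _.
have A0 : 0 < A by lra.
have h0 : (0 < h)%N by rewrite -(ltr_nat R); apply: lt_le_trans hbig; apply: exprn_gt0.
set L := ln _.
pose s : R := Num.sqrt (2 * h)%:R; pose r := Num.truncn s; pose u : R := Num.sqrt (s + 1).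
have s0 : 0 <= s by exact: sqrtr_ge0.
have s2 : s ^+ 2 = (2 * h)%:R by rewrite sqr_sqrtr.
have u0 : 0 <= u by exact: sqrtr_ge0.
have u2 : u ^+ 2 = s + 1 by rewrite sqr_sqrtr //; lra.
have sA : A <= s.
  have hR : 0 <= h%:R :> R by [].
  by rewrite -(ler_pXn2r (n := 2)) ?nnegrE ?(ltW A0) // s2 natrM; lra.
have u50 : 50 <= u.
  have ne : ~ u < 50 by move=> uu; have : u ^+ 2 <= 50 * 50; [rewrite expr2; nra | rewrite u2; lra].
  by rewrite leNgt; apply/negP.
have rs : r%:R <= s by rewrite truncn_le.
have hr : (2 * h < r.+1 ^ 2)%N.
  rewrite -(ltr_nat R) -s2 natrX ltr_pXn2r ?nnegrE //.
  exact: truncnS_gt.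
have := primes_in_double_ge h0 hr; rewrite -/c -(ler_nat R) !natrX => P.
have L0 : 0 <= L by rewrite ln_ge0 // ler1n.
have {}P : (h - (2 * h) %/ 3)%:R * ln 4 <= (c + r.+1)%:R * L.
  rewrite !mulr_natl /L -!lnXn ?ltr0n //.
  by rewrite ler_ln ?posrE ?exprn_gt0 ?ltr0n.
have ln4 : 1 <= ln (4 : R).
  have -> : (4 : R) = 2 ^+ 2 by rewrite expr2; lra.
  by rewrite lnXn // mulr2n; have := ln2_ge R; lra.
have h3 : h%:R / 3 <= (h - (2 * h) %/ 3)%:R :> R.
  have e (x : nat) : (x <= (x - (2 * x) %/ 3) * 3)%N by clear; lia.
  by rewrite ler_pdivrMr // -natrM ler_nat.
have Lu : L <= 4 * u.
  have u4 : ((2 * h).+1%:R : R) <= u ^+ 4.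
    by rewrite (exprM u 2 2) u2 -natr1 -s2; nra.
  apply: (@le_trans _ _ (ln (u ^+ 4))); first by rewrite ler_ln ?posrE ?exprn_gt0 //; lra.
  rewrite lnXn; last by lra.
  rewrite -[_ *+ 4]mulr_natl ler_wpM2l //.
  by have := @ln_le_sub1 R u; lra.
have rL : r.+1%:R * L <= (s + 1) * (4 * u).
  by apply: ler_pM => //; rewrite -natr1 lerD2r.
have h4 : h%:R / 3 <= (c + r.+1)%:R * L.
  apply: le_trans P; apply: le_trans h3 _.
  by rewrite -[leLHS]mulr1 ler_wpM2l.
have sh : h%:R = s ^+ 2 / 2 by rewrite s2 natrM; lra.
have e1 : (s + 1) * (4 * u) <= h%:R / 6.
  by rewrite sh (_ : s = u ^+ 2 - 1); [nra | lra].
rewrite natrD mulrDl in h4; rewrite -mulrA [L * _]mulrC; lra.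
Qed.

Lemma prime_divisors_bound (n : nat) (s : seq nat) :
  (0 < n)%N -> uniq s -> all prime s -> all (fun p => p %| n)%N s -> (2 ^ size s <= n)%N.
Proof.
move=> n0 us ps dn; apply: (@leq_trans (prodn s)).
  apply: prodn_ge; apply: sub_all ps => p; exact: prime_gt1.
apply: dvdn_leq => //.
elim: s us ps dn => [|p s IH] /=; first by rewrite /prodn big_nil dvd1n.
move=> /andP[np us] /andP[pp ps] /andP[pn dn]; rewrite prodn_cons Gauss_dvd ?pn ?IH //.
by rewrite prime_coprime // prime_dvd_prodn.
Qed.

(** At most log_2 b primes divide b, and 1 / log 2 <= 2. *)
Lemma size_filter_coprime (R : realType) (b : nat) (P : seq nat) :
  (0 < b)%N -> uniq P -> all prime P ->
  (size P)%:R - 2 * ln b%:R <= (size [seq p <- P | coprime p b])%:R :> R.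
Proof.
move=> b0 uP pP.
have := @prime_divisors_bound b [seq p <- P | ~~ coprime p b] b0 (filter_uniq _ uP).
have -> : all prime [seq p <- P | ~~ coprime p b].
  by apply/allP => p; rewrite mem_filter => /andP[_ /(allP pP)].
have -> : all (fun p => p %| b)%N [seq p <- P | ~~ coprime p b].
  apply/allP => p; rewrite mem_filter => /andP[+ /(allP pP) pp].
  by rewrite prime_coprime // negbK.
move=> /(_ isT isT); rewrite -(ler_nat R) natrX => h.
have sE : (size P = size [seq p <- P | coprime p b] + size [seq p <- P | ~~ coprime p b])%N.
  by rewrite !size_filter count_predC.
set t := size [seq p <- P | ~~ _] in h sE.
have : t%:R * ln 2 <= ln (b%:R : R).
  by rewrite mulr_natl -lnXn // ler_ln ?posrE ?exprn_gt0 ?ltr0n.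
have t0 : 0 <= t%:R :> R by [].
have := ln2_ge R; rewrite sE natrD; nra.
Qed.

Lemma primes_in_cat (a b c : nat) : (a <= b <= c)%N ->
  primes_in a b ++ primes_in b c = primes_in a c.
Proof.
move=> /andP[ab bc]; rewrite /primes_in -filter_cat.
suff -> : index_iota a.+1 b.+1 ++ index_iota b.+1 c.+1 = index_iota a.+1 c.+1 by [].
have e1 : b.+1 = (a.+1 + (b - a))%N by rewrite addSn subnKC.
have e2 : (c - a = (b - a) + (c - b))%N by move: ab bc; clear; lia.
by rewrite /index_iota !subSS e2 iotaD -e1.
Qed.

Lemma uniq_primes_in (a b : nat) : uniq (primes_in a b).
Proof. by rewrite filter_uniq // iota_uniq. Qed.

(** The blocks are adjacent: they are disjoint and their union is again an interval. *)
Definition dyadic_blocks (h k : nat) : seq (seq nat) :=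
  [seq primes_in (h * 2 ^ i) (h * 2 ^ i.+1) | i <- iota 0 k].

Definition dyadic_prod (h k : nat) : nat := \prod_(i < k) (h * 2 ^ i.+1).

Lemma dyadic_blocksS (h k : nat) :
  dyadic_blocks h k.+1 = dyadic_blocks h k ++ [:: primes_in (h * 2 ^ k) (h * 2 ^ k.+1)].
Proof. by rewrite /dyadic_blocks -[in LHS](addn1 k) iotaD map_cat. Qed.

Lemma flatten_dyadic_blocks (h k : nat) :
  flatten (dyadic_blocks h k) = primes_in h (h * 2 ^ k).
Proof.
elim: k => [|k IH].
  by rewrite /dyadic_blocks /= muln1 /primes_in /index_iota subnn.
rewrite dyadic_blocksS flatten_cat IH /= cats0 primes_in_cat //.
by rewrite leq_pmulr ?expn_gt0 //= leq_mul2l leq_pexp2l ?orbT.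
Qed.

Lemma dyadic_prodS (h k : nat) : dyadic_prod h k.+1 = (dyadic_prod h k * (h * 2 ^ k.+1))%N.
Proof. by rewrite /dyadic_prod big_ord_recr. Qed.

Lemma size_tuples_cat (Qs Qs' : seq (seq nat)) :
  size (tuples (Qs ++ Qs')) = (size (tuples Qs) * size (tuples Qs'))%N.
Proof. by rewrite !size_tuples big_cat. Qed.

(** The upper end of a block is twice its lower end, whence the 2. The function f is the identity
    for the factors of N and the removal of the prime divisors of n for those of q. *)
Lemma size_tuples_dyadic (R : realType) (f : seq nat -> seq nat) (h k : nat) (Lam : R) :
  0 < Lam ->
  (forall i, (i < k)%N -> (h * 2 ^ i)%:R <=
     Lam * (size (f (primes_in (h * 2 ^ i) (h * 2 ^ i.+1))))%:R) ->
  (dyadic_prod h k)%:R <= (2 * Lam) ^+ k * (size (tuples (map f (dyadic_blocks h k))))%:R.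
Proof.
move=> L0; elim: k => [|k IH] H; first by rewrite /dyadic_prod big_ord0 /= mulr1.
have s1 (Q : seq nat) : size (tuples [:: Q]) = size Q by rewrite size_tuples big_seq1.
rewrite dyadic_prodS dyadic_blocksS map_cat size_tuples_cat s1 exprS !natrM.
have := IH (fun i ik => H i (ltnW ik)); have := H k (ltnSn k).
set x := (size (tuples _))%:R; set y := (size (f _))%:R => h1 h2.
have -> : 2 * Lam * (2 * Lam) ^+ k * (x * y) = ((2 * Lam) ^+ k * x) * (2 * (Lam * y)) by ring.
apply: ler_pM => //; rewrite -natrM expnS mulnCA natrM ler_wpM2l //.
Qed.

Lemma prodn_dyadic_le (h k : nat) (f : seq nat -> seq nat) (ps : seq nat) :
  (forall P, {subset f P <= P}) ->
  ps \in tuples (map f (dyadic_blocks h k)) ->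
  (prodn ps <= dyadic_prod h k)%N /\ (dyadic_prod h k <= prodn ps * 2 ^ k)%N.
Proof.
move=> fP; elim: k ps => [|k IH] ps.
  by rewrite /= inE => /eqP ->; rewrite /prodn big_nil /dyadic_prod big_ord0.
rewrite dyadic_blocksS map_cat mem_tuples.
have sz : size (map f (dyadic_blocks h k)) = k by rewrite !size_map size_iota.
rewrite all2E size_cat sz /= => /andP[/eqP sp].
rewrite -{1}(cat_take_drop k ps) zip_cat ?size_takel ?sz ?sp ?leq_addr // all_cat => /andP[h1 h2].
have [i1 i2] : (prodn (take k ps) <= dyadic_prod h k)%N /\ (dyadic_prod h k <= prodn (take k ps) * 2 ^ k)%N.
  by apply: IH; rewrite mem_tuples all2E size_takel ?sz ?sp ?leq_addr // eqxx.
have : size (drop k ps) = 1%N by rewrite size_drop sp addKn.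
case: (drop k ps) h2 (cat_take_drop k ps) => [|p [|//]] //= /andP[/fP] + _ <- _.
rewrite mem_primes_in => /and3P[_ p1 p2].
rewrite prodn_cat dyadic_prodS prodn_cons /prodn big_nil muln1 -/(prodn _).
split; first by rewrite leq_mul.
apply: (@leq_trans (prodn (take k ps) * 2 ^ k * (p * 2))); last first.
  by rewrite expnS; generalize (prodn (take k ps)) (2 ^ k)%N; clear; lia.
by apply: leq_mul => //; rewrite expnS mulnCA mulnC leq_mul2r (ltnW p1).
Qed.

(** The last block of [Qs] is wide: it reaches up to U, and for every product w of primes from the
    dyadic blocks it contains a dyadic interval of primes p with w p in (T/2, T]. So fixing the size
    of q costs no more than one further factor O(Lam). The blocks of [Ns] lie below those of [Qs],
    which makes them all disjoint. *)
Lemma prime_blocks (R : realType) (n U Z hN hQ k v0 : nat) (A T Lam : R) :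
  (0 < n)%N -> 2500 <= A -> A ^+ 2 <= hN%:R -> (hN * 2 ^ k <= hQ)%N -> (hQ * 2 ^ v0.+1 <= U)%N ->
  1 <= Lam -> 6 * ln (2 * U).+1%:R <= Lam -> (0 < Z)%N -> 4 * Lam * Z%:R <= hN%:R ->
  8 * Lam * ln n%:R <= hQ%:R -> 0 < T ->
  ((hQ * 2 ^ v0).+1%:R) * (2 * (dyadic_prod hQ v0)%:R) <= T ->
  T * (2 ^ v0)%:R <= U%:R * (dyadic_prod hQ v0)%:R ->
  exists Qs Ns : seq (seq nat),
  let TT := [seq ps <- tuples Qs | T / 2 < (prodn ps)%:R <= T] in
  [/\ size Qs = v0.+1, size Ns = k, uniq (flatten (Qs ++ Ns)),
     all (fun p => prime p && (Z <= p <= U)%N) (flatten (Qs ++ Ns)) &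
     all (fun P => Z <= size P)%N Ns] /\
  [/\ (forall b, (0 < b)%N -> 8 * Lam * ln b%:R <= hQ%:R ->
         all (fun P => Z <= size [seq p <- P | coprime p b])%N Qs),
      all (fun p => coprime p n) (flatten Qs),
      {in tuples Ns, forall N, (prodn N <= dyadic_prod hN k)%N} &
      (dyadic_prod hN k)%:R <= (2 * Lam) ^+ k * (size (tuples Ns))%:R] /\
  T <= (8 * Lam) ^+ v0.+1 * (size TT)%:R /\
  Z%:R / U%:R * (size (tuples Qs))%:R <= (size TT)%:R :> R.
Proof.
move=> n0 A0 AN NQ QU L1 LU Z0 ZN nQ T0 TP TU.
have L0 : 0 < Lam by lra.
have pos2 i : (0 < 2 ^ i)%N by rewrite expn_gt0.
have hN0 : (0 < hN)%N.
  rewrite -(ltr_nat R); apply: lt_le_trans ZN; rewrite !mulr_gt0 // ltr0n //.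
have hNQ : (hN <= hQ)%N by apply: leq_trans NQ; rewrite leq_pmulr.
have ZR : Z%:R <= hN%:R :> R.
  apply: le_trans ZN; rewrite -[leLHS]mul1r ler_wpM2r //; lra.
have ZhN : (Z <= hN)%N by rewrite -(ler_nat R).
have P0 : 0 < (dyadic_prod hQ v0)%:R :> R.
  rewrite ltr0n /dyadic_prod; apply: prodn_gt0 => i.
  by rewrite muln_gt0 pos2 (leq_trans hN0 hNQ).
have dens h : (hN <= h)%N -> (2 * h <= U)%N -> h%:R <= Lam * (size (primes_in h (2 * h)))%:R.
  move=> h1 h2; have Ah : A ^+ 2 <= h%:R by apply: le_trans AN _; rewrite ler_nat.
  apply: le_trans (primes_in_double_density A0 Ah) _; rewrite ler_wpM2r //.
  apply: le_trans LU; rewrite ler_wpM2l // ler_ln ?posrE ?ltr0n // ler_nat ltnS.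
  by rewrite leq_mul2l; move: h2; clear; lia.
pose f (P : seq nat) := [seq p <- P | coprime p n].
have fP P : {subset f P <= P} by move=> p; rewrite mem_filter => /andP[].
have prp a b : all prime (primes_in a b) by exact: filter_all.
(* By [nQ] the prime divisors of n take away at most a quarter of the h / Lam primes guaranteed by
   [dens]. *)
have densf h : (hQ <= h)%N -> (2 * h <= U)%N ->
    h%:R <= 2 * Lam * (size (f (primes_in h (2 * h))))%:R.
  move=> h1 h2; have := dens h (leq_trans hNQ h1) h2.
  have := @size_filter_coprime R n (primes_in h (2 * h)) n0 (uniq_primes_in _ _) (prp _ _).
  rewrite -/(f _); set x := (size (f _))%:R; set y := (size _)%:R => e1 e2.
  have h1' : hQ%:R <= h%:R :> R by rewrite ler_nat.
  have hR : 0 <= h%:R :> R by [].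
  have : Lam * (y - 2 * ln n%:R) <= Lam * x by rewrite ler_wpM2l // ltW.
  by rewrite mulrBr; lra.
have e2 (x i : nat) : (x * 2 ^ i.+1 = 2 * (x * 2 ^ i))%N by rewrite expnS mulnCA.
have vi i : (i <= v0)%N -> (2 * (hQ * 2 ^ i) <= U)%N.
  by move=> h; apply: leq_trans QU; rewrite -e2 leq_mul2l leq_pexp2l ?orbT.
have hQi i : (hQ <= hQ * 2 ^ i)%N by rewrite leq_pmulr.
pose Qs0 := map f (dyadic_blocks hQ v0).
pose la := f (primes_in (hQ * 2 ^ v0) U).
have la_sub h : (hQ * 2 ^ v0 <= h)%N -> (2 * h <= U)%N -> {subset f (primes_in h (2 * h)) <= la}.
  move=> h1 h2 p; rewrite !mem_filter mem_index_iota => /andP[-> /andP[-> /andP[p1 p2]]] /=.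
  by rewrite mem_index_iota (leq_ltn_trans h1) //= ltnS (leq_trans _ h2).
have flQ : flatten (Qs0 ++ [:: la]) = f (primes_in hQ U).
  rewrite flatten_cat /= cats0 /Qs0 /f -filter_flatten flatten_dyadic_blocks /la -filter_cat.
  rewrite primes_in_cat // hQi /=; apply: leq_trans QU; rewrite e2 leq_pmull //.
have size_ge x : (hQ <= x)%N -> (2 * x <= U)%N -> forall b : nat, (0 < b)%N -> 8 * Lam * ln b%:R <= hQ%:R ->
    (Z <= size [seq p <- f (primes_in x (2 * x)) | coprime p b])%N.
  move=> h1 h2 b b0 bQ; rewrite -(ler_nat R).
  have := densf x h1 h2.
  have pf : all prime (f (primes_in x (2 * x))).
    by apply/allP => p /fP; apply: (allP (prp _ _)).
  have := @size_filter_coprime R b (f (primes_in x (2 * x))) b0 (filter_uniq _ (uniq_primes_in _ _)) pf.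
  set y := (size (f _))%:R; set z := (size _)%:R => g1 g2.
  have h1' : hQ%:R <= x%:R :> R by rewrite ler_nat.
  have hNQ' : hN%:R <= hQ%:R :> R by rewrite ler_nat.
  have g3 : Lam * (y - 2 * ln b%:R) <= Lam * z by rewrite ler_wpM2l // ltW.
  rewrite mulrBr in g3.
  by rewrite -(ler_pM2l L0); lra.
exists (Qs0 ++ [:: la]), (dyadic_blocks hN k).
set TT := [seq ps <- _ | _].
have w_le ps : ps \in tuples Qs0 ->
   [/\ 0 < (prodn ps)%:R :> R, (prodn ps)%:R <= (dyadic_prod hQ v0)%:R :> R &
       (dyadic_prod hQ v0)%:R <= (prodn ps)%:R * (2 ^ v0)%:R :> R].
  move=> /(prodn_dyadic_le fP)[h1 h2]; rewrite -natrM !ler_nat; split => //.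
  rewrite ltr0n lt0n; apply/negP => /eqP e; move: h2 P0; rewrite e mul0n leqn0 => /eqP ->.
  by rewrite ltxx.
pose cnt (ps : seq nat) := size [seq p <- la | T / 2 < ((prodn ps * p)%N%:R : R) <= T].
have cnt_ge ps : ps \in tuples Qs0 -> exists m : nat, [/\ (hQ * 2 ^ v0 <= m)%N, T <= 4 * (prodn ps)%:R * m%:R &
    m%:R <= 2 * Lam * (cnt ps)%:R].
  move=> psQ; have [w0 wP Pw] := w_le ps psQ.
  set w := (prodn ps)%:R in w0 wP Pw *.
  have Tw : T = T / (2 * w) * (2 * w) by field; rewrite gt_eqF.
  (* T/2 < w p <= T means y < p <= 2y; with m the integer part of y, every prime in (m, 2m]
     qualifies. *)
  pose y := T / (2 * w); have yE : T = y * (2 * w) by [].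
  have y0 : 0 <= y by rewrite divr_ge0 ?mulr_ge0 // ltW.
  pose m := Num.truncn y.
  have my : m%:R <= y by rewrite truncn_le.
  have ym : y < m%:R + 1 by rewrite natr1; exact: truncnS_gt.
  have yb : (hQ * 2 ^ v0).+1%:R <= y.
    rewrite /y ler_pdivlMr ?mulr_gt0 //; apply: le_trans TP.
    by rewrite ler_wpM2l // ler_wpM2l.
  have mb : (hQ * 2 ^ v0 <= m)%N.
    have : ((hQ * 2 ^ v0).+1 < m.+1)%N.
      by rewrite -(ltr_nat R) -[X in _ < X]natr1; apply: le_lt_trans yb ym.
    by rewrite ltnS => /ltnW.
  have m2U : (2 * m <= U)%N.
    rewrite -(ler_nat R) natrM; apply: (@le_trans _ _ (2 * y)); first lra.
    have y2 : 2 * y * w <= U%:R * w.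
      have -> : 2 * y * w = T by rewrite yE; ring.
      rewrite -(ler_pM2r (_ : 0 < (2 ^ v0)%:R)) ?ltr0n //.
      by apply: le_trans TU _; rewrite -mulrA ler_wpM2l.
    by rewrite ler_pM2r in y2.
  exists m; split => //.
    have m1 : 1 <= m%:R :> R.
      by rewrite ler1n; apply: leq_trans mb; rewrite muln_gt0 pos2 (leq_trans hN0 hNQ).
    rewrite [leLHS]yE; apply: (@le_trans _ _ (2 * m%:R * (2 * w))); last lra.
    by apply: ler_wpM2r; lra.
  apply: le_trans (densf m (leq_trans (hQi v0) mb) m2U) _.
  rewrite ler_wpM2l ?mulr_ge0 ?(ltW L0) // ler_nat.
  apply: uniq_leq_size; first by rewrite filter_uniq // uniq_primes_in.
  move=> p pm; rewrite mem_filter (la_sub m mb m2U p pm) andbT.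
  have := fP _ _ pm; rewrite mem_primes_in => /and3P[_ p1 p2].
  have p1' : m%:R + 1 <= p%:R :> R by rewrite natr1 ler_nat.
  have p2' : p%:R <= 2 * m%:R :> R by rewrite -natrM ler_nat.
  rewrite natrM -/w; apply/andP; split.
    have -> : T / 2 = w * y by rewrite [in LHS]yE; field.
    by rewrite ltr_pM2l //; lra.
  have -> : T = w * (2 * y) by rewrite [LHS]yE; ring.
  by rewrite ler_pM2l //; lra.
have sTT : (size TT)%:R = \sum_(ps <- tuples Qs0) (cnt ps)%:R :> R.
  rewrite -sum_bool_size natr_sum sum_tuples_cat; apply: eq_bigr => ps _.
  rewrite /cnt -sum_bool_size natr_sum sum_tuples_cons; apply: eq_bigr => p _.
  by rewrite big_seq1 prodn_cat prodn_cons /(prodn [::]) big_nil muln1.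
have sz0 : (0 < size (tuples Qs0))%N.
  rewrite size_tuples; apply: leq_trans (_ : 1 ^ size Qs0 <= _)%N; first by rewrite exp1n.
  rewrite -size_tuples; apply: size_tuples_ge; apply/allP => P /mapP[P' /mapP[i]].
  rewrite mem_iota add0n => /andP[_ iv] -> ->; rewrite e2.
  have := size_ge (hQ * 2 ^ i)%N (hQi i) (vi i (ltnW iv)) 1%N isT.
  rewrite ln1 mulr0 => /(_ (ler0n _ _)) /leq_trans h; apply: leq_trans Z0 _.
  by apply: h; rewrite size_filter count_size.
split; [split | split; [split | split]].
- by rewrite size_cat size_map size_map size_iota addn1.
- by rewrite size_map size_iota.
- rewrite flatten_cat flQ flatten_dyadic_blocks cat_uniq filter_uniq ?uniq_primes_in //= andbT.
  apply/hasPn => p; rewrite mem_primes_in => /and3P[_ _ p2]; apply/negP => /fP.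
  by rewrite mem_primes_in => /and3P[_ p1 _]; have := leq_trans p1 (leq_trans p2 NQ); rewrite ltnn.
- apply/allP => p; rewrite flatten_cat flQ mem_cat flatten_dyadic_blocks => /orP[/fP|];
    rewrite mem_primes_in => /and3P[-> p1 p2] /=.
    by rewrite p2 andbT; apply: leq_trans (ltnW p1); apply: leq_trans hNQ.
  rewrite (leq_trans ZhN (ltnW p1)) /=; apply: leq_trans p2 _; apply: leq_trans NQ _.
  by apply: leq_trans QU; exact: hQi.
- apply/allP => P /mapP[i]; rewrite mem_iota add0n => /andP[_ ik] ->; rewrite e2 -(ler_nat R).
  have : (2 * (hN * 2 ^ i) <= U)%N.
    apply: leq_trans QU; rewrite -e2; apply: leq_trans (hQi v0.+1); apply: leq_trans NQ.
    by rewrite leq_mul2l leq_pexp2l ?orbT.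
  have hh : (hN <= hN * 2 ^ i)%N by rewrite leq_pmulr.
  move=> /(dens _ hh) d1; rewrite -(ler_pM2l L0); apply: le_trans d1.
  have : hN%:R <= (hN * 2 ^ i)%:R :> R by rewrite ler_nat.
  have : 0 <= Lam * Z%:R by rewrite mulr_ge0 // ltW.
  by lra.
- move=> b b0 bQ; rewrite all_cat; apply/andP; split.
    apply/allP => P /mapP[P' /mapP[i]]; rewrite mem_iota add0n => /andP[_ iv] -> ->; rewrite e2.
    exact: size_ge (hQi i) (vi i (ltnW iv)) b b0 bQ.
  rewrite /= andbT; apply: leq_trans (size_ge _ (hQi v0) (vi v0 (leqnn _)) b b0 bQ) _.
  apply: uniq_leq_size; first by do 2 apply: filter_uniq; exact: uniq_primes_in.
  move=> p; rewrite !(mem_filter (fun p => coprime p b)) => /andP[-> h] /=.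
  exact: la_sub (leqnn _) (vi v0 (leqnn _)) _ h.
- by rewrite flQ; exact: filter_all.
- move=> N NN; have := @prodn_dyadic_le hN k id N (fun P x h => h).
  by rewrite map_id => /(_ NN)[].
- have := @size_tuples_dyadic R id hN k Lam L0; rewrite map_id; apply => i ik.
  rewrite e2; apply: dens; first by rewrite leq_pmulr.
  apply: leq_trans QU; rewrite -e2; apply: leq_trans (hQi v0.+1); apply: leq_trans NQ.
  by rewrite leq_mul2l leq_pexp2l ?orbT.
- have s1 := @size_tuples_dyadic R f hQ v0 (2 * Lam) (mulr_gt0 (ltr0n _ 2) L0).
  have {}s1 : (dyadic_prod hQ v0)%:R <= (2 * (2 * Lam)) ^+ v0 * (size (tuples Qs0))%:R.
    apply: s1 => i iv; rewrite e2; exact: densf (hQi i) (vi i (ltnW iv)).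
  have s2 : (size (tuples Qs0))%:R * T <= 8 * Lam * (dyadic_prod hQ v0)%:R * (size TT)%:R.
    rewrite sTT mulr_sumr mulr_natl -[X in _ *+ X](count_predT (tuples Qs0)) -iter_addr_0 -big_const_seq.
    rewrite big_seq [leRHS]big_seq; apply: ler_sum => ps psQ.
    have [m [_ m2 m3]] := cnt_ge ps psQ; have [w0 wP _] := w_le ps psQ.
    apply: le_trans m2 _; apply: (@le_trans _ _ (4 * (dyadic_prod hQ v0)%:R * (2 * Lam * (cnt ps)%:R))).
      by apply: ler_pM => //; rewrite ?mulr_ge0 // ler_wpM2l.
    by rewrite le_eqVlt; apply/orP; left; apply/eqP; ring.
  have sR : 0 < (size (tuples Qs0))%:R :> R by rewrite ltr0n.
  rewrite -(ler_pM2l sR); apply: le_trans s2 _.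
  apply: (@le_trans _ _ (8 * Lam * ((2 * (2 * Lam)) ^+ v0 * (size (tuples Qs0))%:R) * (size TT)%:R)).
    by rewrite ler_wpM2r // ler_wpM2l // mulr_ge0 // ltW.
  rewrite exprS (_ : 8 * Lam * _ * _ = (size (tuples Qs0))%:R * (8 * Lam * (2 * (2 * Lam)) ^+ v0 * (size TT)%:R)); last by ring.
  rewrite ler_wpM2l // ler_wpM2r // ler_wpM2l ?mulr_ge0 ?(ltW L0) // lerXn2r ?nnegrE ?mulr_ge0 ?(ltW L0) //.
  lra.
(* The last block has at most U primes, and for each choice of the others at least Z of them are
   usable. *)
- have U0 : 0 < U%:R :> R.
    by rewrite ltr0n; apply: leq_trans QU; apply: leq_trans (hQi v0.+1); apply: leq_trans hNQ.
  rewrite size_tuples_cat (size_tuples [:: la]) big_seq1 natrM.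
  have laU : (size la)%:R <= U%:R :> R.
    rewrite ler_nat -[leqRHS](size_iota 1); apply: uniq_leq_size; first by rewrite filter_uniq // uniq_primes_in.
    move=> p /fP; rewrite mem_primes_in mem_iota => /and3P[pp _ pU].
    by rewrite prime_gt0 //= add1n ltnS.
  apply: (@le_trans _ _ ((size (tuples Qs0))%:R * Z%:R)).
    have -> : Z%:R / U%:R * ((size (tuples Qs0))%:R * (size la)%:R) =
        (size (tuples Qs0))%:R * Z%:R * ((size la)%:R / U%:R) :> R by ring.
    by rewrite -[leRHS]mulr1 ler_wpM2l ?mulr_ge0 // ler_pdivrMr // mul1r.
  rewrite sTT mulr_natl -[X in _ *+ X](count_predT (tuples Qs0)) -iter_addr_0 -big_const_seq.
  rewrite big_seq [leRHS]big_seq; apply: ler_sum => ps psQ.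
  have [m [m1 _ m3]] := cnt_ge ps psQ.
  have : hN%:R <= m%:R :> R by rewrite ler_nat; apply: leq_trans hNQ (leq_trans (hQi v0) m1).
  have LZ : 0 <= Lam * Z%:R by rewrite mulr_ge0 // ltW.
  by move=> hm; rewrite -(ler_pM2l L0); lra.
Qed.

Lemma ln2_le1 (R : realType) : ln (2 : R) <= 1.
Proof. by have := @ln_le_sub1 R 2; lra. Qed.

(** * Values of b compatible with a given q *)

(** Here g^4 = 2^(1/d). An admissible b lies in [Y/2, Y] and in [q/L, q/(L/g^4 + 1)], the 1 allowing
    for the rounding of m = q / b. The factor g^-2 in the bound for q balances the two ends: for the
    largest q the intersection is about [Y/g^2, Y], for the smallest about [Y/2, g^2 Y/2], so its
    length is of order Y/d throughout. *)
Lemma window_interval (R : realType) (d : nat) (Y L q : R) :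
  (0 < d)%N -> 0 < Y -> 16 * d%:R <= L ->
  let g := expR (ln 2 / (4 * d%:R)) in
  Y * L / g ^+ 2 / 2 < q <= Y * L / g ^+ 2 ->
  Num.max (q / L) (Y / 2) + Y / (32 * d%:R) <= Num.min (q / (L / g ^+ 4 + 1)) Y.
Proof.
move=> d0 Y0 dL g /andP[q1 q2].
have d1 : 1 <= d%:R :> R by rewrite ler1n.
have L0 : 0 < L by lra.
have g1 : 1 + 1 / (8 * d%:R) <= g.
  apply: le_trans (expR_ge1Dx _); rewrite lerD2l.
  have -> : 1 / (8 * d%:R) = (2^-1) / (4 * d%:R) :> R by field; rewrite gt_eqF // ltr0n.
  by rewrite ler_wpM2r ?invr_ge0 ?mulr_ge0 // ln2_ge.
have g4 : g ^+ 4 <= 2.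
  rewrite -expRM_natl -[leRHS]lnK ?posrE // ler_expR.
  have -> : 4%:R * (ln 2 / (4 * d%:R)) = ln (2 : R) / d%:R by field; rewrite gt_eqF // ltr0n.
  by rewrite ler_pdivrMr ?ltr0n // ler_peMr // ln_ge0 // ler1n.
set e := 1 / (8 * d%:R) in g1.
have e0 : 0 < e by rewrite divr_gt0 // mulr_gt0 // ltr0n.
have de : 8 * d%:R * e = 1 by rewrite /e mulrC divfK // gt_eqF // mulr_gt0 // ltr0n.
have eY : Y / (32 * d%:R) = Y * e / 4 by rewrite /e; field; rewrite gt_eqF // ltr0n.
rewrite eY; have e1 : e <= 1 / 8.
  by rewrite /e ler_pdivrMr ?mulr_gt0 ?ltr0n //; lra.
have gg : 1 <= g by lra.
have g2 : g ^+ 2 <= 2.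
  by apply: le_trans g4; rewrite ler_weXn2l.
have g2p : 0 < g ^+ 2 by rewrite exprn_gt0; lra.
have g4p : 0 < g ^+ 4 by rewrite exprn_gt0; lra.
pose z := q / L; have qz : q = z * L by rewrite /z divfK // gt_eqF.
have z1 : Y / g ^+ 2 / 2 < z.
  by rewrite -(ltr_pM2r L0) -qz; apply: le_lt_trans q1; rewrite le_eqVlt; apply/orP; left; apply/eqP; field; lra.
have z2 : z <= Y / g ^+ 2.
  by rewrite -(ler_pM2r L0) -qz; apply: le_trans q2 _; rewrite le_eqVlt; apply/orP; left; apply/eqP; field; lra.
have z3 : z * g ^+ 2 <= Y by rewrite -ler_pdivlMr.
have z4 : Y < 2 * (z * g ^+ 2) by move: z1; rewrite ltr_pdivrMr // ltr_pdivrMr //; lra.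
have zp : 0 < z by nra.
(* As 16 d <= L, the summand 1 costs no more than one of the four factors g. *)
have w3 : z * g ^+ 3 <= q / (L / g ^+ 4 + 1).
  rewrite ler_pdivlMr; last by rewrite addr_gt0 // divr_gt0.
  rewrite qz -mulrA ler_wpM2l ?(ltW zp) //.
  have -> : g ^+ 3 * (L / g ^+ 4 + 1) = L / g + g ^+ 3 by field; lra.
  rewrite -(ler_pM2r (_ : 0 < g)); last lra.
  have -> : (L / g + g ^+ 3) * g = L + g ^+ 4 by field; lra.
  have : 16 * d%:R * e <= L * e by rewrite ler_wpM2r // ltW.
  have : L * (1 + e) <= L * g by rewrite ler_wpM2l // ltW.
  lra.
rewrite -/z; move: z2 z3 z4 w3.
rewrite (exprS g 2) expr2.
set W := q / _ => z2 z3 z4 w3.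
have gge : g * g >= 1 + e by nra.
have zg : z * (g * g) <= Y by [].
have ze2 : z * (g * g) * e <= z * 2 * e.
  by rewrite ler_wpM2r ?(ltW e0) // ler_wpM2l ?(ltW zp) // -expr2.
have k1 : z + Y * e / 4 <= W.
  apply: le_trans w3; have : z * g <= z * (g * (g * g)) by rewrite ler_wpM2l ?(ltW zp) //; nra.
  by nra.
have k2 : z + Y * e / 4 <= Y.
  have : z * (1 + e) <= Y by apply: le_trans zg; rewrite ler_wpM2l // ltW.
  by nra.
have k3 : Y / 2 + Y * e / 4 <= W.
  apply: le_trans w3.
  have h : z * (g * g) * (1 + e) <= z * (g * (g * g)).
    have -> : z * (g * (g * g)) = z * (g * g) * g by ring.
    by rewrite ler_wpM2l // mulr_ge0 ?(ltW zp) //; nra.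
  by apply: le_trans h; nra.
have k4 : Y / 2 + Y * e / 4 <= Y by nra.
by case: (leP z (Y / 2)) => _; case: (leP W Y).
Qed.

(** Union bound: a prime p >= Z divides at most M/Z + 1 integers of an interval of length M. *)
Lemma count_not_coprime (v Z j0 M : nat) (ps : seq nat) :
  all prime ps -> all (fun p => Z <= p)%N ps -> (0 < Z)%N -> size ps = v ->
  (Z * size [seq b <- iota j0 M | ~~ coprime (prodn ps) b] <= v * (M + Z))%N.
Proof.
move=> pp pZ Z0 <-; elim: ps pp pZ => [|p ps IH] /=.
  by move=> _ _; rewrite /prodn big_nil (eq_filter (a2 := pred0)) ?filter_pred0 ?muln0 // => b; rewrite coprime1n.
move=> /andP[pp pps] /andP[Zp pZ]; have {}IH := IH pps pZ.
have h1 : (size [seq b <- iota j0 M | ~~ coprime (prodn (p :: ps)) b] <=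
    size [seq b <- iota j0 M | (p %| b)%N] + size [seq b <- iota j0 M | ~~ coprime (prodn ps) b])%N.
  rewrite !size_filter -count_predUI; apply: leq_trans (leq_addr _ _).
  apply: sub_count => b /=; rewrite prodn_cons coprimeMl negb_and prime_coprime // negbK.
  by move=> /orP[-> //|->]; rewrite orbT.
have h2 : (p * size [seq b <- iota j0 M | (p %| b)%N] <= M + p)%N.
  rewrite -(size_map (fun b => b - j0)%N).
  have inj : {in [seq b <- iota j0 M | (p %| b)%N] &, injective (fun b => b - j0)%N}.
    move=> x y; rewrite !mem_filter !mem_iota => /andP[_ /andP[h _]] /andP[_ /andP[h' _]] /= e.
    by rewrite -[LHS](subnK h) -[RHS](subnK h') e.
  apply: size_congr_le; first exact: prime_gt0.
  - by rewrite map_inj_in_uniq // filter_uniq // iota_uniq.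
  - by move=> x /mapP[y]; rewrite mem_filter mem_iota => /andP[_ /andP[h h']] ->; move: h h'; clear; lia.
  move=> x y /mapP[x']; rewrite mem_filter mem_iota => /andP[dx /andP[hx _]] ->.
  move=> /mapP[y']; rewrite mem_filter mem_iota => /andP[dy /andP[hy _]] ->.
  apply/eqP; wlog xy : x' y' dx dy hx hy / (x' <= y')%N.
    by move=> H; case: (leqP x' y') => [h|/ltnW h]; [exact: H | rewrite eq_sym; exact: H].
  rewrite eq_sym eqn_mod_dvd ?leq_sub2r // subnBA // subnK //.
  exact: dvdn_sub.
have h3 : (Z * size [seq b <- iota j0 M | (p %| b)%N] <= M + Z)%N.
  move: h2 Zp Z0; generalize (size [seq b <- iota j0 M | (p %| b)%N]) => s; clear => h2 Zp Z0.
  case: s h2 => [|s h2]; first by rewrite !muln0.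
  have : (p * s <= M)%N by move: h2; rewrite mulnS; lia.
  move=> h; rewrite mulnS addnC leq_add2r; apply: leq_trans h; exact: leq_mul.
rewrite mulSn; apply: leq_trans (leq_mul (leqnn Z) h1) _.
by rewrite mulnDr leq_add.
Qed.

(** Of the length lam = Y/(32 d) of the interval, rounding takes at most 2 and common factors with q
    at most M/8 + v, so half remains. Moreover m^d >= n/2 and m >= 8, which bounds n by m^(d+1). *)
Lemma window_count (R : realType) (n d Z v : nat) (Y T : R) (ps : seq nat) :
  let L := Lnfun n (2 / 3) (delta_of R n d)^-1 in
  let Bs := [seq b <- iota 1 (Num.truncn Y) | Y / 2 <= b%:R] in
  (0 < d)%N -> 0 < Y -> 16 * d%:R <= L -> L ^+ d = n%:R ->
  T = Y * L / expR (ln 2 / (4 * d%:R)) ^+ 2 ->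
  T / 2 < (prodn ps)%:R <= T -> all prime ps -> all (fun p => Z <= p)%N ps -> size ps = v ->
  (0 < Z)%N -> (8 * v <= Z)%N -> 4 * (v%:R + 2) <= Y / (32 * d%:R) ->
  Y / (64 * d%:R) <= (count (fun b => ((n < (prodn ps %/ b) ^ d.+1)%N &&
     `[< bases R n d (prodn ps %/ b)%N >]) && coprime (prodn ps) b) Bs)%:R.
Proof.
move=> L Bs d0 Y0 dL Ln TE Tq pps pZ sv Z0 vZ lam4.
set q := prodn ps in Tq *.
have d1 : 1 <= d%:R :> R by rewrite ler1n.
have L0 : 0 < L by lra.
have := @window_interval R d Y L q%:R d0 Y0 dL; cbv zeta; rewrite -TE => /(_ Tq).
set g := expR _; set x1 := Num.max _ _; set x2 := Num.min _ _; set lam := Y / (32 * d%:R) in lam4 *.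
move=> x12; have x10 : 0 <= x1 by rewrite le_max divr_ge0 ?orbT // ltW.
have lam0 : 8 <= lam by have : 0 <= v%:R :> R by []; lra.
pose j0 := (Num.truncn x1).+1; pose M := Num.truncn (lam - 1).
have j1 : x1 < j0%:R by exact: truncnS_gt.
have j2 : j0%:R <= x1 + 1 by rewrite /j0 -natr1 lerD2r truncn_le.
have M1 : M%:R <= lam - 1 by rewrite truncn_le; lra.
have M2 : lam - 2 <= M%:R.
  have : lam - 1 < M.+1%:R by exact: truncnS_gt.
  by rewrite -natr1; lra.
set P := fun b => _.
have good b : b \in iota j0 M -> x1 <= b%:R <= x2.
  rewrite mem_iota => /andP[b1 b2].
  have b1' : j0%:R <= b%:R :> R by rewrite ler_nat.
  have b2' : b%:R + 1 <= j0%:R + M%:R :> R by rewrite natr1 -natrD ler_nat.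
  by apply/andP; split; lra.
have gp b : b \in iota j0 M -> coprime q b -> (b \in Bs) && P b.
  move=> bi cqb; have /andP[] := good b bi; rewrite ge_max le_min => /andP[b1 b2] /andP[b3 b4].
  have b0 : 0 < b%:R :> R by apply: lt_le_trans b2; rewrite divr_gt0.
  have b0' : (0 < b)%N by rewrite -(ltr_nat R).
  rewrite /Bs mem_filter b2 mem_iota b0' add1n ltnS truncn_ge_nat ?(ltW Y0) // b4 /=.
  rewrite /P cqb andbT.
  have g4 : g ^+ 4 = expR (ln 2 / d%:R).
    rewrite -expRM_natl; congr expR; field; rewrite gt_eqF //; lra.
  have g4p : 0 < g ^+ 4 by rewrite g4 expR_gt0.
  have Lg : 0 < L / g ^+ 4 by rewrite divr_gt0.
  set m := (q %/ b)%N.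
  have mq : m%:R <= L.
    apply: (@le_trans _ _ (q%:R / b%:R)).
      by rewrite ler_pdivlMr // -natrM ler_nat leq_trunc_div.
    by rewrite ler_pdivrMr // mulrC -ler_pdivrMr.
  have mq2 : L / g ^+ 4 <= m%:R.
    have : q%:R / b%:R < m%:R + 1 :> R.
      by rewrite ltr_pdivrMr // natr1 -natrM ltr_nat ltn_ceil.
    have : L / g ^+ 4 + 1 <= q%:R / b%:R.
      by rewrite ler_pdivlMr // mulrC -ler_pdivlMr // addr_gt0.
    lra.
  have mb : bases R n d m.
    rewrite /bases /= -/L mq andbT; apply: le_trans mq2.
    have -> : 2 `^ (- d%:R^-1) = (g ^+ 4)^-1 :> R.
      by rewrite /powR pnatr_eq0 /= g4 -expRN; congr expR; field; lra.
    by rewrite mulrC.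
  apply/andP; split; last exact/asboolP.
  have g42 : (g ^+ 4) ^+ d = 2.
    rewrite g4 -expRM_natl mulrC divfK ?lnK ?posrE // gt_eqF //; lra.
  have md : n%:R / 2 <= m%:R ^+ d :> R.
    have : (L / g ^+ 4) ^+ d <= m%:R ^+ d by rewrite lerXn2r ?nnegrE // ltW.
    by rewrite expr_div_n Ln g42.
  have g4le : g ^+ 4 <= 2.
    have g41 : 1 <= g ^+ 4.
      rewrite g4; apply: le_trans (expR_ge1Dx _).
      by rewrite lerDl divr_ge0 // ln_ge0 // ler1n.
    by have := ler_eXnr d0 g41; rewrite g42.
  have m3 : 8 <= m%:R :> R.
    apply: le_trans mq2; rewrite ler_pdivlMr //.
    have : 8 * g ^+ 4 <= 8 * 2 by rewrite ler_wpM2l.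
    lra.
  have n0 : 0 < n%:R :> R by rewrite -Ln exprn_gt0.
  rewrite -(ltr_nat R) natrX exprS.
  have : 8 * (n%:R / 2) <= m%:R * m%:R ^+ d :> R by apply: ler_pM => //; rewrite divr_ge0.
  by move=> h; apply: lt_le_trans h; lra.
apply: (@le_trans _ _ (size [seq b <- iota j0 M | coprime q b])%:R); last first.
  rewrite ler_nat -size_filter; apply: uniq_leq_size; first by rewrite filter_uniq // iota_uniq.
  by move=> b; rewrite mem_filter [in X in _ -> X]mem_filter => /andP[h1 h2]; have /andP[-> ->] := gp b h2 h1.
have := @count_not_coprime v Z j0 M ps pps pZ Z0 sv; rewrite -/q.
have sE : (M = size [seq b <- iota j0 M | coprime q b] + size [seq b <- iota j0 M | ~~ coprime q b])%N.
  by rewrite !size_filter count_predC size_iota.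
move: sE; set s1 := size _; set s2 := size _ => sE h.
have {}h : s2%:R <= M%:R / 8 + v%:R :> R.
  have Zr : 0 < Z%:R :> R by rewrite ltr0n.
  rewrite -(ler_pM2l Zr); move: h; rewrite -(ler_nat R) !natrM natrD => h; apply: le_trans h _.
  have vZ' : 8 * v%:R <= Z%:R :> R by rewrite -natrM ler_nat.
  have : 8 * v%:R * M%:R <= Z%:R * M%:R :> R by rewrite ler_wpM2r.
  lra.
have sE' : M%:R = s1%:R + s2%:R :> R by rewrite -natrD -sE.
have -> : Y / (64 * d%:R) = lam / 2 by rewrite /lam; field; lra.
have : 0 <= v%:R :> R by [].
lra.
Qed.

(** The estimate for a single n, free of asymptotics. T is the upper end of the range of q required
    by [window_interval], K0 bounds the coefficients, and Lam, an inverse density of primes, is up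
    to constants the loss for each prime. *)
Lemma finite_lower_bound (R : realType) (n d K0 U Z kap hN hQ k v0 : nat)
    (kappa sigma beta xi A Lam : R) :
  let L1 := Lnfun n (2 / 3) (delta_of R n d)^-1 in
  let L2 := Lnfun n (2 / 3) (kappa - (delta_of R n d)^-1) in
  let Y := Lnfun n (1 / 3) sigma in
  let T := Y * L1 / expR (ln 2 / (4 * d%:R)) ^+ 2 in
  (0 < n)%N -> odd d -> 16 * d%:R <= L1 -> L1 ^+ d = n%:R ->
  (2 * d + 4 <= K0)%N -> K0%:R <= L2 -> L2 / 2 <= K0%:R ->
  U%:R < Lnfun n (1 / 3) beta ->
  2500 <= A -> A ^+ 2 <= hN%:R -> (hN * 2 ^ k <= hQ)%N -> (hQ * 2 ^ v0.+1 <= U)%N ->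
  1 <= Lam -> 6 * ln (2 * U).+1%:R <= Lam -> (0 < Z)%N -> 4 * Lam * Z%:R <= hN%:R ->
  8 * Lam * ln n%:R <= hQ%:R -> 8 * Lam * ln Y <= hQ%:R ->
  ((hQ * 2 ^ v0).+1%:R) * (2 * (dyadic_prod hQ v0)%:R) <= T ->
  T * (2 ^ v0)%:R <= U%:R * (dyadic_prod hQ v0)%:R ->
  (2 * v0.+1 + 2 * ((v0.+1 + kap) %/ kap.+1) <= k)%N -> 0 < xi -> xi <= 1 ->
  ((48 * (kap + 3) ^ kap.+1)%:R * (U%:R / Z%:R) ^+ 5) ^+ kap.+1 <= xi ^+ (2 * kap.+1) * Z%:R ->
  4 * Y * ((1 + xi) ^+ v0.+1 - 1) <= Z%:R / U%:R * (Y / (64 * d%:R)) ->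
  (8 * v0.+1 <= Z)%N -> 4 * (v0.+1%:R + 2) <= Y / (32 * d%:R) ->
  (dyadic_prod hN k)%:R <= T / 2 * (K0%:R / 2 * (Y / 2) ^+ d.-1) ->
  4 * Y <= L2 ->
  (dyadic_prod hN k)%:R / ((2 * Lam) ^+ k * (8 * Lam) ^+ v0.+1) * (Y / (128 * d%:R)) *
    (L2 / (4 * Y)) ^+ d.-1 / ((L1 + 1) * (2 * L2 + 1) ^+ d) <=
  expected_card_X n d kappa sigma beta beta.
Proof.
move=> L1 L2 Y T n0 od dL Ln dK KL LK UB A2500 AN NQ QU Lam1 LU Z0 ZN nQ YQ TP TU kv xi0 xi1 num err vZ vY PX YL.
have d0 : (0 < d)%N by case: (d) od.
have d0R : 0 < d%:R :> R by rewrite ltr0n.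
have Y0 : 0 < Y by exact: expR_gt0.
have L10 : 0 < L1 by exact: expR_gt0.
have L20 : 0 < L2 by exact: expR_gt0.
have T0 : 0 < T by rewrite /T divr_gt0 ?mulr_gt0 ?exprn_gt0 ?expR_gt0.
have Lam0 : 0 < Lam by exact: lt_le_trans Lam1.
have [Qs [Ns [[sQ sN uQN aQN zN] [[zQ cQn PN sNs] [TTs TTe]]]]] :=
  prime_blocks n0 A2500 AN NQ QU Lam1 LU Z0 ZN nQ T0 TP TU.
clear A2500 AN; move: num.
pose Bs := [seq b <- iota 1 (Num.truncn Y) | Y / 2 <= b%:R].
have trY : (Num.truncn Y)%:R <= Y by rewrite truncn_le; exact: ltW Y0.
have BsP b : b \in Bs -> [/\ (0 < b)%N, Y / 2 <= b%:R & b%:R <= Y].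
  rewrite mem_filter mem_iota add1n ltnS => /andP[h1 /andP[h2 h3]].
  have h4 : b%:R <= (Num.truncn Y)%:R :> R by rewrite ler_nat; exact: h3.
  exact: And3 h2 h1 (le_trans h4 trY).
have sBs : (size Bs)%:R <= Y.
  apply: le_trans trY; rewrite ler_nat size_filter.
  by apply: leq_trans (count_size _ _) _; rewrite size_iota; exact: leqnn.
have pQ : all prime (flatten Qs).
  by apply/allP => p pp; have := allP aQN p; rewrite flatten_cat mem_cat pp => /(_ isT)/andP[].
have ZQ : all (fun p => Z <= p)%N (flatten Qs).
  by apply/allP => p pp; have := allP aQN p; rewrite flatten_cat mem_cat pp => /(_ isT)/and3P[].
have pos2 i : (0 < 2 ^ i)%N by rewrite expn_gt0.
have ZU : (Z <= U)%N.
  apply: leq_trans QU; apply: leq_trans (_ : hQ <= _)%N; last by rewrite leq_pmulr.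
  apply: leq_trans NQ; apply: leq_trans (_ : hN <= _)%N; last by rewrite leq_pmulr.
  rewrite -(ler_nat R); apply: le_trans ZN; rewrite ler_peMl //; move: Lam1; clear; lra.
have v1 : 0 <= (1 + xi) ^+ v0.+1 - 1 by rewrite subr_ge0 exprn_ege1 // lerDl ltW.
have Hk0 : K0%:R / 2 <= (K0 - d.+2)%N%:R :> R.
  rewrite ler_pdivrMr // -natrM ler_nat; move: dK; clear; lia.
have := @assembly R n d K0 U Z kap kappa sigma beta beta xi T (Y / (64 * d%:R)) (Z%:R / U%:R) (L2 / (4 * Y)) Bs Qs Ns.
cbv zeta.
have dK0 : (d.+2 <= K0)%N by move: dK; clear; lia.
(* K0 >= L2/2 and L2 >= 4 Y, so that rounding K0 / b down loses at most another factor 2. *)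
have Hm b : b \in Bs -> L2 / (4 * Y) <= (K0 %/ b)%N%:R.
  move=> /BsP[b0 _ bY].
  have h : K0%:R < ((K0 %/ b)%N%:R + 1) * b%:R :> R by rewrite natr1 -natrM ltr_nat ltn_ceil.
  have x0 : 0 <= (K0 %/ b)%N%:R :> R by [].
  set x : R := (K0 %/ b)%N%:R in h x0 *.
  have h2 : (x + 1) * b%:R <= (x + 1) * Y by rewrite ler_wpM2l // addr_ge0.
  have h3 : L2 / 2 < (x + 1) * Y by move: h h2 LK; clear; lra.
  have -> : L2 / (4 * Y) = (L2 / 2) / Y / 2 by move: (lt0r_neq0 Y0); clear => Y1; field.
  have h4 : L2 / 2 / Y < x + 1 by rewrite ltr_pdivrMr; [exact: h3 | exact: Y0].
  have h5 : 2 <= L2 / 2 / Y by rewrite ler_pdivlMr; [move: YL; clear; lra | exact: Y0].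
  by move: h4 h5; clear; lra.
move=> AS num; apply: le_trans (AS _ _ _ _ _ _ _ _ _ _ _ _ _ _ _ _ _ _ _ _ _ _ _ _ _ _ _) => // {AS num}.
- apply: ler_wpM2r; first by rewrite invr_ge0 mulr_ge0 ?exprn_ge0 ?addr_ge0 ?mulr_ge0 ?(ltW L10) ?(ltW L20).
  apply: ler_wpM2r; first by rewrite exprn_ge0 // divr_ge0 ?mulr_ge0 ?(ltW L20) ?(ltW Y0).
  set TT := [seq ps <- _ | _] in TTs *.
  have a1 : (dyadic_prod hN k)%:R / (2 * Lam) ^+ k <= (size (tuples Ns))%:R :> R.
    by rewrite ler_pdivrMr ?exprn_gt0 ?mulr_gt0 // mulrC.
  have a2 : T / (8 * Lam) ^+ v0.+1 <= (size TT)%:R.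
    by rewrite ler_pdivrMr ?exprn_gt0 ?mulr_gt0 // mulrC.
  have -> : (dyadic_prod hN k)%:R / ((2 * Lam) ^+ k * (8 * Lam) ^+ v0.+1) * (Y / (128 * d%:R)) =
     ((dyadic_prod hN k)%:R / (2 * Lam) ^+ k) * (T / (8 * Lam) ^+ v0.+1) * (Y / (64 * d%:R)) / (2 * T).
    have e1 : (2 * Lam) ^+ k != 0 by rewrite gt_eqF // exprn_gt0 // mulr_gt0.
    have e2 : (8 * Lam) ^+ v0.+1 != 0 by rewrite gt_eqF // exprn_gt0 // mulr_gt0.
    move: e1 e2; generalize ((2 * Lam) ^+ k) ((8 * Lam) ^+ v0.+1) => x y x0 y0.
    by field; rewrite x0 y0 !gt_eqF.
  apply: ler_wpM2r; first by rewrite invr_ge0 mulr_ge0 // ltW.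
  apply: ler_wpM2r; first by rewrite divr_ge0 ?mulr_ge0 ?(ltW Y0) ?(ltW d0R).
  apply: ler_pM => //; rewrite divr_ge0 ?exprn_ge0 ?mulr_ge0 ?(ltW Lam0) ?(ltW Y0) ?(ltW L10) //.
- exact: filter_uniq (iota_uniq _ _).
- by move=> b /BsP[].
- by move=> b /BsP[_ h1 h2]; rewrite h1 h2.
- move=> b bB; have [b0 _ bY] := BsP b bB; apply: zQ => //.
  apply: le_trans YQ; apply: ler_wpM2l; first by rewrite mulr_ge0 // ltW.
  by rewrite ler_ln ?posrE; [exact: bY | rewrite ltr0n | exact: Y0].
- by rewrite sQ sN.
- move=> ps; rewrite mem_filter => /andP[psT psQ].
  apply: (@window_count R n d Z v0.+1 Y T ps) => //.
  + by apply/allP => p /(mem_tuples_flatten psQ)/(allP pQ).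
  + by apply/allP => p /(mem_tuples_flatten psQ)/(allP ZQ).
  + by rewrite (size_mem_tuples psQ).
- rewrite sQ; apply: le_trans err; apply: ler_wpM2r => //; exact: ler_wpM2l.
- move=> b bB N NN; have [b0 Yb _] := BsP b bB.
  apply: (@le_trans _ _ (dyadic_prod hN k)%:R); first by rewrite ler_nat; exact: PN.
  apply: le_trans PX _; apply: ler_wpM2l; first by rewrite divr_ge0 // ltW.
  apply: ler_pM => //; rewrite ?divr_ge0 ?exprn_ge0 ?divr_ge0 ?(ltW Y0) //.
  by rewrite lerXn2r ?nnegrE ?divr_ge0 ?(ltW Y0).
- exact: divr_ge0 (ltW L20) (mulr_ge0 (ler0n R 4) (ltW Y0)).
- exact: divr_ge0 (ltW Y0) (mulr_ge0 (ler0n R 64) (ltW d0R)).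
Qed.

(** * Choice of the parameters *)

Lemma dyadic_prodE (R : realType) (h k : nat) : (0 < h)%N ->
  (dyadic_prod h k)%:R = expR (k%:R * ln h%:R + ln 2 * (k%:R * (k%:R + 1) / 2)) :> R.
Proof.
move=> h0; have hR : 0 < h%:R :> R by rewrite ltr0n.
elim: k => [|k IH]; first by rewrite /dyadic_prod big_ord0 !mul0r mulr0 addr0 expR0.
rewrite dyadic_prodS !natrM IH natrX.
have -> : h%:R * 2%:R ^+ k.+1 = expR (ln h%:R + k.+1%:R * ln 2) :> R.
  by rewrite expRD expRM_natl !lnK ?posrE.
by rewrite -expRD -natr1; congr expR; field.
Qed.

Lemma truncn_half (R : realType) (x : R) : 2 <= x ->
  x / 2 <= (Num.truncn x)%:R /\ (Num.truncn x)%:R <= x.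
Proof.
move=> x2; have x0 : 0 <= x by lra.
split; last by rewrite truncn_le.
have : x < (Num.truncn x).+1%:R by exact: truncnS_gt.
by rewrite -natr1; lra.
Qed.

Lemma truncn_expR (R : realType) (x : R) : 1 <= x ->
  let h := Num.truncn (expR x) in
  [/\ (0 < h)%N, x - ln 2 <= ln h%:R & ln h%:R <= x].
Proof.
move=> x1 h; have e2 : 2 <= expR x by apply: le_trans (expR_ge1Dx _); lra.
have [h1 h2] := truncn_half e2; rewrite -/h in h1 h2.
have hR : 0 < h%:R :> R by lra.
split; first by rewrite -(ltr0n R).
  by rewrite -ler_expR lnK ?posrE // expRB lnK ?posrE.
by rewrite -ler_expR lnK ?posrE.
Qed.

(** Rounding the number of primes up to v lowers their common logarithmic scale from b to l = tot /
    v. *)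
Lemma block_number (R : realType) (tot b : R) : 0 < b -> 0 < tot ->
  let v := (Num.truncn (tot / b)).+1 in
  let l := tot / v%:R in
  [/\ v%:R <= tot / b + 1, tot / b <= v%:R, v%:R * l = tot, l <= b & b - b ^+ 2 / tot <= l].
Proof.
move=> b0 t0 v l; have tb : 0 < tot / b by rewrite divr_gt0.
have v1 : v%:R <= tot / b + 1 by rewrite -natr1 lerD2r truncn_le ltW.
have v2 : tot / b <= v%:R by exact/ltW/truncnS_gt.
split => //.
- by rewrite mulrC divfK // gt_eqF.
- by rewrite /l ler_pdivrMr // mulrC -ler_pdivrMr.
rewrite /l ler_pdivlMr //.
have [h|h] := leP 0 (b - b ^+ 2 / tot); last first.
  by apply: le_trans (ltW t0); rewrite mulr_le0_ge0 // ltW.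
apply: (@le_trans _ _ ((b - b ^+ 2 / tot) * (tot / b + 1))); last first.
  have -> : (b - b ^+ 2 / tot) * (tot / b + 1) = tot - b ^+ 2 / tot by field; rewrite !gt_eqF.
  by rewrite gerBl divr_ge0 ?sqr_ge0 // ltW.
by rewrite ler_wpM2l.
Qed.

Lemma expR_sub1_le (R : realType) (x : R) : 0 <= x -> x <= 2^-1 -> expR x - 1 <= 2 * x.
Proof.
move=> x0 x1; have h : 1 - x <= expR (- x) by have := expR_ge1Dx (- x).
rewrite expRN in h.
have e0 : 0 < expR x by exact: expR_gt0.
have h1 : (1 - x) * expR x <= 1.
  by have := ler_wpM2r (ltW e0) h; rewrite mulVf // gt_eqF.
nra.
Qed.

Lemma pow_sub1_le (R : realType) (v : nat) (xi : R) : 0 <= xi -> v%:R * xi <= 2^-1 ->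
  (1 + xi) ^+ v - 1 <= 2 * (v%:R * xi).
Proof.
move=> x0 vx; apply: (@le_trans _ _ (expR (v%:R * xi) - 1)).
  rewrite lerD2r expRM_natl lerXn2r ?nnegrE ?expR_ge0 ?expR_ge1Dx // addr_ge0 //.
by apply: expR_sub1_le => //; rewrite mulr_ge0.
Qed.

(* The size v of the tuple and the common scale l of its primes being such that
   v l = tot, the dyadic blocks start at exp (l - v/2 log 2), up to a bounded
   factor. *)
Definition block_start (R : realType) (l : R) (v : nat) : nat :=
  Num.truncn (expR (l - (v%:R / 2 + 2) * ln 2)).

Lemma block_startP (R : realType) (l : R) (v : nat) : v%:R + 4 <= l ->
  let h := block_start l v in
  [/\ (0 < h)%N, l - (v%:R / 2 + 3) * ln 2 <= ln h%:R & ln h%:R <= l - (v%:R / 2 + 2) * ln 2].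
Proof.
move=> vl h; have v0 : 0 <= v%:R :> R by [].
have l1 := ln2_le1 R; have l2 := ln2_ge R.
have x1 : 1 <= l - (v%:R / 2 + 2) * ln 2.
  have c0 : 0 <= v%:R / 2 + 2 :> R by lra.
  by have := ler_wpM2l c0 l1; lra.
have [h0 h1 h2] := truncn_expR x1; split => //.
by apply: le_trans h1; lra.
Qed.

(** These are the two conditions that [prime_blocks] imposes at T = exp tL: the prime left to the
    wide block is neither too small nor above U, whatever the other primes are. [block_start] makes
    the mean logarithm of the blocks about l, so the last prime has logarithm l + O(v). *)
Lemma blocks_fit (R : realType) (l tL u : R) (v0 : nat) :
  v0.+1%:R * l = tL -> v0.+1%:R + 4 <= l -> l + 4 * v0%:R * ln 2 <= u ->
  let h := block_start l v0.+1 in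
  ((h * 2 ^ v0).+1%:R) * (2 * (dyadic_prod h v0)%:R) <= expR tL /\
  expR tL * (2 ^ v0)%:R <= expR u * (dyadic_prod h v0)%:R.
Proof.
move=> vl v4 lu h; have [h0 h1 h2] := block_startP v4; rewrite -/h in h0 h1 h2.
have hR : 0 < h%:R :> R by rewrite ltr0n.
have l2p : 0 < ln (2 : R) by have := ln2_ge R; lra.
have two i : (2 ^ i)%:R = expR (i%:R * ln 2) :> R by rewrite natrX expRM_natl lnK ?posrE.
rewrite dyadic_prodE //; set lh := ln h%:R in h1 h2 *.
have hE : h%:R = expR lh :> R by rewrite /lh lnK ?posrE.
have v00 : 0 <= v0%:R :> R by [].
have vS : v0.+1%:R = v0%:R + 1 :> R by rewrite natr1.
rewrite vS in vl h1 h2; split.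
  apply: (@le_trans _ _ (2 * (h * 2 ^ v0)%:R * (2 * expR (v0%:R * lh + ln 2 * (v0%:R * (v0%:R + 1) / 2))))).
    rewrite ler_wpM2r ?mulr_ge0 ?expR_ge0 // -natr1.
    have : 1 <= (h * 2 ^ v0)%:R :> R by rewrite ler1n muln_gt0 h0 expn_gt0.
    by clear; lra.
  have -> : 2 * (h * 2 ^ v0)%:R * (2 * expR (v0%:R * lh + ln 2 * (v0%:R * (v0%:R + 1) / 2))) =
     expR (2 * ln 2 + lh + v0%:R * ln 2 + (v0%:R * lh + ln 2 * (v0%:R * (v0%:R + 1) / 2))) :> R.
    have e2 : expR (2 * ln 2) = 2 * 2 :> R by rewrite mulr_natl mulr2n expRD lnK ?posrE.
    by rewrite natrM two hE !expRD e2; ring.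
  rewrite ler_expR -vl.
  have := ler_wpM2l (addr_ge0 v00 ler01) h2.
  move: v00 l2p; set x : R := v0%:R; set l2 := ln 2; clearbody x l2; clear => v00 l2p H.
  have : 0 <= x * l2 by rewrite mulr_ge0 // ltW.
  by nra.
rewrite two -!expRD ler_expR -vl.
have := ler_wpM2l v00 h1.
move: lu v00 l2p; set x : R := v0%:R; set l2 := ln 2; clearbody x l2; clear => lu v00 l2p H.
have : 0 <= x * l2 by rewrite mulr_ge0 // ltW.
by nra.
Qed.

(** The shift in [block_start] compensates the doubling of the blocks, so the product of their upper
    ends is exp (k l) up to exp (O(k)). *)
Lemma blocks_capacity (R : realType) (l X : R) (k : nat) :
  k%:R * l = X -> k%:R + 4 <= l ->
  let h := block_start l k in
  expR (X - 5 / 2 * k%:R) <= (dyadic_prod h k)%:R /\ (dyadic_prod h k)%:R <= expR X.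
Proof.
move=> kl k4 h; have [h0 h1 h2] := block_startP k4; rewrite -/h in h0 h1 h2.
have l2 := ln2_ge R; have l21 := ln2_le1 R.
rewrite dyadic_prodE // !ler_expR -kl; set lh := ln h%:R in h1 h2 *.
have k0 : 0 <= k%:R :> R by [].
have H1 := ler_wpM2l k0 h1; have H2 := ler_wpM2l k0 h2.
move: H1 H2 l2 l21 k0; set y : R := k%:R; set m2 := ln 2; clearbody y m2; clear => H1 H2 l20 l21 k0.
by split; nra.
Qed.

Lemma leq_mul_exp2 (R : realType) (a b k : nat) : (0 < a)%N -> (0 < b)%N ->
  ln a%:R + k%:R * ln 2 <= ln b%:R :> R -> (a * 2 ^ k <= b)%N.
Proof.
move=> a0 b0; rewrite -ler_expR expRD expRM_natl !lnK ?posrE ?ltr0n //.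
by rewrite -natrX -natrM ler_nat.
Qed.

(** For tot of order D^2 w and b of order D w there are O(D) blocks, and the rounding loss b^2 / tot
    is O(w), hence at most D. *)
Lemma block_scale (R : realType) (tot c D w beta M m C : R) :
  1 <= D -> 0 < beta -> 0 < w -> 0 < m -> 0 <= M -> 0 <= c -> 2 * c <= beta * w ->
  tot <= M * (D ^+ 2 * w) -> m * (D ^+ 2 * w) <= tot -> beta ^+ 2 <= C * m ->
  C * w <= D ->
  let b := (beta * w - c) * D in
  let v := (Num.truncn (tot / b)).+1 in
  let l := tot / v%:R in
  [/\ v%:R <= tot / b + 1, tot / b <= v%:R, v%:R * l = tot,
      v%:R <= (2 * M / beta + 1) * D & b - D <= l <= b].
Proof.
move=> D1 be0 w0 m0 M0 c0 cw tM mt bC CD b v l.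
have D0 : 0 < D by lra.
have bw0 : 0 < beta * w by rewrite mulr_gt0.
have b0 : 0 < b by rewrite mulr_gt0 //; lra.
have t0 : 0 < tot by apply: lt_le_trans mt; rewrite !mulr_gt0 // exprn_gt0.
have [h1 h2 h3 h4 h5] := block_number b0 t0; split => //.
  apply: le_trans h1 _; rewrite mulrDl mul1r lerD // ler_pdivrMr //.
  apply: le_trans tM _.
  have -> : 2 * M / beta * D * b = M * D ^+ 2 * (2 * (beta * w - c) / beta).
    by rewrite /b; field; rewrite gt_eqF.
  rewrite mulrA; apply: ler_wpM2l; first by rewrite mulr_ge0 // exprn_ge0 // ltW.
  by rewrite ler_pdivlMr //; lra.
apply/andP; split => //; apply: le_trans h5; rewrite lerD2l lerN2 ler_pdivrMr //.
apply: le_trans (_ : (beta * w * D) ^+ 2 <= _).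
  have bb : b <= beta * w * D by rewrite /b ler_pM2r //; lra.
  by apply: lerXn2r => //; rewrite nnegrE; [exact: ltW | exact: le_trans (ltW b0) bb].
apply: le_trans (_ : C * w * (m * (D ^+ 2 * w)) <= _).
  have -> : C * w * (m * (D ^+ 2 * w)) = (C * m) * (w * D) ^+ 2 by ring.
  by rewrite -mulrA exprMn ler_wpM2r // sqr_ge0.
by apply: ler_pM => //; rewrite ?mulr_ge0 ?exprn_ge0 ?ltW //; have := sqr_ge0 beta; nra.
Qed.

(** The hypotheses on C say that w, D/w and exp D / D^6 exceed constants. All scales are P - O(D)
    with P = beta w D = log y; the constants in [bQ] and [bN] stem from the bounds V D and VN D for
    the numbers of blocks. [tL] is log T, and exp [XL] is the largest N that the coefficients can
    represent, up to rounding. The condition relating tL / bQ to XL / bN provides the blocks for N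
    that [equidistribution] demands. *)
Lemma explicit_bound (R : realType) (n d kap : nat)
    (kappa sigma beta w D dn dl du k0 V VN C A : R) :
  (0 < n)%N -> odd d -> delta_of R n d = dn -> d%:R = dn * D ->
  ln n%:R = D ^+ 3 * w ->
  (forall c, Lnfun n (1 / 3) c = expR (c * (D * w))) ->
  (forall c, Lnfun n (2 / 3) c = expR (c * (D ^+ 2 * w))) ->
  0 < beta -> 0 < sigma -> 0 < kappa -> 0 < dl -> dl <= dn -> dn <= du ->
  0 < k0 -> k0 <= kappa - dn^-1 ->
  V = 2 * (dl^-1 + sigma) / beta + 1 -> VN = 2 * (kappa + sigma * du) / beta + 1 ->
  2500 <= A -> A ^+ 2 <= C -> 2 * (5 * V + VN + 6) <= beta * C -> 1 <= sigma * C ->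
  beta ^+ 2 * du <= C -> 2 * beta ^+ 2 <= C * kappa -> 2 * (du + 3) <= kappa * C ->
  5 * V + 3 * VN + 13 <= beta * C -> sigma + 2 <= k0 * C ->
  4 * du + 8 <= C -> 56 * beta <= C -> 56 * beta * sigma <= C ->
  (48 * (kap + 3) ^ kap.+1)%:R <= C ->
  (35 * V + 14 * VN + 80) * kap.+1%:R + (5 * V + 2 * VN + 12) <= beta * C ->
  512 * V * du <= C -> 8 * V <= C -> 128 * du * (V + 2) <= C -> 128 * du <= C ->
  C <= w -> C * w <= D -> C * D ^+ 6 <= expR D ->
  let tL := dn^-1 * (D ^+ 2 * w) + sigma * (D * w) - ln 2 / (2 * d%:R) in
  let XL := kappa * (D ^+ 2 * w) + d%:R * (sigma * (D * w)) - (d%:R + 3) * ln 2 in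
  let bQ := (beta * w - (4 * V + 2)) * D in
  let bN := (beta * w - (5 * V + VN + 6)) * D in
  (2 + 2 / kap.+1%:R) * (tL / bQ + 1) + 2 <= XL / bN ->
  exists k v : nat, [/\ k%:R <= XL / bN + 1, v%:R <= tL / bQ + 1 &
    expR (2 * sigma * (D * w) - (k + v)%N%:R * ln (56 * (beta * (D * w)))
          - (5 * du + 5 / 2 * VN + 5) * D) <=
    expected_card_X n d kappa sigma beta beta].
Proof.
move=> n0 od dnE dE lnn L13 L23 be0 si0 ka0 dl0 dln dnu k00 k0k VE VNE A25 AC.
move=> C1 C2 C3 C4 C5 C6 C8 C9 C11 C12 C13 C14 C15 C16 C17 C18 Cw CD CE tL XL bQ bN Hk.
have l2 : 0 < ln (2 : R) by rewrite ln_gt0 // ltr1n.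
have l21 := ln2_le1 R.
have dn0 : 0 < dn by exact: lt_le_trans dln.
have du0 : 0 < du by exact: lt_le_trans dnu.
have C8' : 8 <= C by move: C9 du0; clear; lra.
have w8 : 8 <= w by exact: le_trans Cw.
have D8 : 64 <= D.
  by apply: le_trans CD; apply: le_trans (_ : 8 * 8 <= _); [by clear; lra | apply: ler_pM].
have D0 : 0 < D by move: D8; clear; lra.
have D1 : 1 <= D by move: D8; clear; lra.
have w0 : 0 < w by move: w8; clear; lra.
have d0 : 0 < d%:R :> R by rewrite dE mulr_gt0.
have d1 : 1 <= d%:R :> R by rewrite ler1n -(ltr0n R).
have ddu : d%:R <= du * D by rewrite dE ler_wpM2r // ltW.
have Dw0 : 0 < D * w by rewrite mulr_gt0.
have DDw0 : 0 < D ^+ 2 * w by rewrite mulr_gt0 // exprn_gt0.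
have V1 : 1 <= V.
  rewrite VE lerDr !mulr_ge0 ?invr_ge0 ?addr_ge0 ?invr_ge0 ?(ltW be0) ?(ltW dl0) ?(ltW si0) //.
have VN1 : 1 <= VN.
  by rewrite VNE lerDr !mulr_ge0 ?invr_ge0 ?addr_ge0 ?mulr_ge0 ?(ltW be0) ?(ltW ka0) ?(ltW si0) ?(ltW du0).
have scale a : a <= beta * C -> a * D <= beta * w * D.
  move=> h; rewrite ler_wpM2r ?(ltW D0) //; apply: le_trans h _.
  by rewrite ler_pM2l.
have sw : D <= sigma * (D * w).
  rewrite [D * w]mulrC mulrA ler_peMl ?(ltW D0) //; apply: le_trans C2 _.
  by rewrite ler_pM2l.
have poly (a : R) (j : nat) : (j <= 6)%N -> a <= C * D ^+ j -> a <= expR D.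
  move=> j6 h; apply: le_trans h (le_trans _ CE); rewrite ler_pM2l; last by move: C8'; clear; lra.
  by apply: ler_weXn2l j6.
have wD : w <= D by apply: le_trans CD; rewrite ler_peMl ?(ltW w0) //; move: C8'; clear; lra.
have ld : ln 2 / (2 * d%:R) <= 1 :> R by rewrite ler_pdivrMr ?mulr_gt0 //; move: l21 d1; clear; lra.
have ld0 : 0 <= ln 2 / (2 * d%:R) :> R by rewrite divr_ge0 ?mulr_ge0 // ltW.
have bw := scale _ C1.
have dnV : dn^-1 <= dl^-1 by rewrite lef_pV2 ?posrE.
have tLM : tL <= (dl^-1 + sigma) * (D ^+ 2 * w).
  have a1 : dn^-1 * (D ^+ 2 * w) <= dl^-1 * (D ^+ 2 * w) by rewrite ler_pM2r.
  have a2 : sigma * (D * w) <= sigma * (D ^+ 2 * w).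
    by rewrite ler_pM2l // ler_pM2r // expr2 ler_peMl // ltW.
  by rewrite /tL [(dl^-1 + _) * _]mulrDl; move: a1 a2 ld0; clear; lra.
have tLm : du^-1 * (D ^+ 2 * w) <= tL.
  have a1 : du^-1 * (D ^+ 2 * w) <= dn^-1 * (D ^+ 2 * w).
    by rewrite ler_pM2r // lef_pV2 ?posrE.
  by rewrite /tL; move: a1 sw ld D8; clear; lra.
have XE : d%:R * (sigma * (D * w)) = sigma * dn * (D ^+ 2 * w) by rewrite dE; ring.
have XM : XL <= (kappa + sigma * du) * (D ^+ 2 * w).
  have a1 : sigma * dn * (D ^+ 2 * w) <= sigma * du * (D ^+ 2 * w).
    by rewrite ler_pM2r // ler_pM2l.
  have a2 : 0 <= (d%:R + 3) * ln 2 :> R by rewrite mulr_ge0 ?addr_ge0 // ltW.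
  by rewrite /XL XE [(kappa + _) * _]mulrDl; move: a1 a2; clear; lra.
have Xm : kappa / 2 * (D ^+ 2 * w) <= XL.
  have a1 : (d%:R + 3) * ln 2 <= (du + 3) * D.
    apply: le_trans (_ : (d%:R + 3) * 1 <= _); first by rewrite ler_wpM2l // addr_ge0.
    by move: ddu D8; clear; lra.
  have a2 : (du + 3) * D <= kappa / 2 * (D ^+ 2 * w).
    apply: le_trans (_ : kappa * C / 2 * D <= _); first by rewrite ler_wpM2r ?(ltW D0) //; move: C5; clear; lra.
    have -> : kappa / 2 * (D ^+ 2 * w) = kappa / 2 * (w * D) * D by ring.
    rewrite ler_wpM2r ?(ltW D0) // (_ : kappa * C / 2 = kappa / 2 * C); last by ring.
    rewrite ler_wpM2l //; first by move: ka0; clear; lra.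
    by apply: le_trans Cw _; rewrite ler_peMr // ltW.
  have a3 : 0 <= sigma * dn * (D ^+ 2 * w) by rewrite !mulr_ge0 // ltW.
  by rewrite /XL XE; move: a1 a2 a3; clear; lra.
have [P PE] : exists P, P = beta * w * D by eexists.
have PE' : beta * (D * w) = P by rewrite PE; ring.
rewrite -PE in bw; have bw6 := scale _ C6; have bwc := scale _ C14; rewrite -PE in bw6 bwc.
have VD : D <= V * D by rewrite ler_peMl // ltW.
have VND : D <= VN * D by rewrite ler_peMl // ltW.
have c10 : 0 <= 4 * V + 2 by move: V1; clear; lra.
have c20 : 0 <= 5 * V + VN + 6 by move: V1 VN1; clear; lra.
have bwC : beta * C <= beta * w by rewrite ler_pM2l.
have cw1 : 2 * (4 * V + 2) <= beta * w by move: bwC C1 V1 VN1; clear; lra.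
have cw2 : 2 * (5 * V + VN + 6) <= beta * w by move: bwC C1; clear; lra.
have [v0 [lQ [vt vl vV lQ1 lQ2]]] : exists v0 l, [/\ v0.+1%:R <= tL / bQ + 1, v0.+1%:R * l = tL,
    v0.+1%:R <= V * D, bQ - D <= l & l <= bQ].
  exists (Num.truncn (tL / bQ)), (tL / (Num.truncn (tL / bQ)).+1%:R).
  have m0 : 0 < du^-1 by rewrite invr_gt0.
  have M0 : 0 <= dl^-1 + sigma by rewrite addr_ge0 ?invr_ge0 // ltW.
  have bC : beta ^+ 2 <= C * du^-1 by rewrite ler_pdivlMr.
  have [] := block_scale D1 be0 w0 m0 M0 c10 cw1 tLM tLm bC CD.
  by rewrite -VE => h1 h2 h3 h4 /andP[].
have [k [lN [kt Xk kl kV /andP[lN1 lN2]]]] : exists k l, [/\ k%:R <= XL / bN + 1, XL / bN <= k%:R, k%:R * l = XL,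
    k%:R <= VN * D & bN - D <= l <= bN].
  exists (Num.truncn (XL / bN)).+1, (XL / (Num.truncn (XL / bN)).+1%:R).
  have m0 : 0 < kappa / 2 by rewrite divr_gt0.
  have M0 : 0 <= kappa + sigma * du by rewrite addr_ge0 ?mulr_ge0 // ltW.
  have bC : beta ^+ 2 <= C * (kappa / 2) by move: C4; clear; lra.
  have [] := block_scale D1 be0 w0 m0 M0 c20 cw2 XM Xm bC CD.
  by rewrite -VNE => h1 h2 h3 h4 h5; split.
have bQE : bQ = P - 4 * (V * D) - 2 * D by rewrite /bQ PE; ring.
have bNE : bN = P - 5 * (V * D) - VN * D - 6 * D by rewrite /bN PE; ring.
have vln : 0 <= v0.+1%:R * ln 2 :> R /\ v0.+1%:R * ln 2 <= v0.+1%:R :> R.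
  by split; [rewrite mulr_ge0 // ltW | rewrite ler_piMr].
have kln : 0 <= k%:R * ln 2 :> R /\ k%:R * ln 2 <= k%:R :> R.
  by split; [rewrite mulr_ge0 // ltW | rewrite ler_piMr].
case: vln => vln0 vln1; case: kln => kln0 kln1.
have v4 : v0.+1%:R + 4 <= lQ by move: vV lQ1 bw VD VND D8; rewrite bQE; clear; lra.
have k4 : k%:R + 4 <= lN by move: kV lN1 bw VD VND D8; rewrite bNE; clear; lra.
have [] := block_startP v4; have [] := block_startP k4.
set hN := block_start lN k; set hQ := block_start lQ v0.+1 => hN0 hN1 hN2 hQ0 hQ1 hQ2.
have hN3 : P - (5 * V + 2 * VN + 10) * D <= ln hN%:R.
  by apply: le_trans hN1; move: lN1 kV kln1 l21 VD VND D8; rewrite bNE; clear; lra.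
have hQ3 : P - (5 * V + 6) * D <= ln hQ%:R.
  by apply: le_trans hQ1; move: lQ1 vV vln1 l21 VD VND D8; rewrite bQE; clear; lra.
have U1 : 1 <= P - D by move: bw VD VND D8; clear; lra.
have Z1 : 1 <= P - (5 * V + 2 * VN + 11) * D by move: bw6 VD VND D8; clear; lra.
(* U is about exp (P - D), below y, and Z about exp (P - O(D)), below the start of every block; so
   U/Z = exp (O(D)) is negligible against Z. *)
have [] := truncn_expR U1; have [] := truncn_expR Z1.
set Z := Num.truncn _; set U := Num.truncn _ => Z0 ZL ZU U0 UL UU.
have expln (m : nat) : (0 < m)%N -> m%:R = expR (ln m%:R) :> R.
  by move=> m0; rewrite lnK // posrE ltr0n.
have CwC : C <= D by apply: le_trans Cw wD.
pose L1 : R := expR (dn^-1 * (D ^+ 2 * w)); pose L2 : R := expR ((kappa - dn^-1) * (D ^+ 2 * w)).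
pose Y : R := expR (sigma * (D * w)).
have YD : expR D <= Y by rewrite ler_expR.
have L1D : expR D <= L1.
  rewrite ler_expR (_ : dn^-1 * (D ^+ 2 * w) = D * (w * D / dn)); last by field; rewrite gt_eqF.
  rewrite ler_peMr ?(ltW D0) // ler_pdivlMr // mul1r.
  apply: le_trans (_ : w <= _); last by rewrite ler_peMr // ltW.
  by move: Cw C18 dnu du0; clear; lra.
have k1b : (sigma + 2) * (D * w) <= (kappa - dn^-1) * (D ^+ 2 * w).
  apply: le_trans (_ : k0 * (D ^+ 2 * w) <= _); last by rewrite ler_pM2r.
  rewrite (_ : k0 * (D ^+ 2 * w) = k0 * D * (D * w)); last by ring.
  rewrite ler_pM2r //; apply: le_trans C8 _.
  by rewrite ler_pM2l.
have Y0 : 0 < Y by exact: expR_gt0.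
have L20 : 0 < L2 by exact: expR_gt0.
have L10 : 0 < L1 by exact: expR_gt0.
have YL : 4 * Y <= L2.
  apply: le_trans (_ : expR ((sigma + 2) * (D * w)) <= _); last by rewrite ler_expR.
  rewrite [(sigma + 2) * _]mulrDl expRD mulrC ler_pM2l //; apply: le_trans (expR_ge1Dx _).
  have : D * 1 <= D * w by rewrite ler_pM2l //; move: w8; clear; lra.
  by move: D8; clear; lra.
have ED8 : 64 <= expR D by apply: le_trans D8 _; apply: le_trans (expR_ge1Dx _); clear; lra.
have L2_2 : 2 <= L2 by move: YL YD ED8; clear; lra.
have [] := truncn_half L2_2; set K0 := Num.truncn L2 => K1 K2.
have TE : Y * L1 / expR (ln 2 / (4 * d%:R)) ^+ 2 = expR tL.
  rewrite /Y /L1 -expRM_natl -expRN -!expRD; congr expR; rewrite /tL.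
  by field; rewrite !gt_eqF.
have q1 : 16 * d%:R <= L1.
  apply: le_trans L1D; apply: (poly _ 1%N) => //; rewrite expr1.
  apply: le_trans (_ : 16 * (du * D) <= _); first by rewrite ler_pM2l.
  by rewrite mulrA ler_pM2r //; move: C18 du0; clear; lra.
have q2 : L1 ^+ d = n%:R.
  rewrite -expRM_natl (expln _ n0) lnn; congr expR; rewrite dE.
  by field; rewrite gt_eqF.
have q3 : (2 * d + 4 <= K0)%N.
  rewrite -(ler_nat R) natrD natrM; apply: le_trans K1; rewrite ler_pdivlMr //.
  apply: le_trans (_ : expR D <= _); last by move: YL YD Y0; clear; lra.
  apply: (poly _ 1%N) => //; rewrite expr1.
  apply: le_trans (_ : (4 * du + 8) * D <= _); last by rewrite ler_pM2r.
  by move: ddu D1; clear; lra.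
have q4 : U%:R < Lnfun n (1 / 3) beta.
  by rewrite L13 PE' (expln _ U0) ltr_expR; move: UU D0; clear; lra.
have q5 : A ^+ 2 <= hN%:R.
  rewrite (expln _ hN0); apply: le_trans (_ : expR D <= _).
    apply: (poly _ 0%N) => //; by rewrite expr0 mulr1.
  by rewrite ler_expR; apply: le_trans hN3; move: bw6 VD VND D0; clear; lra.
(* [bN] lies below [bQ] by enough for the k <= VN D doublings of the blocks for N. *)
have q6 : (hN * 2 ^ k <= hQ)%N.
  apply: (@leq_mul_exp2 R) => //; apply: le_trans hQ3.
  by move: hN2 lN2 kln1 kV bw VD VND D1 l2; rewrite bNE; clear; lra.
have q7 : (hQ * 2 ^ v0.+1 <= U)%N.
  apply: (@leq_mul_exp2 R) => //; apply: le_trans UL.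
  by move: hQ2 lQ2 vln1 vV bw VD VND D1 l2 l21; rewrite bQE; clear; lra.
have PD : 24 * D <= P by move: bw VD VND; clear; lra.
have q8 : 1 <= 7 * P by move: PD D1; clear; lra.
have UP : U%:R <= expR (P - D) by rewrite (expln _ U0) ler_expR.
have q9 : 6 * ln (2 * U).+1%:R <= 7 * P.
  have h : ln (2 * U).+1%:R <= P.
    rewrite -ler_expR lnK ?posrE ?ltr0n // -natr1 natrM.
    have u1 : 1 <= U%:R :> R by rewrite ler1n.
    have h1 : expR D * U%:R <= expR P.
      have -> : expR P = expR D * expR (P - D) by rewrite -expRD; congr expR; ring.
      by rewrite ler_pM2l ?expR_gt0.
    have h2 : 64 * U%:R <= expR D * U%:R by rewrite ler_wpM2r.
    by move: h1 h2 u1; clear; lra.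
  by move: h PD D0; clear; lra.
have hND : expR D * expR (P - (5 * V + 2 * VN + 11) * D) <= hN%:R.
  by rewrite (expln _ hN0) -expRD ler_expR; apply: le_trans hN3; clear; lra.
have hQD : expR D <= hQ%:R.
  by rewrite (expln _ hQ0) ler_expR; apply: le_trans hQ3; move: bw VD VND D0; clear; lra.
have PDD : P <= beta * D ^+ 2 by rewrite PE expr2 mulrA ler_pM2r // ler_pM2l.
have q11 : 4 * (7 * P) * Z%:R <= hN%:R.
  apply: le_trans hND; apply: ler_pM => //; first by move: q8; clear; lra.
    apply: (poly _ 2%N) => //; apply: le_trans (_ : 56 * beta * D ^+ 2 <= _).
      by move: PDD q8; clear; lra.
    by rewrite ler_wpM2r // exprn_ge0 // ltW.
  by rewrite (expln _ Z0) ler_expR.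
have q12 : 8 * (7 * P) * ln n%:R <= hQ%:R.
  apply: le_trans hQD; apply: (poly _ 6%N) => //; rewrite lnn.
  apply: le_trans (_ : 56 * beta * D ^+ 2 * D ^+ 4 <= _).
    apply: ler_pM; [by move: q8; clear; lra | by rewrite mulr_ge0 ?exprn_ge0 // ltW | |].
      by move: PDD; clear; lra.
    by rewrite (exprSr D 3) ler_pM2l ?exprn_gt0.
  by rewrite -mulrA -exprD ler_wpM2r // exprn_ge0 // ltW.
have q13 : 8 * (7 * P) * ln Y <= hQ%:R.
  apply: le_trans hQD; apply: (poly _ 4%N) => //; rewrite /Y expRK.
  apply: le_trans (_ : 56 * beta * D ^+ 2 * (sigma * D ^+ 2) <= _).
    apply: ler_pM; [by move: q8; clear; lra | by rewrite !mulr_ge0 // ltW | |].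
      by move: PDD; clear; lra.
    by rewrite expr2 !ler_pM2l.
  rewrite (_ : _ * _ * _ = 56 * beta * sigma * D ^+ 4); last by ring.
  by rewrite ler_wpM2r // exprn_ge0 // ltW.
(* The 4 V + 2 in [bQ] makes room for 4 v0 log 2. *)
have lu : lQ + 4 * v0%:R * ln 2 <= ln U%:R.
  apply: le_trans UL; move: vln1 vV bw VD VND D1 l2 l21 lQ2; rewrite bQE -natr1; clear; lra.
have [q14 q15] := blocks_fit vl v4 lu; rewrite -/hQ -(expln _ U0) in q14 q15.
have K0R : 0 < kap.+1%:R :> R by rewrite ltr0n.
have q16 : (2 * v0.+1 + 2 * ((v0.+1 + kap) %/ kap.+1) <= k)%N.
  have h : ((v0.+1 + kap) %/ kap.+1 * kap.+1 <= v0.+1 + kap)%N by exact: leq_divM.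
  rewrite -(ler_nat R) natrD !natrM.
  set m := ((v0.+1 + kap) %/ kap.+1)%N in h *.
  have hm : m%:R <= v0.+1%:R / kap.+1%:R + 1 :> R.
    rewrite -(ler_nat R) natrM natrD in h.
    rewrite -(ler_pM2r K0R) mulrDl mul1r divfK ?gt_eqF //; apply: le_trans h _.
    by rewrite lerD2l ler_nat.
  have h2 : (2 + 2 / kap.+1%:R) * v0.+1%:R <= (2 + 2 / kap.+1%:R) * (tL / bQ + 1).
    by rewrite ler_wpM2l // addr_ge0 // divr_ge0.
  apply: le_trans (le_trans Hk Xk).
  move: hm h2; move: (tL / bQ + 1) (v0.+1%:R : R) (kap.+1%:R^-1 : R) (m%:R : R) => x y z t.
  by clear; lra.
(* c3 D bounds log (U/Z). With one more D in xi, the relative error v xi is smaller than the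
   proportion Z/U of usable tuples by exp (- D) up to polynomial factors, while powers of xi remain
   negligible against Z. *)
pose c3 := 5 * V + 2 * VN + 11; pose c4 := c3 + 1.
pose xi : R := expR (- (c4 * D)).
have xi0 : 0 < xi by exact: expR_gt0.
have c4D : 0 <= c4 * D by rewrite mulr_ge0 ?(ltW D0) // /c4 /c3; move: V1 VN1; clear; lra.
have xi1 : xi <= 1 by rewrite -expR0 ler_expR oppr_le0.
have UZ : U%:R / Z%:R <= expR (c3 * D).
  rewrite (expln _ U0) (expln _ Z0) -expRN -expRD ler_expR /c3.
  by move: UU ZL l21 D1; clear; lra.
have Z0R : 0 < Z%:R :> R by rewrite ltr0n.
have U0R : 0 < U%:R :> R by rewrite ltr0n.
have ZUe : expR (- (c3 * D)) <= Z%:R / U%:R.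
  by rewrite expRN -[Z%:R / U%:R]invrK invf_div lef_pV2 ?posrE ?expR_gt0 // divr_gt0.
have q19 : ((48 * (kap + 3) ^ kap.+1)%:R * (U%:R / Z%:R) ^+ 5) ^+ kap.+1 <= xi ^+ (2 * kap.+1) * Z%:R.
  have h1 : (48 * (kap + 3) ^ kap.+1)%:R <= expR D.
    by apply: le_trans C13 _; apply: (poly _ 0%N) => //; rewrite expr0 mulr1.
  have h2 : (48 * (kap + 3) ^ kap.+1)%:R * (U%:R / Z%:R) ^+ 5 <= expR (D + 5%:R * (c3 * D)).
    rewrite expRD expRM_natl; apply: ler_pM => //.
    by apply: lerXn2r => //; rewrite nnegrE ?divr_ge0 ?expR_ge0.
  apply: le_trans (_ : expR (D + 5%:R * (c3 * D)) ^+ kap.+1 <= _).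
    by apply: lerXn2r => //; rewrite nnegrE ?expR_ge0 // mulr_ge0 // exprn_ge0 // divr_ge0.
  rewrite /xi -!expRM_natl (expln _ Z0) -expRD ler_expR natrM.
  move: bwc ZL l21 D1; rewrite /c4 /c3; move: (kap.+1%:R : R) => K; clear; lra.
have [eD0 eDE] : 0 < expR (- D) /\ expR (- D) * expR D = 1.
  by rewrite expR_gt0 -expRD addNr expR0.
have vt1 : 8 * (v0.+1%:R * expR (- D)) <= 1.
  rewrite -[leRHS]eDE mulrA mulrC ler_pM2l //; apply: (poly _ 1%N) => //; rewrite expr1.
  apply: le_trans (_ : 8 * V * D <= _); first by move: vV; clear; lra.
  by rewrite ler_pM2r.
have vt2 : 512 * (v0.+1%:R * d%:R) * expR (- D) <= 1.
  rewrite -[leRHS]eDE mulrC ler_pM2l //; apply: (poly _ 2%N) => //.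
  apply: le_trans (_ : 512 * V * du * D ^+ 2 <= _); last by rewrite ler_pM2r // exprn_gt0.
  by have := ler_pM (ler0n R v0.+1) (ler0n R d) vV ddu; clear; lra.
have q20 : 4 * Y * ((1 + xi) ^+ v0.+1 - 1) <= Z%:R / U%:R * (Y / (64 * d%:R)).
  have xiE : xi = expR (- (c3 * D)) * expR (- D) by rewrite /xi -expRD; congr expR; rewrite /c4; ring.
  have e1 : expR (- (c3 * D)) <= 1.
    rewrite -expR0 ler_expR oppr_le0 mulr_ge0 ?(ltW D0) // /c3; move: V1 VN1; clear; lra.
  have e0 : 0 < expR (- (c3 * D)) by exact: expR_gt0.
  set e := expR (- (c3 * D)) in xiE e1 e0 ZUe.
  have vx : v0.+1%:R * xi <= 2^-1.
    apply: le_trans (_ : v0.+1%:R * expR (- D) <= _); last by move: vt1; clear; lra.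
    by rewrite ler_wpM2l // xiE ler_piMl // ltW.
  apply: le_trans (_ : 4 * Y * (2 * (v0.+1%:R * xi)) <= _).
    by rewrite ler_wpM2l ?pow_sub1_le ?mulr_ge0 // ltW.
  apply: le_trans (_ : e * (Y / (64 * d%:R)) <= _); last first.
    by rewrite ler_wpM2r // divr_ge0 ?mulr_ge0 // ltW.
  rewrite xiE [leRHS]mulrA ler_pdivlMr ?mulr_gt0 //.
  rewrite [leLHS](_ : _ = e * Y * (512 * (v0.+1%:R * d%:R) * expR (- D))); last by ring.
  by rewrite ler_piMr // mulr_ge0 // ltW.
have q21 : (8 * v0.+1 <= Z)%N.
  rewrite -(ler_nat R) natrM (expln _ Z0); apply: le_trans (_ : expR D <= _).
    apply: (poly _ 1%N) => //; rewrite expr1; apply: le_trans (_ : 8 * V * D <= _).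
      by move: vV; clear; lra.
    by rewrite ler_pM2r.
  by rewrite ler_expR; apply: le_trans ZL; move: bw6 l21 D1 VND; clear; lra.
have q22 : 4 * (v0.+1%:R + 2) <= Y / (32 * d%:R).
  rewrite ler_pdivlMr ?mulr_gt0 //; apply: le_trans YD; apply: (poly _ 2%N) => //.
  apply: le_trans (_ : 128 * ((V + 2) * D * (du * D)) <= _); last first.
    rewrite [leLHS](_ : _ = 128 * du * (V + 2) * D ^+ 2); last by ring.
    by rewrite ler_pM2r // exprn_gt0.
  rewrite [leLHS](_ : _ = 128 * ((v0.+1%:R + 2) * d%:R)); last by ring.
  rewrite ler_pM2l // ler_pM //.
  by move: vV D1; clear; lra.
have [q23a q23b] := blocks_capacity kl k4; rewrite -/hN in q23a q23b.
have dp : (0 < d)%N by rewrite -(ltr0n R).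
have dm1 : d.-1%:R = d%:R - 1 :> R by rewrite -subn1 natrB.
have two : expR (ln 2) = 2 :> R by rewrite lnK ?posrE.
have q23 : (dyadic_prod hN k)%:R <= expR tL / 2 * (K0%:R / 2 * (Y / 2) ^+ d.-1).
  apply: le_trans q23b _.
  apply: le_trans (_ : expR tL / 2 * (L2 / 2 / 2 * (Y / 2) ^+ d.-1) <= _); last first.
    rewrite ler_wpM2l ?divr_ge0 ?expR_ge0 // ler_wpM2r ?exprn_ge0 ?divr_ge0 ?(ltW Y0) //.
    by rewrite ler_wpM2r // invr_ge0.
  rewrite -{1 2 3 4}two /L2 /Y -!expRN -!expRD -expRM_natl -!expRD ler_expR dm1 /tL /XL.
  have ld2 : ln 2 / (2 * d%:R) <= ln 2 :> R.
    by rewrite ler_pdivrMr ?mulr_gt0 // ler_peMr ?(ltW l2) //; move: d1; clear; lra.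
  move: ld2; move: (ln 2 / (2 * d%:R) : R) => q; clear; lra.
exists k, v0.+1; split => //.
have FL := @finite_lower_bound R n d K0 U Z kap hN hQ k v0 kappa sigma beta xi A (7 * P).
rewrite dnE !L23 !(L13 sigma) -/L1 -/L2 -/Y in FL; cbv zeta in FL; rewrite TE in FL.
apply: le_trans (FL n0 od q1 q2 q3 K2 K1 q4 A25 q5 q6 q7 q8 q9 Z0 q11 q12 q13 q14 q15 q16
  xi0 xi1 q19 q20 q21 q22 q23 YL).
(* 56 = 8 * 7: the larger loss 8 Lam, with Lam = 7 P, is charged to all k + v primes. *)
have eL : 8 * (7 * P) = expR (ln (56 * P)).
  by rewrite lnK ?posrE; [ring | move: q8; clear; lra].
have t1 : expR (XL - 5 / 2 * k%:R - (k + v0.+1)%N%:R * ln (56 * P)) <=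
    (dyadic_prod hN k)%:R / ((2 * (7 * P)) ^+ k * (8 * (7 * P)) ^+ v0.+1).
  rewrite expRD; apply: ler_pM; rewrite ?expR_ge0 // expRN natrD mulrDl expRD !expRM_natl -eL.
  have p0 : 0 < 7 * P by move: q8; clear; lra.
  have p8 : 0 < (8 * (7 * P)) ^+ v0.+1 by apply/exprn_gt0; move: p0; clear; lra.
  have p2 : 0 < (2 * (7 * P)) ^+ k by apply/exprn_gt0; move: p0; clear; lra.
  have p3 : 0 < (8 * (7 * P)) ^+ k by apply/exprn_gt0; move: p0; clear; lra.
  rewrite lef_pV2 ?posrE; [|exact: mulr_gt0 p3 p8|exact: mulr_gt0 p2 p8].
  by rewrite ler_pM2r //; apply: lerXn2r; rewrite ?nnegrE; move: p0; clear; lra.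
have t2 : expR (sigma * (D * w) - D) <= Y / (128 * d%:R).
  rewrite expRD -/Y expRN ler_pM2l // lef_pV2 ?posrE ?expR_gt0 ?mulr_gt0 //.
  apply: (poly _ 1%N) => //; rewrite expr1; apply: le_trans (_ : 128 * du * D <= _).
    by move: ddu; clear; lra.
  by rewrite ler_pM2r.
have four : expR (2 * ln 2) = 4 :> R by rewrite mulr_natl mulr2n expRD two; ring.
have t3 : expR (d.-1%:R * ((kappa - dn^-1) * (D ^+ 2 * w) - 2 * ln 2 - sigma * (D * w))) =
    (L2 / (4 * Y)) ^+ d.-1.
  rewrite expRM_natl; congr (_ ^+ _); rewrite !expRB four -/L2 -/Y.
  by field; rewrite !gt_eqF.
have t4 : expR (- (dn^-1 * (D ^+ 2 * w) + ln 2 + d%:R * (2 * ln 2 + (kappa - dn^-1) * (D ^+ 2 * w)))) <=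
    ((L1 + 1) * (2 * L2 + 1) ^+ d)^-1.
  rewrite expRN !expRD expRM_natl expRD four two -/L1 -/L2.
  rewrite lef_pV2 ?posrE ?mulr_gt0 ?exprn_gt0 ?addr_gt0 ?mulr_gt0 //.
  apply: ler_pM; rewrite ?exprn_ge0 ?addr_ge0 ?mulr_ge0 ?(ltW L10) ?(ltW L20) //.
    by move: L1D ED8; clear; lra.
  apply: lerXn2r; rewrite ?nnegrE ?addr_ge0 ?mulr_ge0 ?(ltW L20) //.
  by move: L2_2; clear; lra.
rewrite -t3 PE'.
apply: le_trans (ler_pM _ _ (ler_pM _ _ (ler_pM _ _ t1 t2) (lexx _)) t4);
  rewrite ?mulr_ge0 ?expR_ge0 //.
(* The terms in D^2 w cancel: N gives kappa, the d - 1 free coefficients against d in the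
   denominator give -(kappa - 1/dn), and the bases give -1/dn. Of the terms in sigma D w exactly 2
   survive. *)
rewrite -!expRD ler_expR dm1 /XL.
set q := (k + v0.+1)%N%:R * ln (56 * P).
have ddl : d%:R * ln 2 <= d%:R :> R by rewrite ler_piMr.
move: kV ddl ddu l21 l2 D1; move: q (ln 2) (d%:R) => q l2' dd; clear; lra.
Qed.

(** * The limit *)

Definition lnln (R : realType) (n : nat) : R := ln (ln n%:R).

(** The scale D for which log n = D^3 w with w = log log n; in these variables L_n(1/3, c) and
    L_n(2/3, c) are exp (c D w) and exp (c D^2 w). *)
Definition lscale (R : realType) (n : nat) : R := (ln n%:R / lnln R n) `^ (1 / 3).

Lemma exprn_le_expR (R : realType) (C : R) (a : nat) :
  \forall x \near +oo, C * x ^+ a <= expR x.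
Proof.
near=> x.
have x0 : 0 < x by near: x; apply: nbhs_pinfty_gt; exact: num_real.
have xC : C * (a.+1)`!%:R <= x by near: x; apply: nbhs_pinfty_ge; exact: num_real.
apply: le_trans (_ : x ^+ a.+1 / (a.+1)`!%:R <= _).
  rewrite ler_pdivlMr ?ltr0n ?fact_gt0 // exprS mulrAC.
  by rewrite ler_wpM2r // exprn_ge0 // ltW.
by apply: le_trans (expR_ge1Dxn a (ltW x0)); rewrite lerDr.
Unshelve. all: by end_near.
Qed.

Lemma ln_cvg_pinfty (R : realType) : (ln x : R) @[x --> +oo] --> +oo.
Proof.
apply/cvgryPge => A; near=> x.
rewrite -ler_expR lnK ?posrE; last by near: x; apply: nbhs_pinfty_gt; exact: num_real.
by near: x; apply: nbhs_pinfty_ge; exact: num_real.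
Unshelve. all: by end_near.
Qed.

Lemma lnln_cvg_pinfty (R : realType) : lnln R n @[n --> \oo] --> +oo.
Proof.
apply: (@cvg_comp _ _ _ (fun n : nat => ln n%:R : R) (fun x => ln x)); last exact: ln_cvg_pinfty.
by apply: (@cvg_comp _ _ _ (fun n : nat => n%:R : R) (fun x => ln x)); [exact: cvgr_idn | exact: ln_cvg_pinfty].
Qed.

Lemma lscaleP (R : realType) (n : nat) : 0 < lnln R n ->
  let w := lnln R n in let D := lscale R n in
  [/\ 0 < D, ln n%:R = D ^+ 3 * w,
      forall c, Lnfun n (1 / 3) c = expR (c * (D * w)) &
      forall c, Lnfun n (2 / 3) c = expR (c * (D ^+ 2 * w))].
Proof.
move=> w0 w D.
have ln0 : 0 < ln n%:R :> R.
  (* [ln] is 0 by convention at nonpositive arguments. *)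
  rewrite ltNge; apply/negP => h; move: w0; rewrite /lnln ln0 ?ltxx //.
have q0 : 0 < ln n%:R / w by rewrite divr_gt0.
have D0 : 0 < D by rewrite /D /lscale powR_gt0.
have D3 : D ^+ 3 = ln n%:R / w.
  rewrite -powR_mulrn ?ltW // /D /lscale -powRrM (_ : 1 / 3 * 3%:R = 1) ?powRr1 ?ltW //.
  by field.
have lnE : ln n%:R = D ^+ 3 * w by rewrite D3 divfK // gt_eqF.
have Da (a : R) : (D ^+ 3) `^ a = D `^ (3%:R * a) by rewrite -(powR_mulrn 3 (ltW D0)) powRrM.
have wa (a : R) : w `^ a * w `^ (1 - a) = w.
  rewrite -powRD; last by rewrite (gt_eqF w0) implybT.
  by rewrite addrC subrK powRr1 // ltW.
split => // c; rewrite /Lnfun -/(lnln R n) -/w lnE powRM ?exprn_ge0 ?ltW // Da.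
  rewrite (_ : 3%:R * (1 / 3) = 1); last by field.
  by rewrite powRr1 ?ltW // -!mulrA wa.
rewrite (_ : 3%:R * (2 / 3) = 2%:R); last by field.
by rewrite powR_mulrn ?ltW // -!mulrA wa.
Qed.

(** Cubing and multiplying by w turns the claim into |C|^3 w^4 <= D^3 w = log n = exp w. *)
Lemma lscale_growth (R : realType) (C : R) : \forall n \near \oo, C * lnln R n <= lscale R n.
Proof.
have wy := @lnln_cvg_pinfty R.
have h := wy _ (@exprn_le_expR R (`|C| ^+ 3) 4).
near=> n.
have w0 : 0 < lnln R n by near: n; exact: (cvgry_gt wy).
have hE : `|C| ^+ 3 * lnln R n ^+ 4 <= expR (lnln R n) by near: n; exact: h.
have [D0 lnE _ _] := lscaleP w0.
have ln0 : 0 < ln n%:R :> R by rewrite lnE mulr_gt0 // exprn_gt0.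
apply: le_trans (_ : `|C| * lnln R n <= _); first by rewrite ler_pM2r // ler_norm.
rewrite -(@ler_pXn2r _ 3) ?nnegrE ?mulr_ge0 ?(ltW D0) ?(ltW w0) //.
rewrite -(ler_pM2r w0) -lnE exprMn -mulrA -exprSr; apply: le_trans hE _.
by rewrite /lnln lnK.
Unshelve. all: by end_near.
Qed.

Lemma lscale_cvg_pinfty (R : realType) : lscale R n @[n --> \oo] --> +oo.
Proof.
apply/cvgryPge => A; near=> n.
apply: le_trans (_ : 1 * lnln R n <= _); last by near: n; exact: lscale_growth.
by rewrite mul1r; near: n; exact: (cvgry_ge (@lnln_cvg_pinfty R)).
Unshelve. all: by end_near.
Qed.

(** 3 log D + log w = w gives log (D w) = w/3 + (2/3) log w, the origin of the factor 1/3. The bound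
    log w <= 2 sqrt w makes the remainder w times a null sequence. *)
Lemma ln_mul_lscale_le (R : realType) (a : R) (n : nat) : 0 < a -> 0 < lnln R n ->
  ln (a * (lscale R n * lnln R n)) <=
    (ln a * (lnln R n)^-1 + 1 / 3 + 4 / 3 * Num.sqrt (lnln R n)^-1) * lnln R n.
Proof.
move=> a0 w0; set x := (lnln R n)^-1; have [D0 lnE _ _] := lscaleP w0.
have x0 : 0 < x by rewrite invr_gt0.
have s0 : 0 < Num.sqrt x by rewrite sqrtr_gt0.
rewrite !lnM ?posrE ?mulr_gt0 //.
have wE : 3 * ln (lscale R n) + ln (lnln R n) = lnln R n.
  by rewrite {2}/lnln lnE lnM ?posrE ?exprn_gt0 // lnXn // mulr_natl.
have lw : ln (lnln R n) <= 2 * Num.sqrt x * lnln R n.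
  have sE : Num.sqrt x ^+ 2 = x by rewrite sqr_sqrtr // ltW.
  have wS : lnln R n = (Num.sqrt x)^-1 ^+ 2 by rewrite exprVn sE invrK.
  have -> : ln (lnln R n) = 2 * ln (Num.sqrt x)^-1 by rewrite wS lnXn ?invr_gt0 // mulr_natl.
  have h : ln (Num.sqrt x)^-1 <= (Num.sqrt x)^-1 - 1 by apply: ln_le_sub1; rewrite invr_gt0.
  have -> : 2 * Num.sqrt x * lnln R n = 2 * (Num.sqrt x)^-1.
    by rewrite wS; field; exact: lt0r_neq0.
  by lra.
have -> : (ln a * x + 1 / 3 + 4 / 3 * Num.sqrt x) * lnln R n =
  ln a + lnln R n / 3 + 2 / 3 * (2 * Num.sqrt x * lnln R n).
  by rewrite /x; field; exact: lt0r_neq0.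
by lra.
Qed.

(** Turns a bound for a number of blocks into D times a sequence with a visible limit. *)
Lemma div_scale_le (R : realType) (tot r b c D w : R) :
  0 < D -> 0 < w -> 0 < b - c * w^-1 -> tot <= r * (D ^+ 2 * w) ->
  tot / ((b * w - c) * D) + 1 <= (r / (b - c * w^-1) + D^-1) * D.
Proof.
move=> D0 w0 b0 h.
have bE : b * w - c = (b - c * w^-1) * w by rewrite mulrBl mulfVK ?lt0r_neq0.
rewrite bE; move: b0; move: (b - c * w^-1) => q q0.
rewrite [leRHS]mulrDl mulVf ?lt0r_neq0 // lerD2r ler_pdivrMr ?mulr_gt0 //.
apply: le_trans h _; rewrite le_eqVlt; apply/orP; left; apply/eqP.
by field; exact: lt0r_neq0.
Qed.

Lemma expected_lower_bound (R : realType) (delta kappa sigma beta : R) (d : nat -> nat) :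
  0 < delta -> 0 < kappa -> 0 < sigma -> 0 < beta -> (forall n, odd (d n)) ->
  delta_of R n (d n) @[n --> \oo] --> delta ->
  delta^-1 < kappa -> delta^-1 < (kappa + sigma * delta) / 2 ->
  exists2 G : nat -> R,
    G n @[n --> \oo] --> 2 * sigma - (delta^-1 + (kappa + sigma * delta)) / (3 * beta) &
    \forall n \near \oo, Lnfun n (1 / 3) (G n) <= expected_card_X n (d n) kappa sigma beta beta.
Proof.
move=> de0 ka0 si0 be0 od dcv h1 h2.
pose dn n := delta_of R n (d n); pose w := lnln R; pose D := lscale R.
pose x n := (w n)^-1; pose z n := (D n)^-1.
have wy : w n @[n --> \oo] --> +oo := @lnln_cvg_pinfty R.
have Dy : D n @[n --> \oo] --> +oo := @lscale_cvg_pinfty R.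
have xc : x n @[n --> \oo] --> 0 by apply/gtr0_cvgV0 => //; exact: (cvgry_gt wy).
have zc : z n @[n --> \oo] --> 0 by apply/gtr0_cvgV0 => //; exact: (cvgry_gt Dy).
have sc : Num.sqrt (x n) @[n --> \oo] --> (0 : R).
  rewrite -[X in _ --> X](@sqrtr0 R).
  by apply: (@continuous_cvg _ _ _ _ _ _ Num.sqrt); [exact: sqrt_continuous|].
(* As [dn] merely tends to delta, fixed bounds dl <= dn <= du, valid for large n, enter the
   constants. *)
pose dl := delta / 2; pose du := 2 * delta; pose k0 := (kappa - delta^-1) / 2.
pose V := 2 * (dl^-1 + sigma) / beta + 1; pose VN := 2 * (kappa + sigma * du) / beta + 1.
pose c1 := 4 * V + 2; pose c2 := 5 * V + VN + 6; pose c5 := 5 * du + 5 / 2 * VN + 5.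
have dVc : (dn n)^-1 @[n --> \oo] --> delta^-1 by apply: cvgV => //; exact: lt0r_neq0.
(* Divided by D, the number of primes in q is at most r1 and that in N at most r2, while r3 is a
   lower bound for the blocks available to N; y bounds the logarithm of the loss per prime, divided
   by w. *)
pose r1 n := ((dn n)^-1 + sigma * z n) / (beta - c1 * x n) + z n.
pose r2 n := (kappa + sigma * dn n) / (beta - c2 * x n) + z n.
pose r3 n := (kappa + sigma * dn n - (dn n + 3 * z n) * (z n * x n)) / beta.
pose y n := ln (56 * beta) * x n + 1 / 3 + 4 / 3 * Num.sqrt (x n).
have bc (c : R) : beta - c * x n @[n --> \oo] --> beta.
  rewrite -[X in _ --> X]subr0; apply: cvgB; first exact: cvg_cst.
  by rewrite -[X in _ --> X](mulr0 c); apply: cvgMr.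
have r1c : r1 n @[n --> \oo] --> delta^-1 / beta.
  rewrite -[X in _ --> X]addr0; apply: cvgD => //; apply: cvgM.
    rewrite -[X in _ --> X]addr0; apply: cvgD => //.
    by rewrite -[X in _ --> X](mulr0 sigma); apply: cvgMr.
  by apply: cvgV => //; exact: lt0r_neq0.
have kc : kappa + sigma * dn n @[n --> \oo] --> kappa + sigma * delta.
  by apply: cvgD; [exact: cvg_cst | apply: cvgMr].
have r2c : r2 n @[n --> \oo] --> (kappa + sigma * delta) / beta.
  rewrite -[X in _ --> X]addr0; apply: cvgD => //; apply: cvgM => //.
  by apply: cvgV => //; exact: lt0r_neq0.
have r3c : r3 n @[n --> \oo] --> (kappa + sigma * delta) / beta.
  apply: cvgMl; rewrite -[X in _ --> X]subr0; apply: cvgB => //.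
  rewrite -[X in _ --> X](mulr0 delta); apply: cvgM.
    rewrite -[X in _ --> X]addr0; apply: cvgD => //.
    by rewrite -[X in _ --> X](mulr0 (3 : R)); apply: cvgMr.
  by rewrite -[X in _ --> X](mulr0 (0 : R)); apply: cvgM.
have yc : y n @[n --> \oo] --> (1 / 3 : R).
  rewrite -[X in _ --> X]addr0; apply: cvgD; last first.
    by rewrite -[X in _ --> X](mulr0 (4 / 3 : R)); apply: cvgMr.
  rewrite -[X in _ --> X]add0r; apply: cvgD; last exact: cvg_cst.
  by rewrite -[X in _ --> X](mulr0 (ln (56 * beta))); apply: cvgMr.
pose G n := 2 * sigma - (r1 n + r2 n) * y n - c5 * x n.
exists G.
  have -> : 2 * sigma - (delta^-1 + (kappa + sigma * delta)) / (3 * beta) =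
    2 * sigma - (delta^-1 / beta + (kappa + sigma * delta) / beta) * (1 / 3) - c5 * 0.
    by field; rewrite !lt0r_neq0.
  apply: cvgB; last by apply: cvgMr.
  apply: cvgB; first exact: cvg_cst.
  by apply: cvgM => //; apply: cvgD.
(* The second hypothesis leaves a positive gap, into which 2 delta^-1 / (kap + 1) fits for large
   kap. *)
have [kap hk] : exists kap : nat,
    (2 + 2 / kap.+1%:R) * (delta^-1 / beta) + 2 * 0 < (kappa + sigma * delta) / beta.
  have g0 : 0 < kappa + sigma * delta - 2 * delta^-1 by lra.
  exists (Num.truncn (2 * delta^-1 / (kappa + sigma * delta - 2 * delta^-1))).
  set N := (Num.truncn _).+1.
  have h : 2 * delta^-1 / (kappa + sigma * delta - 2 * delta^-1) < N%:R by exact: truncnS_gt.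
  rewrite mulr0 addr0 mulrA ltr_pM2r ?invr_gt0 //.
  rewrite ltr_pdivrMr // [ltRHS]mulrC -ltr_pdivrMr // in h.
  have -> : (2 + 2 / N%:R) * delta^-1 = 2 * delta^-1 + 2 * delta^-1 / N%:R by ring.
  by lra.
have gapc : r3 n - ((2 + 2 / kap.+1%:R) * r1 n + 2 * z n) @[n --> \oo] -->
    (kappa + sigma * delta) / beta - ((2 + 2 / kap.+1%:R) * (delta^-1 / beta) + 2 * 0).
  by apply: cvgB => //; apply: cvgD; apply: cvgMr.
have cap (a b : R) : 0 < b -> \forall C \near +oo, a <= b * C.
  move=> b0; apply: filterS (nbhs_pinfty_ge (num_real (a / b))) => C.
  by rewrite ler_pdivrMr // mulrC.
have cap1 (a : R) : \forall C \near +oo, a <= C by apply: nbhs_pinfty_ge; exact: num_real.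
have dl0 : 0 < dl by rewrite divr_gt0.
have du0 : 0 < du by rewrite mulr_gt0.
have k00 : 0 < k0 by rewrite divr_gt0 // subr_gt0.
have [A A25] : exists A : R, 2500 <= A by exists 2500.
have dlE : dl < delta by rewrite /dl; lra.
have duE : delta < du by rewrite /du; lra.
have k0E : k0 < kappa - delta^-1 by rewrite /k0; lra.
(* C is fixed before n: it dominates constants made from the parameters, and w and D/w then dominate
   C. *)
near (pinfty_nbhs R) => C.
have C0 : 2 * (5 * V + VN + 6) <= beta * C by near: C; exact: cap.
have C1 : 1 <= sigma * C by near: C; exact: cap.
have C2 : 2 * (du + 3) <= kappa * C by near: C; exact: cap.
have C3 : 2 * beta ^+ 2 <= C * kappa by rewrite [leRHS]mulrC; near: C; exact: cap.
have C4 : 5 * V + 3 * VN + 13 <= beta * C by near: C; exact: cap.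
have C5 : sigma + 2 <= k0 * C by near: C; exact: cap.
have C6 : (35 * V + 14 * VN + 80) * kap.+1%:R + (5 * V + 2 * VN + 12) <= beta * C by near: C; exact: cap.
have C7 : A ^+ 2 <= C by near: C; exact: cap1.
have C8 : beta ^+ 2 * du <= C by near: C; exact: cap1.
have C10 : 4 * du + 8 <= C by near: C; exact: cap1.
have C11 : 56 * beta <= C by near: C; exact: cap1.
have C12 : 56 * beta * sigma <= C by near: C; exact: cap1.
have C13 : (48 * (kap + 3) ^ kap.+1)%:R <= C by near: C; exact: cap1.
have C14 : 512 * V * du <= C by near: C; exact: cap1.
have C15 : 8 * V <= C by near: C; exact: cap1.
have C16 : 128 * du * (V + 2) <= C by near: C; exact: cap1.
have C17 : 128 * du <= C by near: C; exact: cap1.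
near=> n.
have w0 : 0 < w n by near: n; exact: (cvgry_gt wy).
have dln : dl <= dn n by near: n; exact: (cvgr_ge delta).
have dnu : dn n <= du by near: n; exact: (cvgr_le delta).
have k0k : k0 <= kappa - (dn n)^-1.
  near: n; apply: (cvgr_ge (kappa - delta^-1)) => //.
  by apply: cvgB => //; exact: cvg_cst.
have Cw : C <= w n by near: n; exact: (cvgry_ge wy).
have CD : C * w n <= D n by near: n; exact: lscale_growth.
have CE : C * D n ^+ 6 <= expR (D n) by near: n; exact: (Dy _ (exprn_le_expR C 6)).
have y0 : 0 < y n by near: n; apply: (cvgr_gt _ yc); rewrite divr_gt0.
have gap : 0 < r3 n - ((2 + 2 / kap.+1%:R) * r1 n + 2 * z n).
  by near: n; apply: (cvgr_gt _ gapc); rewrite subr_gt0.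
have b1 : 0 < beta - c1 * x n by near: n; exact: (cvgr_gt _ (bc c1)).
have b2 : 0 < beta - c2 * x n by near: n; exact: (cvgr_gt _ (bc c2)).
have r30 : 0 < r3 n by near: n; apply: (cvgr_gt _ r3c); rewrite divr_gt0 // addr_gt0 // mulr_gt0.
have n0 : (0 < n)%N by near: n; exact: nbhs_infty_gt.
have [D0 lnE L13 L23] := lscaleP w0.
have dE : (d n)%:R = dn n * D n by rewrite /dn /delta_of -/(lnln R n) -/(lscale R n) divfK ?lt0r_neq0.
have ln20 : 0 < ln (2 : R) by rewrite ln_gt0 // ltr1n.
have dn0 : 0 < dn n by exact: lt_le_trans dln.
have zD : z n * D n = 1 by rewrite mulVf ?lt0r_neq0.
have xw : x n * w n = 1 by rewrite mulVf ?lt0r_neq0.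
have tLb : ((dn n)^-1 * (D n ^+ 2 * w n) + sigma * (D n * w n) - ln 2 / (2 * (d n)%:R)) /
    ((beta * w n - c1) * D n) + 1 <= r1 n * D n.
  apply: div_scale_le => //.
  have -> : ((dn n)^-1 + sigma * z n) * (D n ^+ 2 * w n) =
    (dn n)^-1 * (D n ^+ 2 * w n) + z n * D n * (sigma * (D n * w n)) by ring.
  rewrite zD mul1r; have : 0 <= ln 2 / (2 * (d n)%:R) :> R by rewrite divr_ge0 ?mulr_ge0 // ltW.
  by clear; lra.
pose XL := kappa * (D n ^+ 2 * w n) + (d n)%:R * (sigma * (D n * w n)) - ((d n)%:R + 3) * ln 2.
have XLE : XL = (kappa + sigma * dn n) * (D n ^+ 2 * w n) - ((d n)%:R + 3) * ln 2.
  by rewrite /XL dE; ring.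
have XLb : XL / ((beta * w n - c2) * D n) + 1 <= r2 n * D n.
  by apply: div_scale_le => //; rewrite XLE gerBl mulr_ge0 ?addr_ge0 // ltW.
have XLl : r3 n * D n <= XL / ((beta * w n - c2) * D n).
  have bw : 0 < (beta * w n - c2) * D n.
    by rewrite mulr_gt0 // (_ : beta * w n - c2 = (beta - c2 * x n) * w n) ?mulr_gt0 // mulrBl -mulrA xw mulr1.
  have c20 : 0 <= c2.
    have V0 : 0 <= V.
      by rewrite addr_ge0 // divr_ge0 ?(ltW be0) // mulr_ge0 // addr_ge0 ?invr_ge0 ?(ltW dl0) ?(ltW si0).
    have VN0 : 0 <= VN.
      have kd : 0 <= kappa + sigma * du := addr_ge0 (ltW ka0) (mulr_ge0 (ltW si0) (ltW du0)).
      by rewrite addr_ge0 // divr_ge0 ?(ltW be0) // mulr_ge0.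
    by rewrite /c2; move: V0 VN0; clear; lra.
  rewrite ler_pdivlMr // XLE; apply: le_trans (_ : r3 n * D n * (beta * w n * D n) <= _).
    apply: ler_wpM2l; first by rewrite mulr_ge0 // ltW.
    by rewrite ler_pM2r // gerBl.
  rewrite (_ : r3 n * D n * (beta * w n * D n) = (kappa + sigma * dn n) * (D n ^+ 2 * w n) -
     (dn n * (D n) + 3 * (z n * D n)) * (z n * D n) * (x n * w n)); last first.
    by rewrite /r3; field; exact: lt0r_neq0.
  rewrite zD xw -dE !mulr1 lerD2l lerN2 ler_piMr ?addr_ge0 //.
  exact: ln2_le1.
have [|k [v [kt vt]]] := explicit_bound (kap := kap) n0 (od n) (erefl : delta_of R n (d n) = dn n) dE lnE L13 L23
  be0 si0 ka0 dl0 dln dnu k00 k0k erefl erefl A25 C7 C0 C1 C8 C3 C2 C4 C5 C10 C11 C12 C13 C6 C14 C15 C16 C17 Cw CD CE.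
  apply: le_trans XLl; apply: le_trans (_ : (2 + 2 / kap.+1%:R) * (r1 n * D n) + 2 * (z n * D n) <= _).
    by rewrite zD mulr1 lerD2r ler_wpM2l.
  by rewrite !mulrA -mulrDl ler_pM2r // -subr_ge0 ltW.
apply: le_trans; rewrite L13 ler_expR.
have kv : (k + v)%N%:R <= (r1 n + r2 n) * D n.
  by rewrite natrD addrC mulrDl lerD // ?(le_trans vt) ?(le_trans kt).
have lb : ln (56 * (beta * (D n * w n))) <= y n * w n.
  by rewrite mulrA; apply: ln_mul_lscale_le => //; rewrite mulr_gt0.
have yw : 0 <= y n * w n by rewrite mulr_ge0 // ltW.
have kvl : (k + v)%N%:R * ln (56 * (beta * (D n * w n))) <= (r1 n + r2 n) * D n * (y n * w n).
  by apply: le_trans (_ : (k + v)%N%:R * (y n * w n) <= _); [rewrite ler_wpM2l | rewrite ler_wpM2r].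
have -> : G n * (D n * w n) = 2 * sigma * (D n * w n) - (r1 n + r2 n) * D n * (y n * w n) - c5 * (x n * w n) * D n.
  by rewrite /G; ring.
by rewrite xw mulr1 lerD2r lerD2l lerN2.
Unshelve. all: by end_near.
Qed.

Theorem theorem5p1 (R : realType) (delta kappa sigma beta beta' : R)
    (d : nat -> nat)
    (delta_gt0 : 0 < delta) (kappa_gt0 : 0 < kappa) (sigma_gt0 : 0 < sigma)
    (beta_gt0 : 0 < beta) (beta'_gt0 : 0 < beta')
    (d_odd : forall n, odd (d n))
    (d_delta : delta_of R n (d n) @[n --> \oo] --> delta)
    (beta_eq : beta = beta')
    (h1 : kappa > delta^-1)
    (h2 : delta^-1 < (kappa + sigma * delta) / 2)
    (h3 : 2 * sigma > Num.max beta beta' + delta^-1 / (3 * beta)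
                      + (sigma * delta + kappa) / (3 * beta')) :
  exists e1 e2 : nat -> R,
    [/\ e1 n @[n --> \oo] --> 0,
        e2 n @[n --> \oo] --> 0 &
        \forall n \near \oo,
          expected_card_X n (d n) kappa sigma beta beta' >=
          Lnfun n (1 / 3)
            (2 * sigma - delta^-1 / (3 * beta') * (1 + e1 n)
             - (sigma * delta + kappa) / (3 * beta) * (1 + e2 n))].
Proof.
rewrite -beta_eq.
have [G Gc GE] := expected_lower_bound delta_gt0 kappa_gt0 sigma_gt0 beta_gt0 d_odd d_delta h1 h2.
pose A := delta^-1 / (3 * beta); pose A2 := (sigma * delta + kappa) / (3 * beta).
have A0 : A != 0 by rewrite mulf_neq0 ?invr_eq0 ?mulf_neq0 ?lt0r_neq0.
(* [e1] carries the whole deviation of G from its limit, its coefficient A being nonzero. *)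
exists (fun n => (2 * sigma - A2 - G n) / A - 1), (fun=> 0); split; last 2 first.
- exact: cvg_cst.
- apply: filterS GE => n; congr (_ <= _); congr (Lnfun _ _ _).
  by rewrite -/A -/A2; field.
have -> : 0 = (2 * sigma - A2 - (2 * sigma - (delta^-1 + (kappa + sigma * delta)) / (3 * beta))) / A - 1.
  by rewrite /A /A2; field; rewrite !lt0r_neq0.
apply: cvgB; last exact: cvg_cst.
by apply: cvgMl; apply: cvgB => //; exact: cvg_cst.
Qed.
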